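(* Let $L^{m}$ be an $m$-dimensional Einstein manifold, let $\lambda\ge 0$ be a real constant, and let $\varphi:M^{m}\to L^{m}\times\mathbb{R}$ be a $\lambda$-biharmonic hypersurface with constant mean curvature $H$. Then $M^{m}$ is minimal (i.e. $H\equiv 0$), or $M^{m}$ is a vertical cylinder over a $\lambda$-biharmonic hypersurface in $L^{m}$.
   Context: Manifolds are smooth and, as usual, connected. $L^m$ Einstein means $\mathrm{Ric}^{L}=\mu g^{L}$ with $\mu$ a constant; $L^m\times\mathbb{R}$ carries the product metric $g^{L}+dt^2$. For a smooth map $\varphi:(M,g)\to (Q,g^Q)$ of Riemannian manifolds, the tension field is $\tau(\varphi)=\mathrm{tr}_g(\nabla d\varphi)$ and the bitension field is $\tau_2(\varphi)=\mathrm{tr}_g(\nabla^\varphi\nabla^\varphi-\nabla^\varphi_{\nabla^M})\tau(\varphi)-\mathrm{tr}_g\widetilde R(d\varphi,\tau(\varphi))d\varphi$, where $\nabla^\varphi$ is the induced connection on $\varphi^{-1}TQ$, $\nabla^M$ the Levi-Civita connection of $M$, and $\widetilde R(X,Y)Z=\widetilde\nabla_X\widetilde\nabla_YZ-\widetilde\nabla_Y\widetilde\nabla_XZ-\widetilde\nabla_{[X,Y]}Z$ the curvature of $Q$. For a real constant $\lambda$, $\varphi$ is called $\lambda$-biharmonic if $\tau_2(\varphi)-\lambda\tau(\varphi)=0$ (equivalently, $\varphi$ is a critical point of $E_2+\lambda E$, with $E$ the energy and $E_2$ the bienergy). A $\lambda$-biharmonic hypersurface is a codimension-one isometric immersion that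 is a $\lambda$-biharmonic map. A hypersurface $\varphi:M^m\to L^m\times\mathbb{R}$ has unit normal field $\xi$, shape operator $A$ and mean curvature $H=\frac1m\mathrm{tr}A$. A vertical cylinder over a hypersurface $\bar M^{m-1}$ of $L^m$ is (an open part of) $\bar M^{m-1}\times\mathbb{R}\subset L^m\times\mathbb{R}$, in the local sense: every point of $M$ has a neighbourhood whose image is an open subset of such a product; equivalently $\partial_t$ is everywhere tangent to $M$. The $\lambda$ for the hypersurface in $L^m$ is the same $\lambda$. *)

(* Defs.v *)
From HB Require Import structures.
From mathcomp Require Import all_boot all_order all_algebra.
From mathcomp Require Import all_classical all_reals all_analysis.
Import Order.TTheory GRing.Theory Num.Theory.
Import numFieldNormedType.Exports.

Set Implicit Arguments.
Unset Strict Implicit.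
Unset Printing Implicit Defensive.

Local Open Scope classical_set_scope.
Local Open Scope ring_scope.

(* Tangent vectors and points of a coordinate domain are row vectors, with
   coordinate basis ['e_i].  Functions defined on a coordinate domain are total
   functions on ['rV[R]_n], used only at points of an open set, where their
   derivatives do not depend on the values outside it. *)

Section LocalFormulas.
Context {R : realType}.

Definition partial {n} {V : normedModType R} (i : 'I_n) (f : 'rV[R]_n -> V)
  : 'rV[R]_n -> V := fun x => 'D_('e_i) f x.

(* C^infinity on an open set U: all iterated partial derivatives are
   (Frechet) differentiable at every point of U. *)
Definition smooth_on {n} {V : normedModType R} (U : set 'rV[R]_n)
    (f : 'rV[R]_n -> V) : Prop :=
  forall (s : seq 'I_n) x, U x -> differentiable (foldr partial f s) x.

Definition inner {n} (G : 'M[R]_n) (u v : 'rV[R]_n) : R :=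
  (u *m G *m v^T) 0 0.

Definition pullback_metric {n q} (h : 'rV[R]_q -> 'M[R]_q)
    (f : 'rV[R]_n -> 'rV[R]_q) (x : 'rV[R]_n) : 'M[R]_n :=
  \matrix_(i, j) inner (h (f x)) (partial i f x) (partial j f x).

(* [christoffel g k i j] is Gamma^k_{ij} of the Levi-Civita connection. *)
Definition christoffel {n} (g : 'rV[R]_n -> 'M[R]_n) (k i j : 'I_n)
    (x : 'rV[R]_n) : R :=
  2^-1 * \sum_l invmx (g x) k l *
    (partial i (fun y => g y j l) x + partial j (fun y => g y i l) x
     - partial l (fun y => g y i j) x).

Definition christoffel_form {n} (g : 'rV[R]_n -> 'M[R]_n) (x u v : 'rV[R]_n)
  : 'rV[R]_n :=
  \row_k \sum_i \sum_j christoffel g k i j x * u 0 i * v 0 j.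

(* Induced connection on sections of f^{-1}TQ, h being the metric of Q.
   For f = id it is the Levi-Civita connection of h. *)
Definition cov {n q} (h : 'rV[R]_q -> 'M[R]_q) (f : 'rV[R]_n -> 'rV[R]_q)
    (u : 'rV[R]_n) (V : 'rV[R]_n -> 'rV[R]_q) : 'rV[R]_n -> 'rV[R]_q :=
  fun x => 'D_u V x + christoffel_form h (f x) ('D_u f x) (V x).

(* R(u,v)w, computed on the vector fields with constant components u, v, w,
   for which the bracket [u,v] vanishes. *)
Definition curvature {q} (h : 'rV[R]_q -> 'M[R]_q) (x u v w : 'rV[R]_q)
  : 'rV[R]_q :=
  cov h id u (cov h id v (cst w)) x - cov h id v (cov h id u (cst w)) x.

(* Ric(Y,Z) = tr (X |-> R(X,Y)Z) *)
Definition ricci {q} (h : 'rV[R]_q -> 'M[R]_q) (x : 'rV[R]_q) : 'M[R]_q :=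
  \matrix_(i, j) \sum_k (curvature h x 'e_k 'e_i 'e_j) 0 k.

(* tr_g (nabla d f) *)
Definition tension {n q} (g : 'rV[R]_n -> 'M[R]_n) (h : 'rV[R]_q -> 'M[R]_q)
    (f : 'rV[R]_n -> 'rV[R]_q) : 'rV[R]_n -> 'rV[R]_q :=
  fun x => \sum_i \sum_j invmx (g x) i j *:
    (cov h f 'e_i (partial j f) x
     - \sum_k christoffel g k i j x *: partial k f x).

(* tr_g (nabla^f nabla^f - nabla^f_{nabla^M}) V *)
Definition rough_laplacian {n q} (g : 'rV[R]_n -> 'M[R]_n)
    (h : 'rV[R]_q -> 'M[R]_q) (f : 'rV[R]_n -> 'rV[R]_q)
    (V : 'rV[R]_n -> 'rV[R]_q) : 'rV[R]_n -> 'rV[R]_q :=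
  fun x => \sum_i \sum_j invmx (g x) i j *:
    (cov h f 'e_i (cov h f 'e_j V) x
     - \sum_k christoffel g k i j x *: cov h f 'e_k V x).

Definition bitension {n q} (g : 'rV[R]_n -> 'M[R]_n) (h : 'rV[R]_q -> 'M[R]_q)
    (f : 'rV[R]_n -> 'rV[R]_q) : 'rV[R]_n -> 'rV[R]_q :=
  fun x => rough_laplacian g h f (tension g h f) x
    - \sum_i \sum_j invmx (g x) i j *:
        curvature h (f x) (partial i f x) (tension g h f x) (partial j f x).

Definition unit_normal_on {n q} (h : 'rV[R]_q -> 'M[R]_q)
    (f : 'rV[R]_n -> 'rV[R]_q) (V : set 'rV[R]_n) (nu : 'rV[R]_n -> 'rV[R]_q)
  : Prop :=
  [/\ smooth_on V nu,
      forall x, V x -> inner (h (f x)) (nu x) (nu x) = 1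
    & forall x i, V x -> inner (h (f x)) (partial i f x) (nu x) = 0].

(* The shape operator, A(e_i) = \sum_k A i k e_k, is determined by Weingarten's
   formula df (A X) = - nabla_X nu; pairing with df (e_j) gives
   A *m g = (- <nabla_{e_i} nu, df e_j>)_{ij}. *)
Definition shape_operator {n q} (g : 'rV[R]_n -> 'M[R]_n)
    (h : 'rV[R]_q -> 'M[R]_q) (f : 'rV[R]_n -> 'rV[R]_q)
    (nu : 'rV[R]_n -> 'rV[R]_q) (x : 'rV[R]_n) : 'M[R]_n :=
  (\matrix_(i, j) - inner (h (f x)) (cov h f 'e_i nu x) (partial j f x))
    *m invmx (g x).

Definition mean_curvature {n q} (g : 'rV[R]_n -> 'M[R]_n)
    (h : 'rV[R]_q -> 'M[R]_q) (f : 'rV[R]_n -> 'rV[R]_q)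
    (nu : 'rV[R]_n -> 'rV[R]_q) (x : 'rV[R]_n) : R :=
  \tr (shape_operator g h f nu x) / n%:R.

End LocalFormulas.

Record chart (R : realType) (T : Type) (n : nat) := Chart {
  dom : set T;
  coord : T -> 'rV[R]_n;
  param : 'rV[R]_n -> T   (* inverse of [coord], meaningful on its image *)
}.

Definition img (R : realType) (T : Type) (n : nat) (c : chart R T n)
  : set 'rV[R]_n := coord c @` dom c.

Definition is_chart (R : realType) (T : topologicalType) (n : nat)
    (c : chart R T n) : Prop :=
  [/\ open (dom c), open (img c),
      {within dom c, continuous (coord c)},
      {within img c, continuous (param c)}
    & forall p, dom c p -> param c (coord c p) = p].

(* The data of a Riemannian manifold: a space with an indexed atlas and, in
   each chart, the matrix (g_ij) of the metric.  The axioms are in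
   [riemannian_manifold]. *)
Record riemData (R : realType) (n : nat) := RiemData {
  carrier :> topologicalType;
  idx : Type;
  chart_at : idx -> chart R carrier n;
  metric : idx -> 'rV[R]_n -> 'M[R]_n
}.

Arguments chart_at {R n r} _.
Arguments metric {R n r} _ _.

Section Maps.
Context {R : realType} {n q : nat}.
Variables (M : riemData R n) (Q : riemData R q).
Implicit Type phi : M -> Q.

Definition loc_dom phi (c : idx M) (d : idx Q) : set 'rV[R]_n :=
  img (chart_at c) `&` [set x | dom (chart_at d) (phi (param (chart_at c) x))].

Definition loc phi (c : idx M) (d : idx Q) : 'rV[R]_n -> 'rV[R]_q :=
  fun x => coord (chart_at d) (phi (param (chart_at c) x)).

Definition smooth_map phi : Prop :=
  continuous phi /\ forall c d, smooth_on (loc_dom phi c d) (loc phi c d).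

Definition isometric phi : Prop :=
  forall c d x, loc_dom phi c d x ->
    metric c x = pullback_metric (metric d) (loc phi c d) x.

(* [phi] is an immersion because its pullback metric is positive definite. *)
Definition isometric_immersion phi : Prop := smooth_map phi /\ isometric phi.

Definition hypersurface phi : Prop := q = n.+1 /\ isometric_immersion phi.

Definition biharmonic (lambda : R) phi : Prop :=
  forall c d x, loc_dom phi c d x ->
    bitension (metric c) (metric d) (loc phi c d) x
    - lambda *: tension (metric c) (metric d) (loc phi c d) x = 0.

Definition biharmonic_hypersurface (lambda : R) phi : Prop :=
  hypersurface phi /\ biharmonic lambda phi.

(* [phi] has constant mean curvature H.  Since [tr A] changes sign with the unit
   normal, H is taken with respect to suitable unit normal fields defined
   locally; when a global unit normal field exists and its mean curvature is the
   constant H, its restrictions qualify. *)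
Definition constant_mean_curvature phi (H : R) : Prop :=
  forall c d x, loc_dom phi c d x ->
    exists V nu,
      [/\ open V, V x, V `<=` loc_dom phi c d,
          unit_normal_on (metric d) (loc phi c d) V nu
        & forall y, V y ->
            mean_curvature (metric c) (metric d) (loc phi c d) nu y = H].

Definition minimal phi : Prop := constant_mean_curvature phi 0.

End Maps.

Section Manifolds.
Context {R : realType} {n : nat}.
Variable M : riemData R n.

(* Smoothness of the transition maps and the transformation law of the metric
   are expressed by the identity of M being smooth and isometric. *)
Definition riemannian_manifold : Prop :=
  [/\ hausdorff_space M, @second_countable M & connected [set: M]] /\
  [/\ forall c : idx M, is_chart (chart_at c),
      forall p : M, exists c : idx M, dom (chart_at c) p
    & smooth_map (id : M -> M)] /\
  [/\ forall c : idx M, smooth_on (img (chart_at c)) (metric c),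
      forall (c : idx M) x, img (chart_at c) x -> (metric c x)^T = metric c x,
      forall (c : idx M) x u, img (chart_at c) x -> u != 0 ->
        0 < inner (metric c x) u u
    & isometric (id : M -> M)].

Definition einstein : Prop :=
  exists mu : R, forall (c : idx M) x, img (chart_at c) x ->
    ricci (metric c) x = mu *: metric c x.

End Manifolds.

(* L x R with the metric g^L + dt^2; in a chart, t is the last coordinate. *)
Definition chart_times_line (R : realType) (T : Type) (n : nat)
    (c : chart R T n) : chart R (T * R)%type (n + 1) :=
  Chart (dom c `*` setT)
        (fun p => row_mx (coord c p.1) (const_mx p.2))
        (fun y => (param c (lsubmx y), rsubmx y 0 0)).

Definition times_line (R : realType) (n : nat) (L : riemData R n)
  : riemData R (n + 1) :=
  RiemData (carrier := (L * R)%type)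
    (fun c : idx L => chart_times_line (chart_at c))
    (fun c y => block_mx (metric c (lsubmx y)) 0 0 1%:M).

(* [phi] is locally a vertical cylinder N x R over lambda-biharmonic
   hypersurfaces psi : N -> L; the base N may depend on the neighbourhood U. *)
Definition vertical_cylinder_over_biharmonic (R : realType) (m : nat)
    (L M : riemData R m) (lambda : R) (phi : M -> times_line L) : Prop :=
  forall p : M, exists (N : riemData R m.-1) (psi : N -> L),
    [/\ riemannian_manifold N, biharmonic_hypersurface lambda psi
      & exists (U : set M) (W : set (N * R)%type),
          [/\ open U, U p, open W
            & phi @` U = [set (psi q.1, q.2) | q in W]]].

(* Main.v *)
(* The tension field of a hypersurface with unit normal nu and constant tr A = c
   is c nu.  If c <> 0, the normal part of the lambda-biharmonic equation reads
   |A|^2 = Ric(nu, nu) - lambda and, the traced Codazzi equation eliminating the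
   derivatives of A, its tangential part says that Ric(nu, .) vanishes on the
   tangent space.  In L x R with L Einstein of constant mu, Ric(u, v) is mu times
   the inner product of the horizontal parts.  Writing theta = <nu, dt>, the
   normal equation gives mu (1 - theta^2) = |A|^2 + lambda > 0, so mu <> 0 and
   the tangential equation becomes theta dt(X) = 0 for X tangent.  If theta were
   nonzero, dt would be normal, so theta^2 = 1, a contradiction.  Hence theta = 0.

   The height and k linear functions of the horizontal part are then local
   coordinates on M (inverse function theorem) in which phi is
   (t, z) |-> (F z, t).  The slice z |-> F z has the same tr A and |A|^2 as phi,
   so F is again lambda-biharmonic, by the same two equations in L. *)

From HB Require Import structures.
Require Import Defs.
From mathcomp Require Import all_boot all_order all_algebra.
From mathcomp Require Import all_classical all_reals all_analysis.
From mathcomp Require Import ring lra.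
Import Order.TTheory GRing.Theory Num.Theory.
Import numFieldNormedType.Exports.
Set Implicit Arguments.
Unset Strict Implicit.
Unset Printing Implicit Defensive.
Local Open Scope classical_set_scope.
Local Open Scope ring_scope.

(** * Calculus on row vectors *)

(** The term |A|^2 is positive because tr A is nonzero: in an orthonormal basis it is a sum of
    squares that vanishes only together with A. The tangential equation is free of derivatives of A
    because commuting the second derivatives of nu trades its Laplacian for the gradient of the
    constant tr A plus a Ricci term. In the coordinates (t, z) the map F does not depend on t
    because dt is tangent: the t-derivative of phi is dt, whose horizontal part is zero. Two
    requirements shape the assembly. The slice has to be lambda-biharmonic in every chart of L,
    while unit normals are only given near a point and for one pair of charts. The constants mu, tr
    A and |A|^2 = mu - lambda do not depend on these choices, so the computation can be redone
    around each point in each chart. Moreover the base of the cylinder has to be a manifold with all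
    its data; it is a coordinate ball whose metric is induced from M through the slice. *)

Section PointwiseRules.
Context {R : realType} {V : normedModType R}.

Lemma is_derive_fin_sum (W : normedModType R) (I : finType) (F : I -> V -> W)
    (dF : I -> W) x v :
  (forall i, is_derive x v (F i) (dF i)) ->
  is_derive x v (fun y => \sum_i F i y) (\sum_i dF i).
Proof.
move=> H; rewrite (_ : (fun y => _) = \sum_i F i); last first.
  by apply/funext => y; rewrite fct_sumE.
by elim/big_ind2 : _ => // [|f df g dg]; [exact: is_derive_cst|exact: is_deriveD].
Qed.

Lemma is_derive_mul (f g : V -> R) x v df dg :
  is_derive x v f df -> is_derive x v g dg ->
  is_derive x v (fun y => f y * g y) (df * g x + f x * dg).
Proof.
by move=> hf hg; rewrite addrC [df * _]mulrC; exact: is_deriveM.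
Qed.

End PointwiseRules.

Section MatrixCalculus.
Context {R : realType} {V : normedModType R}.

Lemma differentiable_mxP m n (F : V -> 'M[R]_(m, n)) x :
  differentiable F x <-> forall i j, differentiable (fun y => F y i j) x.
Proof.
split=> [dF i j|dF].
  exact: (differentiable_comp dF (differentiable_coord (F x) i j)).
have -> : F = \sum_(i < m) \sum_(j < n) (fun y => F y i j *: delta_mx i j).
  apply/funext => y; rewrite fct_sumE [LHS]matrix_sum_delta.
  by apply: eq_bigr => i _; rewrite fct_sumE.
by do 2![apply: differentiable_sum => ?]; apply: differentiableZl.
Qed.

Lemma is_derive_mxP m n (F : V -> 'M[R]_(m, n)) x v dF :
  is_derive x v F dF <-> forall i j, is_derive x v (fun y => F y i j) (dF i j).
Proof.
split=> [[d <-] i j|H].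
  apply: DeriveDef; first by move/derivable_mxP : d; apply.
  by rewrite derive_mx// mxE.
have d : derivable F x v by apply/derivable_mxP => i j; have [] := H i j.
apply: DeriveDef => //; rewrite derive_mx//; apply/matrixP => i j; rewrite mxE.
by have [_ <-] := H i j.
Qed.

Lemma is_derive_mulmx m n p (F : V -> 'M[R]_(m, n)) (G : V -> 'M[R]_(n, p))
    x v dF dG :
  is_derive x v F dF -> is_derive x v G dG ->
  is_derive x v (fun y => F y *m G y) (dF *m G x + F x *m dG).
Proof.
move=> /is_derive_mxP HF /is_derive_mxP HG; apply/is_derive_mxP => i k.
under eq_fun do rewrite mxE; rewrite !mxE -big_split/=.
by apply: is_derive_fin_sum => j; apply: is_derive_mul.
Qed.

Lemma is_derive_tr m n (F : V -> 'M[R]_(m, n)) x v dF :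
  is_derive x v F dF -> is_derive x v (fun y => (F y)^T) dF^T.
Proof.
move=> /is_derive_mxP HF; apply/is_derive_mxP => i j.
by under eq_fun do rewrite mxE; rewrite mxE.
Qed.

Lemma is_derive_inner n (h : V -> 'M[R]_n) (Y Z : V -> 'rV[R]_n) x v dh dY dZ :
  is_derive x v h dh -> is_derive x v Y dY -> is_derive x v Z dZ ->
  is_derive x v (fun y => inner (h y) (Y y) (Z y))
    (inner (h x) dY (Z x) + inner dh (Y x) (Z x) + inner (h x) (Y x) dZ).
Proof.
move=> Hh HY HZ; have H := is_derive_mulmx (is_derive_mulmx HY Hh) (is_derive_tr HZ).
have /(_ 0 0) := (is_derive_mxP _ _ _ _).1 H.
by rewrite mulmxDl [(_ + _ *m dZ^T) _ _]mxE [(_ + _ *m (Z x)^T) _ _]mxE.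
Qed.

End MatrixCalculus.

Section DirectionalDerivatives.
Context {R : realType}.

(** The transpose of the usual Jacobian matrix: tangent vectors are rows, so the differential acts
    by multiplication on the right, and the rows of [jac f x] are the coordinate tangent vectors of
    [f]. *)
Definition jac {n q} (f : 'rV[R]_n -> 'rV[R]_q) (x : 'rV[R]_n) : 'M[R]_(n, q) :=
  \matrix_(i, j) partial i f x 0 j.

Lemma row_jac n q (f : 'rV[R]_n -> 'rV[R]_q) x i : row i (jac f x) = partial i f x.
Proof. by apply/rowP => j; rewrite !mxE. Qed.

Lemma deriveD_dir n (W : normedModType R) (f : 'rV[R]_n -> W) x (u v : 'rV[R]_n) :
  differentiable f x -> 'D_(u + v) f x = 'D_u f x + 'D_v f x.
Proof. by move=> df; rewrite !deriveE// linearD. Qed.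

Lemma deriveZ_dir n (W : normedModType R) (f : 'rV[R]_n -> W) x a (u : 'rV[R]_n) :
  differentiable f x -> 'D_(a *: u) f x = a *: 'D_u f x.
Proof. by move=> df; rewrite !deriveE// linearZ. Qed.

Lemma derive_partial n (W : normedModType R) (f : 'rV[R]_n -> W) x (u : 'rV[R]_n) :
  differentiable f x -> 'D_u f x = \sum_i u 0 i *: partial i f x.
Proof.
move=> df; rewrite deriveE// {1}(row_sum_delta u) linear_sum.
by apply: eq_bigr => i _; rewrite linearZ /partial deriveE.
Qed.

Lemma derive_jac n q (f : 'rV[R]_n -> 'rV[R]_q) x u :
  differentiable f x -> 'D_u f x = u *m jac f x.
Proof.
move=> df; rewrite derive_partial// mulmx_sum_row.
by apply: eq_bigr => i _; rewrite row_jac.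
Qed.

Lemma derive_comp (U V W : normedModType R) (f : U -> V) (g : V -> W) x u :
  differentiable f x -> differentiable g (f x) ->
  'D_u (fun y => g (f y)) x = 'D_('D_u f x) g (f x).
Proof.
move=> df dg; rewrite !deriveE//; last exact: differentiable_comp.
by rewrite (_ : (fun y => _) = g \o f)// diff_comp.
Qed.

Lemma is_derive_comp (U V W : normedModType R) (f : U -> V) (g : V -> W) x u :
  differentiable f x -> differentiable g (f x) ->
  is_derive x u (fun y => g (f y)) ('D_('D_u f x) g (f x)).
Proof.
move=> df dg; apply: DeriveDef; last exact: derive_comp.
exact/diff_derivable/differentiable_comp.
Qed.

End DirectionalDerivatives.

Section FiniteSmoothness.
Context {R : realType} {n : nat}.
Implicit Types (U : set 'rV[R]_n) (W : normedModType R).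

(* [ck k U f]: the iterated partial derivatives of [f] of order at most [k] are
   Frechet differentiable on [U]. *)
Fixpoint ck {W} (k : nat) U (f : 'rV[R]_n -> W) : Prop :=
  (forall x, U x -> differentiable f x) /\
  match k with 0 => True | k'.+1 => forall i, ck k' U (partial i f) end.

Lemma ck_diff W k U (f : 'rV[R]_n -> W) x : ck k U f -> U x -> differentiable f x.
Proof. by case: k => [|k] [df _] /df. Qed.

Lemma ck_partial W k U (f : 'rV[R]_n -> W) i : ck k.+1 U f -> ck k U (partial i f).
Proof. by case=> _; apply. Qed.

Lemma ckW W k U (f : 'rV[R]_n -> W) : ck k.+1 U f -> ck k U f.
Proof. by elim: k f => [|k IH] f [df H]; split => // i; apply/IH/H. Qed.

(** [foldr] puts the last entry of the list innermost, and [ck] peels off the innermost derivative,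
    so lists are taken apart from the right. *)
Lemma smooth_onP W U (f : 'rV[R]_n -> W) : smooth_on U f <-> forall k, ck k U f.
Proof.
split=> [sf k|cf s].
  elim: k f sf => [|k IH] f sf; split => //; try exact: (sf [::]).
  by move=> i; apply: IH => s x Ux; have := sf (rcons s i) x Ux; rewrite foldr_rcons.
elim/last_ind: s f cf => [|s i IH] f cf x Ux; first exact: (ck_diff (cf 0%N)).
by rewrite foldr_rcons; apply: IH => // k; apply: ck_partial.
Qed.

Lemma ckS W U V k (f : 'rV[R]_n -> W) : V `<=` U -> ck k U f -> ck k V f.
Proof.
move=> VU; elim: k f => [|k IH] f [df H]; first by split => // x /VU/df.
by split=> [x /VU/df|i] //; exact: IH (H i).
Qed.

Lemma near_open U (P : 'rV[R]_n -> Prop) x :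
  open U -> U x -> (forall y, U y -> P y) -> \forall y \near x, P y.
Proof. by move=> oU Ux H; apply: filterS (open_nbhs_nbhs (conj oU Ux)). Qed.

(** ['d f x] satisfies the first-order expansion that characterises ['d g x], and uniqueness of that
    expansion identifies the two. Functions are total but meaningful only on an open set, which is
    why this locality is needed. *)
Lemma differentiable_near (X W : normedModType R) (f g : X -> W) x :
  (\forall y \near x, f y = g y) -> differentiable f x -> differentiable g x.
Proof.
move=> fg df; have fgx := nbhs_singleton fg.
have cd : continuous ('d f x : X -> W) by apply: diff_continuous.
have H : g \o shift x = cst (g x) + 'd f x +o_ (0 : X) id.
  apply/eqaddoE.
  have /eqaddoP Hf := diff_locally df.
  apply/eqaddoP => e e0; move: (Hf e e0) => He.
  have fg' : \forall y \near (0 : X), f (y + x) = g (y + x).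
    by move: fg; rewrite (near_shift 0 x)/= subr0.
  near=> y.
  have -> : (g \o shift x - (cst (g x) + 'd f x)) y =
            (f \o shift x - (cst (f x) + 'd f x)) y.
    by rewrite -[LHS]/(g (y + x) - (g x + 'd f x y)) -(near fg' y)// -fgx.
  by near: y.
apply/diff_locallyP; rewrite (diff_unique cd H); split => //.
Unshelve. all: by end_near. Qed.

(** Lets a derivative be replaced by a product-rule or chain-rule expression that is valid only on
    [U]; the inductions on [k] below rest on this. *)
Lemma ck_ext W k U (f g : 'rV[R]_n -> W) :
  open U -> (forall x, U x -> f x = g x) -> ck k U f -> ck k U g.
Proof.
move=> oU; elim: k f g => [|k IH] f g fg [df H].
  split => // x Ux; apply: differentiable_near (df x Ux).
  exact: near_open Ux fg.
split=> [x Ux|i].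
  by apply: differentiable_near (df x Ux); exact: near_open Ux fg.
apply: IH (H i) => x Ux; apply: near_eq_derive; exact: near_open Ux fg.
Qed.

Lemma ck_cst W k U (c : W) : ck k U (fun _ => c).
Proof.
elim: k c => [|k IH] c; first by split => // x _; exact: differentiable_cst.
split=> [x _|i]; first exact: differentiable_cst.
rewrite (_ : partial i _ = fun _ => 0) //.
by apply/funext => x; rewrite /partial derive_cst.
Qed.

Lemma partialD W (f g : 'rV[R]_n -> W) i x :
  differentiable f x -> differentiable g x ->
  partial i (fun y => f y + g y) x = partial i f x + partial i g x.
Proof. by move=> df dg; apply: deriveD; apply: diff_derivable. Qed.

Lemma partialM (f g : 'rV[R]_n -> R) i x :
  differentiable f x -> differentiable g x ->
  partial i (fun y => f y * g y) x = partial i f x * g x + f x * partial i g x.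
Proof.
move=> df dg; rewrite /partial; apply: derive_val.
by apply: is_derive_mul; apply: derivableP; apply: diff_derivable.
Qed.

Lemma ckD W k U (f g : 'rV[R]_n -> W) : open U ->
  ck k U f -> ck k U g -> ck k U (fun x => f x + g x).
Proof.
move=> oU; elim: k f g => [|k IH] f g cf cg; split => //.
- by move=> x Ux; apply: differentiableD; [apply: ck_diff cf _|apply: ck_diff cg _].
- by move=> x Ux; apply: differentiableD; [apply: ck_diff cf _|apply: ck_diff cg _].
move=> i; apply: (ck_ext oU _ (IH _ _ (ck_partial i cf) (ck_partial i cg))).
by move=> x Ux /=; rewrite partialD//; [apply: ck_diff cf _|apply: ck_diff cg _].
Qed.

Lemma ckM k U (f g : 'rV[R]_n -> R) : open U ->
  ck k U f -> ck k U g -> ck k U (fun x => f x * g x).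
Proof.
move=> oU; elim: k f g => [|k IH] f g cf cg; split => //.
- by move=> x Ux; apply: differentiableM; [apply: ck_diff cf _|apply: ck_diff cg _].
- by move=> x Ux; apply: differentiableM; [apply: ck_diff cf _|apply: ck_diff cg _].
move=> i.
apply: (ck_ext oU _ (ckD oU (IH _ _ (ck_partial i cf) (ckW cg))
                            (IH _ _ (ckW cf) (ck_partial i cg)))).
by move=> x Ux /=; rewrite partialM//; [apply: ck_diff cf _|apply: ck_diff cg _].
Qed.

Lemma ck_big_sum W k U (I : Type) (r : seq I) (P : pred I) (F : I -> 'rV[R]_n -> W) :
  open U -> (forall i, P i -> ck k U (F i)) ->
  ck k U (fun x => \sum_(i <- r | P i) F i x).
Proof.
move=> oU H; elim: r => [|i r IH].
  by apply: (ck_ext oU _ (ck_cst k U 0)) => x _; rewrite big_nil.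
case Pi : (P i).
  by apply: (ck_ext oU _ (ckD oU (H i Pi) IH)) => x _; rewrite big_cons Pi.
by apply: (ck_ext oU _ IH) => x _; rewrite big_cons Pi.
Qed.

Lemma ck_big_prod k U (I : Type) (r : seq I) (F : I -> 'rV[R]_n -> R) :
  open U -> (forall i, ck k U (F i)) -> ck k U (fun x => \prod_(i <- r) F i x).
Proof.
move=> oU H; elim: r => [|i r IH].
  by apply: (ck_ext oU _ (ck_cst k U (1 : R))) => x _; rewrite big_nil.
by apply: (ck_ext oU _ (ckM oU (H i) IH)) => x _; rewrite big_cons.
Qed.

(** The derivative of 1/f is -(1/f)(1/f)f', which contains 1/f undifferentiated, so order [k] for
    1/f yields order [k.+1]. *)
Lemma ckV k U (f : 'rV[R]_n -> R) : open U -> (forall x, U x -> f x != 0) ->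
  ck k U f -> ck k U (fun x => (f x)^-1).
Proof.
move=> oU f0; elim: k f f0 => [|k IH] f f0 cf.
  by split => // x Ux; apply: differentiableV; [apply: ck_diff cf _|exact: f0].
split=> [x Ux|i].
  by apply: differentiableV; [apply: ck_diff cf _|exact: f0].
have cV := IH f f0 (ckW cf).
apply: (ck_ext oU _ (ckM oU (ck_cst k U (-1 : R)) (ckM oU (ckM oU cV cV) (ck_partial i cf)))).
move=> x Ux /=; rewrite /partial deriveV; [|exact: f0|].
  by rewrite /GRing.scale/= -exprVn expr2 mulN1r mulNr.
by apply: diff_derivable; apply: ck_diff cf _.
Qed.

Lemma ck_mxP p q k U (F : 'rV[R]_n -> 'M[R]_(p, q)) : open U ->
  ck k U F <-> forall i j, ck k U (fun x => F x i j).
Proof.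
move=> oU; elim: k F => [|k IH] F.
  split=> [cF i j|cF]; split => // x Ux.
    by move/differentiable_mxP : (ck_diff cF Ux); apply.
  by apply/differentiable_mxP => i j; apply: ck_diff (cF i j) Ux.
have dP l x : differentiable F x ->
    forall i j, partial l F x i j = partial l (fun y => F y i j) x.
  by move=> dF i j; rewrite /partial derive_mx ?mxE//; exact: diff_derivable.
split=> [cF i j|cF].
  split=> [x Ux|l].
    by move/differentiable_mxP : (ck_diff cF Ux); apply.
  move/IH : (ck_partial l cF) => /(_ i j); apply: ck_ext => // x Ux.
  by rewrite dP//; apply: ck_diff cF Ux.
have dF x : U x -> differentiable F x.
  by move=> Ux; apply/differentiable_mxP => i j; apply: ck_diff (cF i j) Ux.
split => // l; apply/IH => i j; apply: (ck_ext oU _ (ck_partial l (cF i j))).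
by move=> x Ux; rewrite dP//; exact: dF.
Qed.

Lemma ck_mulmx p q r k U (F : 'rV[R]_n -> 'M[R]_(p, q)) (G : 'rV[R]_n -> 'M[R]_(q, r)) :
  open U -> ck k U F -> ck k U G -> ck k U (fun x => F x *m G x).
Proof.
move=> oU /(ck_mxP _ _ oU) cF /(ck_mxP _ _ oU) cG; apply/ck_mxP => // i j.
under eq_fun do rewrite mxE.
by apply: ck_big_sum => // l _; apply: ckM.
Qed.

Lemma ck_tr p q k U (F : 'rV[R]_n -> 'M[R]_(p, q)) :
  open U -> ck k U F -> ck k U (fun x => (F x)^T).
Proof.
move=> oU /(ck_mxP _ _ oU) cF; apply/ck_mxP => // i j.
by under eq_fun do rewrite mxE.
Qed.

Lemma ck_scale p q k U (c : 'rV[R]_n -> R) (F : 'rV[R]_n -> 'M[R]_(p, q)) :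
  open U -> ck k U c -> ck k U F -> ck k U (fun x => c x *: F x).
Proof.
move=> oU cc /(ck_mxP _ _ oU) cF; apply/ck_mxP => // i j.
by under eq_fun do rewrite mxE; apply: ckM.
Qed.

Lemma ck_det p k U (F : 'rV[R]_n -> 'M[R]_p) :
  open U -> ck k U F -> ck k U (fun x => \det (F x)).
Proof.
move=> oU /(ck_mxP _ _ oU) cF; apply: ck_big_sum => // s _.
by apply: ckM => //; [exact: ck_cst|exact: ck_big_prod].
Qed.

Lemma ck_invmx p k U (F : 'rV[R]_n -> 'M[R]_p) :
  open U -> (forall x, U x -> F x \in unitmx) -> ck k U F ->
  ck k U (fun x => invmx (F x)).
Proof.
move=> oU uF cF.
(* Cramer's rule: the entries of the adjugate are determinants, hence polynomials in the entries of
   [F x]. *)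
suff c : ck k U (fun x => (\det (F x))^-1 *: \adj (F x)).
  by apply: (ck_ext oU _ c) => x Ux; rewrite /invmx uF.
apply: ck_scale => //.
  apply: ckV; [by []| |exact: ck_det].
  by move=> x Ux; rewrite -unitfE -unitmxE uF.
apply/ck_mxP => // i j; under eq_fun do rewrite mxE.
rewrite /cofactor; apply: ckM => //; first exact: ck_cst.
apply: ck_det => //; move/(ck_mxP _ _ oU) : cF => cF.
apply/ck_mxP => // a b.
by under eq_fun do rewrite !mxE.
Qed.

End FiniteSmoothness.

(** By the chain rule a partial derivative of the composite is a sum of products of a derivative of
    [G] with a composite of [partial j f] and [G]. The order of [f] drops by one, so the induction
    runs over all [f]. *)
Lemma ck_comp (R : realType) n q k (U : set 'rV[R]_n) (W : set 'rV[R]_q)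
    (f : 'rV[R]_q -> R) (G : 'rV[R]_n -> 'rV[R]_q) :
  open U -> (forall x, U x -> W (G x)) ->
  ck k W f -> ck k U G -> ck k U (fun x => f (G x)).
Proof.
move=> oU UW; elim: k f => [|k IH] f cf cG.
  split => // x Ux; apply: differentiable_comp; first exact: ck_diff cG Ux.
  exact: ck_diff cf (UW _ Ux).
split=> [x Ux|i].
  apply: differentiable_comp; first exact: ck_diff cG Ux.
  exact: ck_diff cf (UW _ Ux).
have c : ck k U (fun x => \sum_j partial i G x 0 j * partial j f (G x)).
  apply: ck_big_sum => // j _; apply: ckM => //.
    by move: (ck_partial i cG) => /(ck_mxP _ _ oU); apply.
  by apply: IH; [exact: ck_partial|exact: ckW].
apply: (ck_ext oU _ c) => x Ux.
have dG : differentiable G x by apply: ck_diff cG Ux.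
have df : differentiable f (G x) by apply: ck_diff cf (UW _ Ux).
rewrite -[RHS]/('D_('e_i) (fun y => f (G y)) x) (derive_comp 'e_i dG df).
by rewrite derive_partial.
Qed.

Lemma ck_comp_mx (R : realType) n q k a b (U : set 'rV[R]_n) (W : set 'rV[R]_q)
    (f : 'rV[R]_q -> 'M[R]_(a, b)) (G : 'rV[R]_n -> 'rV[R]_q) :
  open U -> open W -> (forall x, U x -> W (G x)) ->
  ck k W f -> ck k U G -> ck k U (fun x => f (G x)).
Proof.
move=> oU oW UW /(ck_mxP _ _ oW) cf cG; apply/ck_mxP => // i j.
exact: (ck_comp oU UW (cf i j)).
Qed.

(** * Mean value estimates and symmetry of second derivatives *)

Section MeanValue.
Context {R : realType}.

Lemma is_derive_line (V W : normedModType R) (f : V -> W) (x v : V) (s : R) :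
  differentiable f (s *: v + x) ->
  is_derive s 1 (fun t : R => f (t *: v + x)) ('D_v f (s *: v + x)).
Proof.
move=> df; pose l := (fun t : R => t *: v + x).
have dl : is_diff s l ( *:%R ^~ v).
  rewrite (_ : l = *:%R ^~ v + cst x) //.
  by apply: is_diff_eq; rewrite addr0.
have e : 'D_1 l s = v.
  by rewrite deriveE ?diff_val ?scale1r //; case: dl.
have dl' : differentiable l s by case: dl.
by have := @is_derive_comp _ _ _ _ l f s 1 dl' df; rewrite e.
Qed.

Lemma mvt_line (V : normedModType R) (f : V -> R) (x v : V) :
  (forall t : R, 0 <= t <= 1 -> differentiable f (t *: v + x)) ->
  exists t : R, [/\ 0 <= t <= 1 & f (v + x) - f x = 'D_v f (t *: v + x)].
Proof.
move=> df; pose g t := f (t *: v + x).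
have dg (t : R) : 0 <= t <= 1 -> is_derive t 1 g ('D_v f (t *: v + x)).
  by move=> /df; exact: is_derive_line.
have cg : {within `[0, 1], continuous g}.
  apply: derivable_within_continuous => t; rewrite in_itv/= => ht; by case: (dg t ht).
have dg' (t : R) : t \in `]0, 1[ -> is_derive t 1 g ('D_v f (t *: v + x)).
  by rewrite in_itv/= => /andP[t0 t1]; apply: dg; rewrite !ltW.
have [t] := MVT ltr01 dg' cg; rewrite in_itv/= => /andP[t0 t1].
rewrite /g scale0r add0r scale1r subr0 mulr1 => e.
by exists t; split=> //; rewrite !ltW.
Qed.

Lemma mx_entry_le m n (M : 'M[R]_(m, n)) i j : `|M i j| <= `|M|.
Proof. by rewrite [leRHS]mx_normrE; apply: le_trans (le_bigmax _ _ (i, j)). Qed.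

Lemma mx_norm_le m n (M : 'M[R]_(m, n)) c :
  0 <= c -> (forall i j, `|M i j| <= c) -> `|M| <= c.
Proof. by move=> c0 H; rewrite [leLHS]mx_normrE; apply: bigmax_le => // -[]. Qed.

(** The norm is the largest entry in absolute value; an entry of the product has [n] terms, hence
    the factor [n]. *)
Lemma mx_norm_mul m n p (A : 'M[R]_(m, n)) (B : 'M[R]_(n, p)) :
  `|A *m B| <= n%:R * `|B| * `|A|.
Proof.
apply: mx_norm_le => [|i j]; first by rewrite !mulr_ge0.
rewrite mxE (le_trans (ler_norm_sum _ _ _))//.
apply: (@le_trans _ _ (\sum_(k < n) (`|B| * `|A|))).
  apply: ler_sum => k _; rewrite normrM mulrC.
  by apply: ler_pM => //; exact: mx_entry_le.
by rewrite sumr_const card_ord -mulrA mulr_natl.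
Qed.

Lemma delta_mx_norm n (i : 'I_n) : `|'e_i : 'rV[R]_n| <= 1.
Proof.
apply: mx_norm_le => // a b; rewrite mxE.
by case: (_ && _); rewrite ?normr1 ?normr0.
Qed.

Lemma segment_ball (V : normedModType R) (a x y : V) r (t : R) : ball a r x -> ball a r y ->
  0 <= t <= 1 -> ball a r (t *: (y - x) + x).
Proof.
rewrite -ball_normE /ball_/= => ax ay /andP[t0 t1].
have -> : a - (t *: (y - x) + x) = (1 - t) *: (a - x) + t *: (a - y).
  rewrite scalerBl scale1r -addrA [- _ + _]addrC -scalerBr.
  rewrite (_ : a - y - (a - x) = x - y); last by rewrite opprB addrC addrA subrK.
  by rewrite opprD -scalerN opprB addrA addrAC.
rewrite (le_lt_trans (ler_normD _ _))// !normrZ !ger0_norm ?subr_ge0//.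
(* The strict inequality below is taken from the second term and needs t > 0. *)
have [->|tn0] := eqVneq t 0; first by rewrite subr0 mul1r mul0r addr0.
have tp : 0 < t by rewrite lt0r tn0.
rewrite (_ : r = (1 - t) * r + t * r); last by rewrite -mulrDl subrK mul1r.
apply: ler_ltD; last by rewrite ltr_pM2l.
by apply: ler_wpM2l (ltW ax); rewrite subr_ge0.
Qed.

(** The mean value theorem is applied to one coordinate at a time. The intermediate points may
    differ, which is harmless for the maximum norm. *)
Lemma mean_value_ineq n q (F : 'rV[R]_n -> 'rV[R]_q) (a : 'rV[R]_n) r c :
  0 <= c ->
  (forall y, ball a r y -> differentiable F y) ->
  (forall y v, ball a r y -> `|'D_v F y| <= c * `|v|) ->
  forall x y, ball a r x -> ball a r y -> `|F y - F x| <= c * `|y - x|.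
Proof.
move=> c0 dF HF x y ax ay.
apply: mx_norm_le => [|i j]; first by rewrite mulr_ge0.
have H (t : R) : 0 <= t <= 1 -> ball a r (t *: (y - x) + x) by exact: segment_ball.
have dj (t : R) : 0 <= t <= 1 -> differentiable (fun z => F z i j) (t *: (y - x) + x).
  by move=> /H/dF/differentiable_mxP; apply.
have [t [/H Ht]] := mvt_line dj; rewrite subrK => e; rewrite !mxE e.
have -> : 'D_(y - x) (fun z => F z i j) (t *: (y - x) + x) =
    ('D_(y - x) F (t *: (y - x) + x)) i j.
  by rewrite derive_mx ?mxE//; exact/diff_derivable/dF.
exact: le_trans (mx_entry_le _ _ _) (HF _ _ Ht).
Qed.

(** Two mean value steps: along [s *: 'e_i] for the increment [p] of [f] in direction [j], then
    along [s *: 'e_j] for [partial i f]. Basis vectors have norm at most 1, so 2s < r keeps the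
    whole parallelogram in the ball. *)
Lemma second_difference n (U : set 'rV[R]_n) (f : 'rV[R]_n -> R) i j x r s :
  ck 1 U f -> ball x r `<=` U -> 0 < s -> 2 * s < r ->
  exists2 xi, ball x r xi &
    f (s *: 'e_i + s *: 'e_j + x) - f (s *: 'e_i + x) - f (s *: 'e_j + x) + f x
      = s ^+ 2 * partial j (partial i f) xi.
Proof.
move=> cf rU s0 sr.
have B a b : 0 <= a <= 1 -> 0 <= b <= 1 ->
    ball x r (b *: (s *: 'e_j) + (a *: (s *: 'e_i) + x)).
  move=> /andP[a0 a1] /andP[b0 b1].
  rewrite -ball_normE /ball_/= addrA opprD addrCA subrr addr0 normrN.
  apply: le_lt_trans sr; rewrite (le_trans (ler_normD _ _))// mulrDl !mul1r.
  rewrite !normrZ (ger0_norm a0) (ger0_norm b0) (gtr0_norm s0).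
  have H (c : R) k : 0 <= c -> c <= 1 -> c * (s * `|'e_k : 'rV[R]_n|) <= s.
    move=> c0 c1; apply: le_trans (ler_piMl _ c1) _; first by rewrite mulr_ge0// ltW.
    by apply: ler_piMr; [exact: ltW|exact: delta_mx_norm].
  by apply: lerD; exact: H.
have Z01 : 0 <= (0 : R) <= 1 by rewrite lexx ler01.
have O01 : 0 <= (1 : R) <= 1 by rewrite lexx ler01.
pose p y := f (s *: 'e_j + y) - f y.
have dsh y : differentiable (fun z : 'rV[R]_n => s *: 'e_j + z) y.
  by apply: differentiableD; [exact: differentiable_cst|by case: (is_diff_id y)].
have df a b : 0 <= a <= 1 -> 0 <= b <= 1 ->
    differentiable f (b *: (s *: 'e_j) + (a *: (s *: 'e_i) + x)).
  by move=> ha hb; apply: (ck_diff cf); apply/rU/B.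
have df1 a : 0 <= a <= 1 -> differentiable f (a *: (s *: 'e_i) + x).
  by move=> ha; have := df a 0 ha Z01; rewrite scale0r add0r.
have df2 a : 0 <= a <= 1 -> differentiable f (s *: 'e_j + (a *: (s *: 'e_i) + x)).
  by move=> ha; have := df a 1 ha O01; rewrite scale1r.
have dc a : 0 <= a <= 1 ->
    differentiable (fun y => f (s *: 'e_j + y)) (a *: (s *: 'e_i) + x).
  by move=> ha; apply: (differentiable_comp (dsh _)); exact: df2.
have dp a : 0 <= a <= 1 -> differentiable p (a *: (s *: 'e_i) + x).
  by move=> ha; apply: differentiableB; [exact: dc|exact: df1].
have [a [ha]] := mvt_line dp.
have dq b : 0 <= b <= 1 ->
    differentiable (partial i f) (b *: (s *: 'e_j) + (a *: (s *: 'e_i) + x)).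
  by move=> hb; apply: (ck_diff (ck_partial i cf)); apply/rU/B.
have [b [hb e2]] := mvt_line dq.
rewrite deriveZ_dir; last exact: dp.
have -> : 'D_('e_i) p (a *: (s *: 'e_i) + x) =
    'D_('e_i) (fun y => f (s *: 'e_j + y)) (a *: (s *: 'e_i) + x) -
    'D_('e_i) f (a *: (s *: 'e_i) + x).
  by apply: deriveB; apply: diff_derivable; [exact: dc|exact: df1].
rewrite (derive_comp _ (dsh _) (df2 _ ha)).
have -> : 'D_('e_i) (fun z : 'rV[R]_n => s *: 'e_j + z) (a *: (s *: 'e_i) + x) = 'e_i.
  by rewrite deriveD// derive_cst derive_id add0r.
rewrite -/(partial i f _) e2 deriveZ_dir; last exact: dq.
rewrite -/(partial j _ _) /GRing.scale/= mulrA -expr2 => e3.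
exists (b *: (s *: 'e_j) + (a *: (s *: 'e_i) + x)); first exact: B.
have -> : s *: 'e_i + s *: 'e_j + x = s *: 'e_j + (s *: 'e_i + x).
  by rewrite -addrA addrCA.
by rewrite -e3 /p; ring.
Qed.

(** Near [x] each function is kept within half the gap between the two values at [x]. *)
Lemma continuous_separated (T : pseudoMetricType R) (F G : T -> R) (U : set T) x :
  nbhs x U -> {for x, continuous F} -> {for x, continuous G} -> F x != G x ->
  exists2 r : R, 0 < r & ball x r `<=` U /\
    forall u w, ball x r u -> ball x r w -> G u != F w.
Proof.
move=> Ux cF cG ne.
have e0 : 0 < `|F x - G x| / 2 by rewrite divr_gt0// normr_gt0 subr_eq0.
have nF : \forall y \near x, `|F x - F y| < `|F x - G x| / 2.
  by move/cvgrPdist_lt : cF => /(_ _ e0).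
have nG : \forall y \near x, `|G x - G y| < `|F x - G x| / 2.
  by move/cvgrPdist_lt : cG => /(_ _ e0).
have [r r0 H] := (nbhs_ballP _ _).1 (filterI Ux (filterI nF nG)).
exists r => //; split=> [y /H[]//|u w /H[_ [_ bu]] /H[_ [aw _]]].
apply/eqP => e; move: bu aw; rewrite e.
move: (F x) (G x) (F w) => a b z bz az.
have : `|a - b| < `|a - b|.
  rewrite -{1}(subrK z a) -addrA (le_lt_trans (ler_normD _ _))//.
  by rewrite [X in _ < X]splitr ltrD// distrC.
by rewrite ltxx.
Qed.

(** The second difference of [f] is symmetric in [i] and [j] and equals s^2 times either mixed
    derivative at a nearby point. If the mixed derivatives differed at [x], continuity would keep
    their nearby values apart. *)
Lemma schwarz n (U : set 'rV[R]_n) (f : 'rV[R]_n -> R) i j x :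
  open U -> U x -> ck 2 U f ->
  partial i (partial j f) x = partial j (partial i f) x.
Proof.
move=> oU Ux cf; apply/eqP/negPn/negP => ne.
have ca : {for x, continuous (partial i (partial j f))}.
  apply: differentiable_continuous; apply: ck_diff Ux.
  exact: (ck_partial i (ck_partial j cf)).
have cb : {for x, continuous (partial j (partial i f))}.
  apply: differentiable_continuous; apply: ck_diff Ux.
  exact: (ck_partial j (ck_partial i cf)).
have nU : nbhs x U by exact: open_nbhs_nbhs.
have [r r0 [rU H]] := continuous_separated nU ca cb ne.
have s0 : 0 < r / 4 by rewrite divr_gt0.
have sr : 2 * (r / 4) < r by clear -r0; lra.
have [u xu e1] := second_difference i j (ckW cf) rU s0 sr.
have [w xw e2] := second_difference j i (ckW cf) rU s0 sr.
move/eqP: (H _ _ xu xw); apply.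
apply: (@mulfI _ ((r / 4) ^+ 2)); first by rewrite expf_neq0// gt_eqF.
apply: etrans (esym e1) _; apply: etrans _ e2.
by rewrite [r / 4 *: 'e_i + _]addrC; congr (_ + _); rewrite addrAC.
Qed.

End MeanValue.

(** Completeness of matrices in the form that the Banach fixed-point theorem asks for. *)
HB.instance Definition _ (R : realType) m n :=
  Uniform_isComplete.Build 'M[R]_(m, n) (@mx_complete R m n).

(** * Inverse function theorem *)

Section InverseFunction.
Context {R : realType}.

Let contraction_estimate (a c : R) : a <= 2^-1 * a + c -> a <= 2 * c.
Proof. lra. Qed.

Let half_lt (r : R) : 0 < r -> r / 2 < r.
Proof. lra. Qed.

Let quarter_estimate (a r : R) : a <= r / 2 -> 2^-1 * a + r / 4 <= r / 2.
Proof. lra. Qed.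

Lemma differentiable_remainder (V W : normedModType R) (f : V -> W) x (L : {linear V -> W}) :
  continuous L ->
  (forall e, 0 < e -> \forall h \near (0 : V), `|f (h + x) - (f x + L h)| <= e * `|h|) ->
  differentiable f x /\ ('d f x : V -> W) = L.
Proof.
move=> cL H.
have E : f \o shift x = cst (f x) + L +o_ (0 : V) id.
  apply/eqaddoE; apply/eqaddoP => e e0; exact: H.
have dE := diff_unique cL E.
by split => //; apply/diff_locallyP; rewrite dE.
Qed.

Lemma remainder_differentiable (V W : normedModType R) (f : V -> W) x : differentiable f x ->
  forall e, 0 < e -> \forall h \near (0 : V), `|f (h + x) - (f x + 'd f x h)| <= e * `|h|.
Proof. by move=> df e e0; have /eqaddoP/(_ e e0) := diff_locally df. Qed.

Lemma differentiable_mulmxr m n p (B : 'M[R]_(n, p)) (A : 'M[R]_(m, n)) :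
  differentiable (mulmxr B) A.
Proof.
apply/differentiable_mxP => i j.
rewrite (_ : (fun y => _) = \sum_k (fun y : 'M[R]_(m, n) => y i k * B k j)).
  apply: differentiable_sum => k; apply: differentiableM.
    exact: differentiable_coord.
  exact: differentiable_cst.
by apply/funext => y; rewrite mxE fct_sumE.
Qed.

Lemma unitmx_kernel n (A : 'M[R]_n) : (forall v : 'rV_n, v *m A = 0 -> v = 0) -> A \in unitmx.
Proof.
move=> H; rewrite -row_free_unit -kermx_eq0; apply/eqP/row_matrixP => i.
by rewrite row0; apply: H; rewrite -row_mul mulmx_ker row0.
Qed.

Lemma smooth_jac n q (U : set 'rV[R]_n) (f : 'rV[R]_n -> 'rV[R]_q) :
  open U -> smooth_on U f -> forall k, ck k U (jac f).
Proof.
move=> oU /smooth_onP sf k; apply/ck_mxP => // i j.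
have /(ck_mxP _ _ oU)/(_ 0 j) := ck_partial i (sf k.+1).
by apply: ck_ext => // x Ux; rewrite mxE.
Qed.

Variables (n : nat) (U : set 'rV[R]_n) (f : 'rV[R]_n -> 'rV[R]_n) (x0 : 'rV[R]_n).
Hypotheses (oU : open U) (Ux0 : U x0) (sf : smooth_on U f).
Hypothesis unit_jac : jac f x0 \in unitmx.

Let J := jac f x0.
(** Solutions of f x = y are the fixed points of x |-> k x + y J^-1. The derivative of [k] vanishes
    at [x0], so this map contracts near [x0]. *)
Let k x := x - f x *m invmx J.

Let dk x v : U x -> is_derive x v k (v - v *m jac f x *m invmx J).
Proof.
move=> Ux; have df : differentiable f x by apply: (sf [::]).
apply: is_deriveB; rewrite -(derive_jac v df).
have H := is_derive_mulmx (derivableP (diff_derivable (v := v) df))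
                      (is_derive_cst (invmx J) x v).
by rewrite mulmx0 addr0 in H.
Qed.

Let dkJ x : U x -> differentiable k x.
Proof.
move=> Ux; have df : differentiable f x by apply: (sf [::]).
apply: differentiableB; first by case: (is_diff_id x).
have := @ck_mulmx _ _ _ _ _ 0 U f (cst (invmx J)) oU ((smooth_onP _ _).1 sf 0) (ck_cst _ _ _).
by move=> /ck_diff; apply.
Qed.

Let radius : exists2 r : R, 0 < r & ball x0 r `<=` U /\
  forall x v, ball x0 r x -> `|'D_v k x| <= 2^-1 * `|v|.
Proof.
pose Q x := 1%:M - jac f x *m invmx J.
have cQ : ck 0 U Q.
  have cJ : ck 0 U (fun x => jac f x *m ((-1) *: invmx J)).
    by apply: ck_mulmx; [exact: oU|exact: smooth_jac|exact: ck_cst].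
  have := ckD oU (ck_cst 0 U 1%:M) cJ; apply: ck_ext => // x Ux.
  by rewrite /Q scaleN1r mulmxN.
have Q0 : Q x0 = 0 by rewrite /Q mulmxV ?subrr.
(* [mx_norm_mul] costs a factor [n], so a deviation below 1/(2(n+1)) gives the contraction factor
   1/2; [n.+1] avoids a zero denominator. *)
pose e : R := (2 * n.+1%:R)^-1.
have e0 : 0 < e by rewrite invr_gt0 mulr_gt0.
have cont : {for x0, continuous Q}.
  by apply: differentiable_continuous; apply: ck_diff cQ Ux0.
have nQ : \forall x \near x0, `|Q x0 - Q x| < e by move/cvgrPdist_lt : cont => /(_ _ e0).
have [r r0 H] := (nbhs_ballP _ _).1 (filterI (open_nbhs_nbhs (conj oU Ux0)) nQ).
exists r => //; split=> [x /H[]//|x v /H[Ux]]; rewrite Q0 sub0r normrN => Qe.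
have [_ ->] := dk v Ux.
have -> : v - v *m jac f x *m invmx J = v *m Q x.
  by rewrite /Q mulmxBr mulmx1 mulmxA.
apply: le_trans (mx_norm_mul _ _) _; apply: ler_wpM2r => //.
apply: (@le_trans _ _ (n.+1%:R * e)); last by rewrite /e invfM mulrCA mulfV ?mulr1 ?pnatr_eq0.
by apply: ler_pM => //; [rewrite ler_nat|exact: ltW].
Qed.

(** The inverse comes from a fixed point. The Lipschitz bound [inv_lip] makes it injective and
    continuous, then differentiable, and the formula for its derivative bootstraps to smoothness. *)
Theorem inverse_function : exists r s G, [/\ 0 < r /\ ball x0 r `<=` U,
  0 < s,
  forall x, ball x0 r x -> jac f x \in unitmx,
  forall y, ball (f x0) s y -> ball x0 r (G y) /\ f (G y) = y &
  (forall x, ball x0 r x -> ball (f x0) s (f x) -> G (f x) = x) /\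
  smooth_on (ball (f x0) s) G].
Proof.
have [r r0 [rU kr]] := radius.
have kU x v : ball x0 r x -> 'D_v k x = v - v *m jac f x *m invmx J.
  by move=> /rU Ux; have [_ ->] := dk v Ux.
have dkr y : ball x0 r y -> differentiable k y by move=> /rU/dkJ.
have klip x y : ball x0 r x -> ball x0 r y -> `|k y - k x| <= 2^-1 * `|y - x|.
  by move=> bx byy; apply: (mean_value_ineq _ dkr) => //; rewrite invr_ge0.
(* If [v] is killed by [jac f x], then ['D_v k x] is [v] itself, and |v| <= |v|/2 forces v = 0. *)
have unitr x : ball x0 r x -> jac f x \in unitmx.
  move=> bx; apply: unitmx_kernel => v vJ.
  have := kr x v bx; rewrite kU// vJ mul0mx subr0 -[X in _ <= X]addr0.
  by move=> /contraction_estimate; rewrite mulr0 normr_le0 => /eqP.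
pose C : R := 2 * (n%:R * `|invmx J|).
have C0 : 0 <= C by rewrite !mulr_ge0.
have inv_lip x y : ball x0 r x -> ball x0 r y -> `|x - y| <= C * `|f x - f y|.
  move=> bx byy; have := klip _ _ byy bx; rewrite /k => h.
  have e : x - y = (x - f x *m invmx J - (y - f y *m invmx J)) + (f x - f y) *m invmx J.
    by rewrite mulmxBl opprB addrACA subrK [_ - y - _]addrAC subrr sub0r.
  have h2 : `|x - y| <= 2^-1 * `|x - y| + n%:R * `|invmx J| * `|f x - f y|.
    rewrite {1}e (le_trans (ler_normD _ _))// lerD//; exact: mx_norm_mul.
  by rewrite /C -mulrA; exact: contraction_estimate h2.
have inj x y : ball x0 r x -> ball x0 r y -> f x = f y -> x = y.
  move=> bx byy e; have := inv_lip _ _ bx byy.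
  by rewrite e subrr normr0 mulr0 normr_le0 subr_eq0 => /eqP.
(* [s] makes |(f x0 - y) J^-1| at most r/4, and [k] contributes at most another r/4, so the closed
   ball of radius r/2 is mapped into itself. The added 1 keeps the denominator positive. *)
have [s s0 surj] : exists2 s, 0 < s & forall y, ball (f x0) s y ->
    exists2 x, ball x0 r x & f x = y.
  pose s := r / 4 / (n%:R * `|invmx J| + 1).
  have D0 : 0 < n%:R * `|invmx J| + 1 by rewrite ltr_wpDl// mulr_ge0.
  have s0 : 0 < s by rewrite !divr_gt0.
  exists s => // y ys.
  pose T x := k x + y *m invmx J.
  pose B := closed_ball_ Num.norm x0 (r / 2).
  have r2 : 0 < r / 2 by rewrite divr_gt0.
  have BE x : B x <-> `|x0 - x| <= r / 2 by [].
  have Br x : B x -> ball x0 r x.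
    move=> /BE h; rewrite -ball_normE /ball_/=; apply: le_lt_trans h _.
    exact: half_lt.
  have Bx0 : B x0 by apply/BE; rewrite subrr normr0 ltW.
  have TB x : B x -> B (T x).
    move=> Bx; apply/BE.
    have -> : x0 - T x = (k x0 - k x) + (f x0 - y) *m invmx J.
      by rewrite /T /k mulmxBl opprD !opprB addrACA subrK.
    have h1 := klip _ _ (Br _ Bx) (ballxx x0 r0).
    have h2 : `|(f x0 - y) *m invmx J| <= r / 4.
      apply: le_trans (mx_norm_mul _ _) _; move: ys; rewrite -ball_normE /ball_/= => /ltW ys.
      apply: (@le_trans _ _ ((n%:R * `|invmx J| + 1) * s)).
        by apply: ler_pM => //; rewrite ?mulr_ge0// lerDl.
      by rewrite /s mulrC divfK// gt_eqF.
    rewrite (le_trans (ler_normD _ _))//.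
    move/BE : Bx => h3.
    by apply: le_trans (lerD h1 h2) _; exact: quarter_estimate.
  pose Tm : {fun B >-> B} := HB.pack T (isFun.Build _ _ _ _ T TB).
  have half0 : 0 <= 2^-1 :> R by rewrite invr_ge0.
  have Tc : is_contraction Tm.
    exists (NngNum half0); split => [|[u v] [/= Bu Bv]].
      by rewrite /= invf_lt1// ltr1n.
    have -> : Tm u - Tm v = k u - k v by rewrite /= /T opprD addrACA subrr addr0.
    by apply: klip; exact: Br.
  have [|x Bx xT] := banach_fixed_point Tc (@closed_closed_ball_ _ _ x0 (r / 2)).
    by exists x0.
  exists x; first exact: Br.
  have e : f x *m invmx J = y *m invmx J.
    move: xT; rewrite -[Tm x]/(x - f x *m invmx J + y *m invmx J) -addrA.
    rewrite -{1}[x]addr0 => /addrI/esym/eqP.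
    by rewrite addrC subr_eq0 => /eqP.
  by rewrite -[f x]mulmx1 -(mulVmx unit_jac) mulmxA e mulmxKV.
(* Where [y] has no preimage in the ball, the value [x0] is a dummy. *)
pose G y := if pselect (exists2 x, ball x0 r x & f x = y) is left e
            then s2val (cid2 e) else x0.
have GE y : ball (f x0) s y -> ball x0 r (G y) /\ f (G y) = y.
  move=> ys; rewrite /G; case: pselect => [e|[]]; last exact: surj.
  by split; [exact: (s2valP (cid2 e))|exact: (s2valP' (cid2 e))].
exists r, s, G; split=> //; split.
  move=> x bx fx; have [bG fG] := GE _ fx; exact: inj.
have oB : open (ball (f x0) s) by apply: ball_open.
have diffG y : ball (f x0) s y ->
    differentiable G y /\ forall v, 'D_v G y = v *m invmx (jac f (G y)).
  move=> ys; have [bG fG] := GE _ ys; have uA := unitr _ bG.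
  set A := jac f (G y) in uA *.
  pose L : {linear 'rV[R]_n -> 'rV[R]_n} := mulmxr (invmx A).
  have dfG : differentiable f (G y) by apply: (sf [::]); exact: rU.
  have cL : continuous L.
    move=> v; apply: differentiable_continuous.
    exact: differentiable_mulmxr.
  have [|dG dGE] := @differentiable_remainder _ _ G y L cL.
    move=> e e0.
    pose c := (n%:R * `|invmx A|) * C + 1.
    have c0 : 0 < c by rewrite ltr_wpDl// !mulr_ge0.
    pose d := e / c; have d0 : 0 < d by rewrite divr_gt0.
    have [t t0 Ht] := (nbhs_ballP _ _).1 (remainder_differentiable dfG d0).
    have cont : \forall h \near (0 : 'rV[R]_n), ball (f x0) s (h + y) /\ `|G (h + y) - G y| < t.
      have /nbhs_ballP[u u0 uB] : nbhs y (ball (f x0) s) by exact: open_nbhs_nbhs.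
      apply/nbhs_ballP; exists (Num.min u (t / (C + 1))).
        by rewrite /= lt_min u0 divr_gt0// ltr_wpDl.
      move=> h; rewrite -ball_normE /ball_/= sub0r normrN lt_min => /andP[hu ht].
      have bhy : ball (f x0) s (h + y).
        by apply: uB; rewrite -ball_normE /ball_/= opprD addrCA subrr addr0 normrN.
      split; first by move: bhy; rewrite -ball_normE.
      have [bGh fGh] := GE _ bhy.
      apply: le_lt_trans (inv_lip _ _ bGh bG) _; rewrite fGh fG addrK.
      have hC : C * `|h| <= (C + 1) * `|h| by rewrite ler_wpM2r// lerDl.
      by apply: le_lt_trans hC _; rewrite mulrC -ltr_pdivlMr// ltr_wpDl.
    near=> h.
    have [bhy hG] : ball (f x0) s (h + y) /\ `|G (h + y) - G y| < t by near: h.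
    have [bGh fGh] := GE _ bhy.
    pose w := G (h + y) - G y.
    have wt : ball (0 : 'rV[R]_n) t w by rewrite -ball_normE /ball_/= sub0r normrN.
    have := Ht _ wt; rewrite subrK fGh fG.
    rewrite -deriveE// derive_jac// -/A => rem.
    (* The remainder of [G] is minus the remainder of [f] along [w], multiplied by [invmx A];
       [inv_lip] bounds |w| by C|h|, which turns o(|w|) into o(|h|). *)
    have -> : G (h + y) - (G y + L h) = - (h + y - (y + w *m A)) *m invmx A.
      have -> : h + y - (y + w *m A) = h - w *m A.
        by rewrite [y + _]addrC opprD addrA addrAC addrK.
      by rewrite opprB mulmxBl mulmxK// opprD addrA.
    apply: le_trans (mx_norm_mul _ _) _; rewrite normrN.
    apply: (@le_trans _ _ (n%:R * `|invmx A| * (d * (C * `|h|)))).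
      apply: ler_wpM2l; first by rewrite mulr_ge0.
      apply: le_trans rem _; apply: ler_wpM2l; first exact: ltW.
      by have := inv_lip _ _ bGh bG; rewrite fGh fG addrK.
    rewrite [d * _]mulrCA !mulrA; apply: ler_wpM2r => //.
    rewrite ler_pdivrMr// mulrC.
    by apply: ler_wpM2l; [exact: ltW|rewrite /c /C !mulrA lerDl].
  by split => // v; rewrite deriveE// dGE.
(* The derivative of [G] is the inverse of the Jacobian of [f] at [G y], hence as smooth as [G]
   itself, so the order of [G] rises by one at each step. *)
apply/smooth_onP; elim=> [|j IH]; first by split=> // y /diffG[].
split=> [y /diffG[]//|i].
have c : ck j (ball (f x0) s) (fun y => ('e_i : 'rV[R]_n) *m invmx (jac f (G y))).
  apply: ck_mulmx; [exact: oB|exact: (ck_cst _ _ ('e_i : 'rV[R]_n))|].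
  apply: ck_invmx; [exact: oB|by move=> y /GE[/unitr]|].
  apply: (ck_comp_mx oB oU _ _ IH); first by move=> y /GE[/rU].
  exact: smooth_jac.
by apply: (ck_ext oB _ c) => y ys; rewrite /partial (diffG y ys).2.
Unshelve. all: by end_near. Qed.

End InverseFunction.

(** * Levi-Civita connection and curvature *)

Section InnerAlgebra.
Context {R : realType} {n : nat}.
Implicit Types (G : 'M[R]_n) (u v w : 'rV[R]_n).

Lemma innerDl G u v w : inner G (u + v) w = inner G u w + inner G v w.
Proof. by rewrite /inner !mulmxDl mxE. Qed.

Lemma innerDr G u v w : inner G u (v + w) = inner G u v + inner G u w.
Proof. by rewrite /inner linearD mulmxDr mxE. Qed.

Lemma innerZl G a u v : inner G (a *: u) v = a * inner G u v.
Proof. by rewrite /inner -!scalemxAl mxE. Qed.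

Lemma innerZr G a u v : inner G u (a *: v) = a * inner G u v.
Proof. by rewrite /inner linearZ -scalemxAr mxE. Qed.

Lemma inner0l G v : inner G 0 v = 0.
Proof. by rewrite /inner !mul0mx mxE. Qed.

Lemma inner0r G u : inner G u 0 = 0.
Proof. by rewrite /inner trmx0 mulmx0 mxE. Qed.

Lemma innerNl G u v : inner G (- u) v = - inner G u v.
Proof. by rewrite -scaleN1r innerZl mulN1r. Qed.

Lemma innerNr G u v : inner G u (- v) = - inner G u v.
Proof. by rewrite -scaleN1r innerZr mulN1r. Qed.

Lemma innerBl G u v w : inner G (u - v) w = inner G u w - inner G v w.
Proof. by rewrite innerDl innerNl. Qed.

Lemma innerBr G u v w : inner G u (v - w) = inner G u v - inner G u w.
Proof. by rewrite innerDr innerNr. Qed.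

Lemma inner_suml G (I : finType) (F : I -> 'rV[R]_n) v :
  inner G (\sum_i F i) v = \sum_i inner G (F i) v.
Proof.
by elim/big_ind2 : _ => [|x y z t <- <-|//]; rewrite ?inner0l ?innerDl.
Qed.

Lemma inner_sumr G (I : finType) (F : I -> 'rV[R]_n) v :
  inner G v (\sum_i F i) = \sum_i inner G v (F i).
Proof.
by elim/big_ind2 : _ => [|x y z t <- <-|//]; rewrite ?inner0r ?innerDr.
Qed.

Lemma innerC G u v : G^T = G -> inner G u v = inner G v u.
Proof.
move=> sG; rewrite /inner.
have -> : (v *m G *m u^T) = (u *m G *m v^T)^T by rewrite !trmx_mul trmxK sG mulmxA.
by rewrite [RHS]mxE.
Qed.

Lemma inner_expand G u v : inner G u v = \sum_i \sum_j u 0 i * G i j * v 0 j.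
Proof.
rewrite /inner mxE exchange_big/=; apply: eq_bigr => j _; rewrite !mxE mulr_suml.
by [].
Qed.

Lemma inner_nondeg G u : G \in unitmx -> (forall v, inner G u v = 0) -> u = 0.
Proof.
move=> uG H; rewrite -[u](mulmxK uG).
suff -> : u *m G = 0 by rewrite mul0mx.
apply/rowP => j; have := H 'e_j.
by rewrite /inner trmx_delta -colE mxE => ->; rewrite mxE.
Qed.

Lemma inner_inj G u u' : G \in unitmx -> (forall v, inner G u v = inner G u' v) -> u = u'.
Proof.
move=> uG H; apply/eqP; rewrite -subr_eq0; apply/eqP/(inner_nondeg uG) => v.
by rewrite innerBl H subrr.
Qed.

Lemma row_linear_expand q (F : 'rV[R]_n -> 'rV[R]_q) u :
  (forall v w, F (v + w) = F v + F w) -> (forall a v, F (a *: v) = a *: F v) ->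
  F u = \sum_i u 0 i *: F 'e_i.
Proof.
move=> FD FZ; have F0 : F 0 = 0 by rewrite -(scale0r 0) FZ scale0r.
rewrite {1}(row_sum_delta u).
elim: (index_enum _) => [|i s IH]; first by rewrite !big_nil.
by rewrite !big_cons FD FZ IH.
Qed.

End InnerAlgebra.

Section BilinearForms.
Context {R : realType} {q : nat}.
Implicit Types (c : 'I_q -> 'I_q -> 'I_q -> R) (u v : 'rV[R]_q).

(** Isolates the bilinear algebra from the geometry: [christoffel_form] at a point is, by
    conversion, the case where [c] holds the Christoffel symbols there. *)
Definition biform c u v : 'rV[R]_q := \row_k \sum_i \sum_j c k i j * u 0 i * v 0 j.

Lemma biformDl c u u' v : biform c (u + u') v = biform c u v + biform c u' v.
Proof.
apply/rowP => k; rewrite !mxE -big_split/=; apply: eq_bigr => i _.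
by rewrite -big_split/=; apply: eq_bigr => j _; rewrite mxE; ring.
Qed.

Lemma biformDr c u v v' : biform c u (v + v') = biform c u v + biform c u v'.
Proof.
apply/rowP => k; rewrite !mxE -big_split/=; apply: eq_bigr => i _.
by rewrite -big_split/=; apply: eq_bigr => j _; rewrite mxE; ring.
Qed.

Lemma biformZl c a u v : biform c (a *: u) v = a *: biform c u v.
Proof.
apply/rowP => k; rewrite !mxE mulr_sumr; apply: eq_bigr => i _.
by rewrite mulr_sumr; apply: eq_bigr => j _; rewrite mxE; ring.
Qed.

Lemma biformZr c a u v : biform c u (a *: v) = a *: biform c u v.
Proof.
apply/rowP => k; rewrite !mxE mulr_sumr; apply: eq_bigr => i _.
by rewrite mulr_sumr; apply: eq_bigr => j _; rewrite mxE; ring.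
Qed.

Lemma biformDc c c' u v :
  biform (fun k i j => c k i j + c' k i j) u v = biform c u v + biform c' u v.
Proof.
apply/rowP => k; rewrite !mxE -big_split/=; apply: eq_bigr => i _.
by rewrite -big_split/=; apply: eq_bigr => j _; ring.
Qed.

Lemma biformZc a c u v :
  biform (fun k i j => a * c k i j) u v = a *: biform c u v.
Proof.
apply/rowP => k; rewrite !mxE mulr_sumr; apply: eq_bigr => i _.
by rewrite mulr_sumr; apply: eq_bigr => j _; ring.
Qed.

Lemma is_derive_biform (V : normedModType R) (c : 'I_q -> 'I_q -> 'I_q -> V -> R) dc
    (Y Z : V -> 'rV[R]_q) dY dZ x w :
  (forall k i j, is_derive x w (c k i j) (dc k i j)) ->
  is_derive x w Y dY -> is_derive x w Z dZ ->
  is_derive x w (fun y => biform (fun k i j => c k i j y) (Y y) (Z y))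
    (biform dc (Y x) (Z x) + biform (fun k i j => c k i j x) dY (Z x)
       + biform (fun k i j => c k i j x) (Y x) dZ).
Proof.
move=> Hc /is_derive_mxP HY /is_derive_mxP HZ; apply/is_derive_mxP => a k.
under eq_fun do rewrite mxE.
rewrite [X in is_derive _ _ _ X](_ : _ = \sum_i \sum_j
   ((dc k i j * Y x 0 i + c k i j x * dY 0 i) * Z x 0 j + c k i j x * Y x 0 i * dZ 0 j)).
  apply: is_derive_fin_sum => i; apply: is_derive_fin_sum => j.
  by apply: is_derive_mul => //; apply: is_derive_mul.
rewrite !mxE -!big_split/=; apply: eq_bigr => i _.
by rewrite -!big_split/=; apply: eq_bigr => j _; ring.
Qed.

End BilinearForms.

Section SmoothFields.
Context {R : realType} {n : nat}.
Implicit Types (U : set 'rV[R]_n).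

Lemma ck_derive p q U (F : 'rV[R]_n -> 'M[R]_(p, q)) u k :
  open U -> ck k.+1 U F -> ck k U (fun y => 'D_u F y).
Proof.
move=> oU cF; have c : ck k U (fun y => \sum_i u 0 i *: partial i F y).
  by apply: ck_big_sum => // i _; apply: ck_scale => //; [exact: ck_cst|exact: ck_partial].
by apply: (ck_ext oU _ c) => x Ux; rewrite derive_partial//; apply: ck_diff cF Ux.
Qed.

Lemma schwarz_dir p q U (F : 'rV[R]_n -> 'M[R]_(p, q)) u v x :
  open U -> U x -> ck 2 U F ->
  'D_u (fun y => 'D_v F y) x = 'D_v (fun y => 'D_u F y) x.
Proof.
move=> oU Ux cF.
have key w z : 'D_w (fun y => 'D_z F y) x =
    \sum_i \sum_j (w 0 i * z 0 j) *: partial i (partial j F) x.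
  have -> : 'D_w (fun y => 'D_z F y) x = 'D_w (fun y => \sum_j z 0 j *: partial j F y) x.
    apply: near_eq_derive; apply: (near_open oU Ux) => y Uy.
    by rewrite derive_partial//; apply: ck_diff cF Uy.
  have d : is_derive x w (fun y => \sum_j z 0 j *: partial j F y)
      (\sum_j z 0 j *: 'D_w (partial j F) x).
    apply: is_derive_fin_sum => j; apply: is_deriveZ; apply: derivableP.
    by apply: diff_derivable; apply: ck_diff (ck_partial j cF) Ux.
  have [_ ->] := d; rewrite exchange_big; apply: eq_bigr => j _ /=.
  rewrite derive_partial; last by apply: ck_diff (ck_partial j cF) Ux.
  by rewrite scaler_sumr; apply: eq_bigr => i _; rewrite scalerA mulrC.
have E k l a b : (partial k (partial l F) x) a b = partial k (partial l (fun y => F y a b)) x.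
  have dF y i w : U y -> ('D_w F y) a b = 'D_w (fun y => F y a b) y.
    by move=> Uy; rewrite derive_mx ?mxE//; apply: diff_derivable; apply: ck_diff cF Uy.
  have dlF : derivable (partial l F) x 'e_k.
    by apply: diff_derivable; apply: ck_diff (ck_partial l cF) Ux.
  have -> : (partial k (partial l F) x) a b = partial k (fun y => partial l F y a b) x.
    by rewrite {1}/partial (derive_mx dlF) mxE.
  by apply: near_eq_derive; apply: (near_open oU Ux) => y; exact: dF.
have S k l : partial k (partial l F) x = partial l (partial k F) x.
  apply/matrixP => a b; apply: etrans (E k l a b) (etrans _ (esym (E l k a b))).
  have c : ck 2 U (fun y => F y a b) by move/(ck_mxP _ _ oU) : cF; apply.
  exact: (schwarz k l oU Ux c).
rewrite !key [LHS]exchange_big; apply: eq_bigr => i _; apply: eq_bigr => j _.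
by rewrite S (mulrC (u 0 j)).
Qed.

End SmoothFields.

(* [G] and [dG u] stand for the values at a point of a metric and of its
   derivative in the direction [u]. *)
Section ChristoffelAlgebra.
Context {R : realType} {q : nat}.
Variables (G : 'M[R]_q) (dG : 'rV[R]_q -> 'M[R]_q).
Hypotheses (symG : G^T = G) (unitG : G \in unitmx).
Hypotheses (dG_sym : forall u, (dG u)^T = dG u)
  (dG_expand : forall u, dG u = \sum_i u 0 i *: dG 'e_i).

(** Twice the Christoffel symbols of the first kind. *)
Let kappa i j l : R := dG 'e_i j l + dG 'e_j i l - dG 'e_l i j.

Definition christoffel_coef k i j : R := 2^-1 * \sum_l invmx G k l * kappa i j l.

Let K u v w : R := inner (dG u) v w + inner (dG v) u w - inner (dG w) u v.

Let inner_dG u v w : inner (dG u) v w =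
  \sum_i \sum_j \sum_l dG 'e_i j l * u 0 i * v 0 j * w 0 l.
Proof.
rewrite inner_expand [RHS]exchange_big; apply: eq_bigr => j _ /=.
rewrite exchange_big; apply: eq_bigr => l _ /=.
rewrite dG_expand summxE mulr_sumr mulr_suml; apply: eq_bigr => i _.
by rewrite mxE; ring.
Qed.

Let K_expand u v w :
  K u v w = \sum_l (\sum_i \sum_j kappa i j l * u 0 i * v 0 j) * w 0 l.
Proof.
rewrite /K !inner_dG [X in _ + X - _]exchange_big/=.
have -> : \sum_i \sum_j \sum_l dG 'e_i j l * w 0 i * u 0 j * v 0 l
  = \sum_i \sum_j \sum_l dG 'e_l i j * u 0 i * v 0 j * w 0 l.
  rewrite exchange_big; apply: eq_bigr => i _ /=; rewrite exchange_big.
  by apply: eq_bigr => j _; apply: eq_bigr => l _; ring.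
have -> : \sum_l (\sum_i \sum_j kappa i j l * u 0 i * v 0 j) * w 0 l
  = \sum_i \sum_j \sum_l kappa i j l * u 0 i * v 0 j * w 0 l.
  under eq_bigr do rewrite mulr_suml.
  rewrite exchange_big; apply: eq_bigr => i _ /=.
  under eq_bigr do rewrite mulr_suml.
  by rewrite exchange_big.
rewrite -big_split -sumrB; apply: eq_bigr => i _ /=.
rewrite -big_split -sumrB; apply: eq_bigr => j _ /=.
rewrite -big_split -sumrB; apply: eq_bigr => l _ /=.
by rewrite /kappa; ring.
Qed.

(** Koszul's formula for vector fields with constant components, whose brackets vanish. Testing
    against all [w] then replaces index computations in the proof of symmetry. *)
Lemma koszul_biform u v w :
  inner G (biform christoffel_coef u v) w =
  2^-1 * (inner (dG u) v w + inner (dG v) u w - inner (dG w) u v).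
Proof.
pose r : 'rV[R]_q := \row_l \sum_i \sum_j kappa i j l * u 0 i * v 0 j.
have invS k l : invmx G k l = invmx G l k.
  have e : (invmx G)^T = invmx G by rewrite trmx_inv symG.
  by rewrite -[in RHS]e mxE.
have -> : biform christoffel_coef u v = 2^-1 *: (r *m invmx G).
  apply/rowP => k; rewrite !mxE mulr_sumr.
  transitivity (\sum_i \sum_j \sum_l 2^-1 * (kappa i j l * u 0 i * v 0 j * invmx G l k)).
    apply: eq_bigr => i _; apply: eq_bigr => j _.
    rewrite /christoffel_coef mulr_sumr !mulr_suml; apply: eq_bigr => l _.
    by rewrite invS; ring.
  under [RHS]eq_bigr => l _ do rewrite mxE mulr_suml mulr_sumr.
  rewrite [RHS]exchange_big; apply: eq_bigr => i _ /=.
  under [RHS]eq_bigr => l _ do rewrite mulr_suml mulr_sumr.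
  by rewrite [RHS]exchange_big.
rewrite innerZl /inner mulmxKV// -/(K u v w) K_expand; congr (_ * _).
by rewrite mxE; apply: eq_bigr => l _; rewrite !mxE.
Qed.

Lemma christoffel_biformC u v :
  biform christoffel_coef u v = biform christoffel_coef v u.
Proof.
apply: (inner_inj unitG) => w; rewrite !koszul_biform.
by rewrite [inner (dG w) u v]innerC//; ring.
Qed.

Lemma metric_compat_biform z u v :
  inner (dG z) u v =
  inner G (biform christoffel_coef z u) v + inner G u (biform christoffel_coef z v).
Proof.
rewrite [X in _ + X]innerC// !koszul_biform [inner (dG z) v u]innerC//.
by field.
Qed.

End ChristoffelAlgebra.

Lemma ck_id (R : realType) n (U : set 'rV[R]_n) k : open U -> ck k U id.
Proof.
move=> oU; apply/ck_mxP => // a b.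
case: k => [|k]; split => //; try by move=> y _; exact: differentiable_coord.
move=> i; have -> : partial i (fun y : 'rV[R]_n => y a b) = cst (('e_i : 'rV[R]_n) a b).
  apply/funext => y; rewrite /partial.
  have := derive_mx (@derivable_id _ _ y ('e_i : 'rV[R]_n)).
  by rewrite derive_id => /matrixP/(_ a b) ->; rewrite mxE.
exact: ck_cst.
Qed.

Section LeviCivita.
Context {R : realType} {q : nat}.
Variables (W : set 'rV[R]_q) (h : 'rV[R]_q -> 'M[R]_q).

Definition metric_on : Prop :=
  [/\ open W, smooth_on W h, forall x, W x -> (h x)^T = h x
    & forall x u, W x -> u != 0 -> 0 < inner (h x) u u].

Hypothesis hW : metric_on.
Let oW : open W. Proof. by case: hW. Qed.
Let ch k : ck k W h. Proof. by case: hW => _ /smooth_onP. Qed.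
Let sym x : W x -> (h x)^T = h x. Proof. by case: hW => _ _ + _; apply. Qed.

Lemma posdef_unit n (G : 'M[R]_n) : (forall u, u != 0 -> 0 < inner G u u) -> G \in unitmx.
Proof.
move=> pG; apply: unitmx_kernel => v vG; have [//|/pG] := eqVneq v 0.
by rewrite /inner vG mul0mx mxE ltxx.
Qed.

Lemma metric_unit x : W x -> h x \in unitmx.
Proof. by move=> Wx; apply: posdef_unit => u; case: hW => _ _ _; apply. Qed.

Let dh x : W x -> differentiable h x. Proof. exact: ck_diff (ch 0). Qed.

Let Dh_entry x u i j : W x -> ('D_u h x) i j = 'D_u (fun y => h y i j) x.
Proof. by move=> Wx; rewrite derive_mx ?mxE//; exact/diff_derivable/dh. Qed.

Let Dh_sym x u : W x -> ('D_u h x)^T = 'D_u h x.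
Proof.
move=> Wx; have := is_derive_tr (derivableP (diff_derivable (v := u) (dh Wx))).
move=> [_ <-]; apply: near_eq_derive; apply: (near_open oW Wx) => y; exact: sym.
Qed.

Let christoffelE x k i j : W x ->
  christoffel h k i j x = christoffel_coef (h x) (fun u => 'D_u h x) k i j.
Proof.
move=> Wx; apply: (f_equal ( *%R 2^-1)).
apply: eq_bigr => l _; apply: (f_equal ( *%R _)).
apply: (f_equal2 (fun a b => a - b)); last exact: (esym (Dh_entry _ _ _ Wx)).
by apply: (f_equal2 +%R); exact: (esym (Dh_entry _ _ _ Wx)).
Qed.

Let christoffel_formE' x : W x ->
  christoffel_form h x = biform (christoffel_coef (h x) (fun u => 'D_u h x)).
Proof.
move=> Wx; apply/funext => u; apply/funext => v; apply/rowP => k; rewrite !mxE.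
by apply: eq_bigr => i _; apply: eq_bigr => j _; rewrite christoffelE.
Qed.

Lemma koszul x u v w : W x ->
  inner (h x) (christoffel_form h x u v) w =
  2^-1 * (inner ('D_u h x) v w + inner ('D_v h x) u w - inner ('D_w h x) u v).
Proof.
move=> Wx; rewrite christoffel_formE'//.
apply: (koszul_biform (dG := fun u => 'D_u h x)); [exact: sym|exact: metric_unit|].
by move=> z; exact/derive_partial/dh.
Qed.

Lemma christoffel_formC x u v : W x ->
  christoffel_form h x u v = christoffel_form h x v u.
Proof.
move=> Wx; rewrite christoffel_formE'//.
apply: (christoffel_biformC (dG := fun u => 'D_u h x)); [exact: sym|exact: metric_unit| |].
  by move=> z; exact: Dh_sym.
by move=> z; exact/derive_partial/dh.
Qed.

Lemma metric_compat x z u v : W x ->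
  inner ('D_z h x) u v =
  inner (h x) (christoffel_form h x z u) v + inner (h x) u (christoffel_form h x z v).
Proof.
move=> Wx; rewrite christoffel_formE'//.
apply: (metric_compat_biform (dG := fun u => 'D_u h x)); [exact: sym|exact: metric_unit| |].
  by move=> w; exact: Dh_sym.
by move=> w; exact/derive_partial/dh.
Qed.

Lemma ck_christoffel i j l k : ck k W (christoffel h l i j).
Proof.
have cinv : ck k W (fun x => invmx (h x)).
  by apply: ck_invmx => // x; exact: metric_unit.
have cp a b c : ck k W (partial a (fun y => h y b c)).
  by apply: ck_partial; have /(ck_mxP _ _ oW) := ch k.+1; apply.
apply: ckM => //; first exact: ck_cst.
apply: ck_big_sum => // m _; apply: ckM => //.
  by move/(ck_mxP _ _ oW) : cinv; apply.
apply: ckD => //; first exact: ckD.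
have := ckM oW (ck_cst k W (-1 : R)) (cp m i j).
by apply: ck_ext => // x _; rewrite mulN1r.
Qed.

Lemma christoffel_formE x : christoffel_form h x = biform (fun k i j => christoffel h k i j x).
Proof. by []. Qed.

(** Only the Christoffel symbols are differentiated; [u] and [v] are frozen. *)
Definition dchristoffel_form x z u v : 'rV[R]_q :=
  biform (fun k i j => 'D_z (christoffel h k i j) x) u v.

Lemma is_derive_christoffel_form n (f Y Z : 'rV[R]_n -> 'rV[R]_q) x u dY dZ :
  W (f x) -> differentiable f x -> is_derive x u Y dY -> is_derive x u Z dZ ->
  is_derive x u (fun y => christoffel_form h (f y) (Y y) (Z y))
    (dchristoffel_form (f x) ('D_u f x) (Y x) (Z x)
     + christoffel_form h (f x) dY (Z x) + christoffel_form h (f x) (Y x) dZ).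
Proof.
move=> Wx df HY HZ.
have Hc k i j : is_derive x u (fun y => christoffel h k i j (f y))
    ('D_('D_u f x) (christoffel h k i j) (f x)).
  by apply: is_derive_comp => //; apply: ck_diff (ck_christoffel i j k 0) Wx.
exact: (is_derive_biform Hc HY HZ).
Qed.

Lemma cov_id_cst v w : cov h id v (cst w) = fun y => christoffel_form h y v w.
Proof. by apply/funext => y; rewrite /cov derive_cst add0r derive_id. Qed.

Lemma curvatureE x u v w : W x ->
  curvature h x u v w =
    dchristoffel_form x u v w - dchristoffel_form x v u w
    + christoffel_form h x u (christoffel_form h x v w)
    - christoffel_form h x v (christoffel_form h x u w).
Proof.
move=> Wx; rewrite /curvature !cov_id_cst /cov !derive_id.
have D a b : 'D_a (fun y => christoffel_form h y b w) x = dchristoffel_form x a b w.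
  have := is_derive_christoffel_form (f := id) Wx _ (is_derive_cst b x a) (is_derive_cst w x a).
  move=> [|_ ->]; first by case: (is_diff_id x).
  rewrite derive_id -[in X in _ + X + _](scale0r 0) -[in X in _ + X](scale0r 0).
  by rewrite !christoffel_formE biformZl biformZr !scale0r !addr0.
by rewrite !D opprD addrACA addrA.
Qed.

Let commute_aux (a b c d e g k l : 'rV[R]_q) :
  a + (k + b + c) + (d + e) - (a + (l + b + d) + (c + g)) = k - l + e - g.
Proof. by apply/rowP => i; rewrite !mxE; ring. Qed.

Let skew_aux (a a' b c d d' : R) :
  a + b + (c + d) = a' + c + (b + d') -> a - a' = - (d - d').
Proof. by move=> H; lra. Qed.

Section AlongMap.
Variables (n : nat) (U : set 'rV[R]_n) (f : 'rV[R]_n -> 'rV[R]_q).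
Hypotheses (oU : open U) (cf : forall k, ck k U f) (UW : forall x, U x -> W (f x)).

Lemma ck_cov u Y k : (forall k, ck k U Y) -> ck k U (cov h f u Y).
Proof.
move=> cY; apply: ckD => //; first exact: ck_derive.
apply/ck_mxP => // a l; under eq_fun do rewrite mxE.
apply: ck_big_sum => // i _; apply: ck_big_sum => // j _.
apply: ckM => //; last by move/(ck_mxP _ _ oU) : (cY k); apply.
apply: ckM => //; last first.
  have c : ck k U (fun y => 'D_u f y) by exact: ck_derive.
  by move/(ck_mxP _ _ oU) : c; apply.
exact: (ck_comp oU UW (ck_christoffel i j l k)).
Qed.

Lemma is_derive_inner_along Y Z x u : U x -> differentiable Y x -> differentiable Z x ->
  is_derive x u (fun y => inner (h (f y)) (Y y) (Z y))
    (inner (h (f x)) (cov h f u Y x) (Z x) + inner (h (f x)) (Y x) (cov h f u Z x)).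
Proof.
move=> Ux dY dZ; have Wx := UW Ux.
have df : differentiable f x by apply: ck_diff (cf 0) Ux.
have Hh := is_derive_comp u df (dh Wx).
have := is_derive_inner Hh (derivableP (diff_derivable (v := u) dY))
   (derivableP (diff_derivable (v := u) dZ)).
rewrite (metric_compat _ _ _ Wx) (_ : forall a b c d : R, a + (b + c) + d = (a + b) + (d + c)).
  by rewrite -innerDl -innerDr.
by move=> a b c d; ring.
Qed.

(** The directions are constant vectors of the domain, so there is no bracket term. The second
    derivatives of [Z] and of [f] cancel by Schwarz, and what is left is the coordinate expression
    of the curvature. *)
Lemma cov_commute Z x u v : U x -> (forall k, ck k U Z) ->
  cov h f u (cov h f v Z) x - cov h f v (cov h f u Z) x =
  curvature h (f x) ('D_u f x) ('D_v f x) (Z x).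
Proof.
move=> Ux cZ; have Wx := UW Ux.
have df : differentiable f x by apply: ck_diff (cf 0) Ux.
have ddf w : differentiable (fun y => 'D_w f y) x by apply: ck_diff (ck_derive w oU (cf 1)) Ux.
have dZ : differentiable Z x by apply: ck_diff (cZ 0) Ux.
have ddZ w : differentiable (fun y => 'D_w Z y) x by apply: ck_diff (ck_derive w oU (cZ 1)) Ux.
have D a b : 'D_a (cov h f b Z) x = 'D_a (fun y => 'D_b Z y) x
   + (dchristoffel_form (f x) ('D_a f x) ('D_b f x) (Z x)
      + christoffel_form h (f x) ('D_a (fun y => 'D_b f y) x) (Z x)
      + christoffel_form h (f x) ('D_b f x) ('D_a Z x)).
  have H := is_derive_christoffel_form Wx df (derivableP (diff_derivable (v := a) (ddf b)))
    (derivableP (diff_derivable (v := a) dZ)).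
  have [_ ->] := is_deriveD (derivableP (diff_derivable (v := a) (ddZ b))) H.
  by [].
have C a b : cov h f a (cov h f b Z) x = 'D_a (fun y => 'D_b Z y) x
   + (dchristoffel_form (f x) ('D_a f x) ('D_b f x) (Z x)
      + christoffel_form h (f x) ('D_a (fun y => 'D_b f y) x) (Z x)
      + christoffel_form h (f x) ('D_b f x) ('D_a Z x))
   + (christoffel_form h (f x) ('D_a f x) ('D_b Z x) +
      christoffel_form h (f x) ('D_a f x) (christoffel_form h (f x) ('D_b f x) (Z x))).
  by rewrite -(D a b) christoffel_formE -biformDr.
rewrite (C u v) (C v u) (curvatureE _ _ _ Wx).
rewrite (schwarz_dir u v oU Ux (cZ 2)) (schwarz_dir u v oU Ux (cf 2)).
exact: commute_aux.
Qed.

(** Torsion-freeness along a map: second derivatives commute and Christoffel symbols are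
    symmetric. *)
Lemma cov_partialC x u v : U x -> cov h f u (fun y => 'D_v f y) x = cov h f v (fun y => 'D_u f y) x.
Proof.
move=> Ux.
exact: (f_equal2 +%R (schwarz_dir u v oU Ux (cf 2)) (christoffel_formC _ _ (UW Ux))).
Qed.

End AlongMap.

(** Second derivatives of the inner product of constant [w] and [z] are expanded by metric
    compatibility; their symmetry leaves exactly the two curvature terms. *)
Lemma curvature_skew x u v w z : W x ->
  inner (h x) (curvature h x u v w) z = - inner (h x) w (curvature h x u v z).
Proof.
move=> Wx.
have cid k : ck k W (@id 'rV[R]_q) by exact: ck_id.
have cc t a k : ck k W (cov h id a (cst t)).
  by apply: ck_cov => // l; exact: ck_cst.
have E a b : 'D_a (fun y => 'D_b (fun y => inner (h y) w z) y) x =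
  inner (h x) (cov h id a (cov h id b (cst w)) x) z
  + inner (h x) (cov h id b (cst w) x) (cov h id a (cst z) x)
  + (inner (h x) (cov h id a (cst w) x) (cov h id b (cst z) x)
  + inner (h x) w (cov h id a (cov h id b (cst z)) x)).
  have -> : 'D_a (fun y => 'D_b (fun y => inner (h y) w z) y) x =
    'D_a (fun y => inner (h y) (cov h id b (cst w) y) (cst z y) +
                   inner (h y) (cst w y) (cov h id b (cst z) y)) x.
    apply: near_eq_derive; apply: (near_open oW Wx) => y Wy.
    by have [_ <-] := is_derive_inner_along (f := id) cid (fun x W => W) b Wy
      (differentiable_cst w y) (differentiable_cst z y).
  have dc t s : differentiable (cov h id s (cst t)) x by apply: ck_diff (cc t s 0) Wx.
  have H1 := is_derive_inner_along (f := id) cid (fun x W => W) a Wx (dc w b) (differentiable_cst z x).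
  have H2 := is_derive_inner_along (f := id) cid (fun x W => W) a Wx (differentiable_cst w x) (dc z b).
  by have [_ ->] := is_deriveD H1 H2.
(* The scalar is treated as a 1x1 matrix because [schwarz_dir] speaks of matrix-valued maps. *)
have cw : ck 2 W (fun y => (w *m h y *m z^T)).
  by apply: ck_mulmx => //; [apply: ck_mulmx => //|]; exact: ck_cst.
have S : 'D_u (fun y => 'D_v (fun y => inner (h y) w z) y) x =
         'D_v (fun y => 'D_u (fun y => inner (h y) w z) y) x.
  have T a b : 'D_a (fun y => 'D_b (fun y => inner (h y) w z) y) x =
      ('D_a (fun y => 'D_b (fun y => (w *m h y *m z^T)) y) x) 0 0.
    have d : differentiable (fun y => 'D_b (fun y => (w *m h y *m z^T)) y) x.
      by apply: ck_diff (ck_derive b oW cw) Wx.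
    rewrite [in RHS]derive_mx; last exact: diff_derivable.
    rewrite mxE; apply: near_eq_derive; apply: (near_open oW Wx) => y Wy.
    have dw := diff_derivable (v := b) (ck_diff cw Wy).
    by rewrite [in RHS](derive_mx dw) mxE.
  apply: etrans (T u v) (etrans _ (esym (T v u))).
  exact: (f_equal (fun A : 'M[R]_1 => A 0 0) (schwarz_dir u v oW Wx cw)).
rewrite /curvature innerBl innerBr.
apply: skew_aux; apply: etrans (esym (E u v)) _; apply: etrans S _; exact: E.
Qed.

End LeviCivita.

(** * Tension and bitension of a hypersurface *)

(** The sizes are equal only propositionally, so the equality is eliminated before the square case
    applies. *)
Lemma mulmx1_swap (R : comUnitRingType) p q (A : 'M[R]_(p, q)) (B : 'M[R]_(q, p)) :
  p = q -> A *m B = 1%:M -> B *m A = 1%:M.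
Proof. by move=> e; move: A B; rewrite e => A B /mulmx1C. Qed.

(* Everything is evaluated at one point: [G] is the ambient metric, the rows of
   [D] are the tangent frame, those of [N] the derivatives of the normal [nu],
   row [j] of [S i] is the second covariant derivative of [nu] in the directions
   [i], [j]; [C i] collects the Christoffel symbols Gamma_{i,.}, [B] is the second
   fundamental form, [B' i] its derivative and [Rm] the curvature. *)
Section HypersurfaceAlgebra.
Context {R : realType} {n q : nat}.
Variables (G : 'M[R]_q) (D : 'M[R]_(n, q)) (nu : 'rV[R]_q).
Hypotheses (dim : q = (n + 1)%N) (symG : G^T = G) (unitG : G \in unitmx).
Hypotheses (nuG : inner G nu nu = 1) (Dnu : forall i, inner G (row i D) nu = 0).
Hypothesis unitg : D *m G *m D^T \in unitmx.
Let g := D *m G *m D^T.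

Lemma inner_row p r (A : 'M[R]_(p, q)) (B : 'M[R]_(r, q)) i j :
  inner G (row i A) (row j B) = (A *m G *m B^T) i j.
Proof.
rewrite /inner -row_mul tr_row [LHS]mxE [RHS]mxE; apply: eq_bigr => k _.
by rewrite [row _ _ _ _]mxE [col _ _ _ _]mxE.
Qed.

Lemma tangent_normal : D *m G *m nu^T = 0.
Proof.
by apply/matrixP => i j; rewrite -inner_row row_id Dnu mxE.
Qed.

Lemma normal_tangent : nu *m G *m D^T = 0.
Proof. by rewrite -[nu]trmxK -symG -trmx_mul -[D^T]trmxK -trmx_mul trmxK mulmxA tangent_normal trmx0. Qed.

Lemma normal_normal : nu *m G *m nu^T = 1%:M.
Proof. by apply/matrixP => i j; rewrite !ord1 [RHS]mxE. Qed.

(** The rows of [D] together with [nu] form a square matrix because q = n + 1. Orthogonality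
    exhibits a one-sided inverse, which is then two-sided. *)
Lemma frame_complete : G *m D^T *m invmx g *m D + G *m nu^T *m nu = 1%:M.
Proof.
rewrite -mul_row_col; apply: mulmx1_swap (esym dim) _.
rewrite mul_col_row !mulmxA normal_normal tangent_normal normal_tangent mul0mx.
by rewrite mulmxV// scalar_mx_block.
Qed.

Lemma frame_decomp (w : 'rV[R]_q) :
  w = w *m G *m D^T *m invmx g *m D + inner G w nu *: nu.
Proof.
rewrite -[LHS]mulmx1 -frame_complete mulmxDr !mulmxA; congr (_ + _).
by rewrite {1}[w *m G *m nu^T]mx11_scalar mul_scalar_mx.
Qed.

Lemma frame_eq0 (w : 'rV[R]_q) :
  (forall i, inner G w (row i D) = 0) -> inner G w nu = 0 -> w = 0.
Proof.
move=> wD wn; rewrite [w]frame_decomp wn scale0r addr0.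
suff -> : w *m G *m D^T = 0 by rewrite !mul0mx.
by apply/matrixP => i j; rewrite ord1 -inner_row row_id wD mxE.
Qed.

(** Splits an ambient trace into a tangential trace and a normal entry; this is how the Ricci trace
    becomes a sum over the tangent frame. *)
Lemma frame_trace (M : 'M[R]_q) :
  \tr (invmx g *m (D *m M *m G *m D^T)) + inner G (nu *m M) nu = \tr M.
Proof.
rewrite -[M in RHS]mulmx1 -frame_complete mulmxDr mxtraceD; congr (_ + _).
  by rewrite [LHS]mxtrace_mulC -!(mulmxA D) [LHS]mxtrace_mulC !mulmxA.
by rewrite !mulmxA [RHS]mxtrace_mulC !mulmxA [X in \tr X]mx11_scalar mxtrace_scalar.
Qed.

Variables (N : 'M[R]_(n, q)) (S : 'I_n -> 'M[R]_(n, q)) (C B' : 'I_n -> 'M[R]_n).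
Variables (Rm : 'rV[R]_q -> 'rV[R]_q -> 'rV[R]_q -> 'rV[R]_q)
  (RM : 'rV[R]_q -> 'rV[R]_q -> 'M[R]_q).
Let B := - (N *m G *m D^T).
Hypotheses (Nnu : forall i, inner G (row i N) nu = 0) (symB : B^T = B).
Hypothesis S_normal : forall i j, inner G (row j (S i)) nu = - inner G (row i N) (row j N).
Hypothesis B'E : forall i, B' i = - (S i *m G *m D^T) + C i *m B + B *m (C i)^T.
Hypothesis symB' : forall i, (B' i)^T = B' i.
(** The derivative of tr(B g^-1) in direction [i], the derivative of g being C_i g + g C_i^T. *)
Hypothesis trace_const : forall i,
  \tr (B' i *m invmx g - B *m (invmx g *m (C i *m g + g *m (C i)^T) *m invmx g)) = 0.
Hypothesis S_commute : forall i j, row j (S i) - row i (S j) = Rm (row i D) (row j D) nu.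
Hypothesis RmE : forall u v w, Rm u v w = u *m RM v w.
Hypothesis Rm_skew : forall u v w z, inner G (Rm u v w) z = - inner G w (Rm u v z).

Let symg : g^T = g.
Proof. by rewrite /g !trmx_mul trmxK symG mulmxA. Qed.

Let sym_invg : (invmx g)^T = invmx g.
Proof. by rewrite trmx_inv symg. Qed.

Let trace_sum (X : 'M[R]_n) :
  \sum_i \sum_j invmx g i j * X i j = \tr (invmx g *m X).
Proof.
rewrite mxtrace_mulC -mxtrace_tr trmx_mul sym_invg.
apply: eq_bigr => i _; rewrite mxE; apply: eq_bigr => j _.
by rewrite mxE.
Qed.

Let skew0 u v : inner G (Rm u v nu) nu = 0.
Proof.
have := Rm_skew u v nu nu; rewrite [X in _ = - X]innerC// => /eqP.
by rewrite -addr_eq0 -mulr2n mulrn_eq0/= => /eqP.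
Qed.

(** [B] and its derivatives are symmetric, so by [B'E] the pairing of [S i] with the frame is
    symmetric as well. *)
Let S_sym i j l : inner G (row j (S i)) (row l D) = inner G (row l (S i)) (row j D).
Proof.
have : (S i *m G *m D^T)^T = S i *m G *m D^T.
  have -> : S i *m G *m D^T = C i *m B + B *m (C i)^T - B' i.
    rewrite B'E; move: (S i *m G *m D^T) (C i *m B) (B *m (C i)^T) => s a b.
    by apply/matrixP => x y; rewrite !mxE; ring.
  by rewrite linearB linearD /= !trmx_mul trmxK symB symB' [X in X - _]addrC.
by rewrite !inner_row => /matrixP/(_ l j); rewrite mxE => ->.
Qed.

(** Up to sign, the derivative of tr A in direction [l]: the Christoffel terms coming from B and
    from g^-1 cancel under the trace. *)
Let trace_S l : \sum_i \sum_j invmx g i j * inner G (row i (S l)) (row j D) = 0.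
Proof.
under eq_bigr do under eq_bigr do rewrite inner_row.
rewrite trace_sum mxtrace_mulC; apply: oppr_inj; rewrite oppr0.
rewrite -[RHS](trace_const l) B'E.
have cancel (g0 K : 'M[R]_n) : g0 \in unitmx ->
    invmx g0 *m (K *m g0 + g0 *m K^T) *m invmx g0 = invmx g0 *m K + K^T *m invmx g0.
  by move=> u0; rewrite mulmxDr mulmxDl !mulmxA mulmxK// mulVmx// mul1mx.
rewrite cancel//; move: (invmx g) (S l *m G *m D^T) B (C l) => i s b c.
have trN (X : 'M[R]_n) : \tr (- X) = - \tr X by exact: raddfN.
rewrite mulmxDr !mulmxDl mulNmx !mulmxA !mxtraceD !trN !mxtraceD.
by rewrite -[c *m b *m i]mulmxA [\tr (c *m _)]mxtrace_mulC; ring.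
Qed.

(** Weingarten's formula writes [N] as -A D, so contracting the products of the rows of [N] with
    g^-1 gives tr A^2. *)
Lemma laplacian_normal :
  \sum_i \sum_j invmx g i j * inner G (row j (S i)) nu = - \tr (B *m invmx g *m (B *m invmx g)).
Proof.
have NE : N = - (B *m invmx g *m D).
  apply/row_matrixP => i; rewrite [LHS]frame_decomp Nnu scale0r addr0.
  by rewrite /B !mulNmx opprK !row_mul.
under eq_bigr do under eq_bigr do rewrite S_normal inner_row mulrN.
under eq_bigr do rewrite sumrN.
rewrite sumrN trace_sum; congr (- _).
have NN : N *m G *m N^T = (B *m invmx g) *m g *m (B *m invmx g)^T.
  move: NE; move: (B *m invmx g) => X ->.
  by rewrite linearN/= !mulNmx mulmxN opprK trmx_mul /g !mulmxA.
rewrite NN mulmxKV// trmx_mul sym_invg symB !mulmxA.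
by rewrite mxtrace_mulC !mulmxA.
Qed.

Lemma curvature_trace w z :
  \sum_i \sum_j invmx g i j * inner G (Rm (row i D) w z) (row j D) =
  \tr (RM w z) - inner G (Rm nu w z) nu.
Proof.
under eq_bigr do under eq_bigr do rewrite RmE -row_mul inner_row.
by rewrite trace_sum -(frame_trace (RM w z)) -RmE addrK.
Qed.

(** The traced Codazzi equation. Symmetry of [S i] moves [l] into the second derivative, commuting
    that derivative costs a curvature term, and the commuted sum vanishes by [trace_S]. The
    curvature sum is the full trace, since the missing normal entry is zero by skewness. *)
Lemma laplacian_tangent l :
  \sum_i \sum_j invmx g i j * inner G (row j (S i)) (row l D) = \tr (RM (row l D) nu).
Proof.
transitivity (\sum_i \sum_j invmx g i j * inner G (row i (S l)) (row j D) +
  \sum_i \sum_j invmx g i j * inner G (Rm (row i D) (row l D) nu) (row j D)).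
  rewrite -big_split; apply: eq_bigr => i _; rewrite -big_split; apply: eq_bigr => j _ /=.
  rewrite S_sym -mulrDr -innerDl -S_commute addrC subrK //.
by rewrite trace_S add0r curvature_trace skew0 subr0.
Qed.

End HypersurfaceAlgebra.

(** * Curvature as a trilinear map and the Ricci tensor as a trace *)

Section CurvatureAlgebra.
Context {R : realType} {q : nat}.
Variables (c : 'I_q -> 'I_q -> 'I_q -> R) (dc : 'rV[R]_q -> 'I_q -> 'I_q -> 'I_q -> R).
Hypothesis dcD : forall u v k i j, dc (u + v) k i j = dc u k i j + dc v k i j.
Hypothesis dcZ : forall a u k i j, dc (a *: u) k i j = a * dc u k i j.

Definition curvature_biform u v w : 'rV[R]_q :=
  biform (dc u) v w - biform (dc v) u w + biform c u (biform c v w)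
  - biform c v (biform c u w).

Let biform_dcD u v y z : biform (dc (u + v)) y z = biform (dc u) y z + biform (dc v) y z.
Proof.
rewrite -biformDc; apply/rowP => k; rewrite !mxE.
by apply: eq_bigr => i _; apply: eq_bigr => j _; rewrite dcD.
Qed.

Let biform_dcZ a u y z : biform (dc (a *: u)) y z = a *: biform (dc u) y z.
Proof.
rewrite -biformZc; apply/rowP => k; rewrite !mxE.
by apply: eq_bigr => i _; apply: eq_bigr => j _; rewrite dcZ.
Qed.

Lemma curvature_biformC u v w : curvature_biform u v w = - curvature_biform v u w.
Proof.
rewrite /curvature_biform.
move: (biform (dc u) v w) (biform (dc v) u w) (biform c u _) (biform c v _) => a b d e.
by apply/rowP => i; rewrite !mxE; ring.
Qed.

Lemma curvature_biformD1 u u' v w :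
  curvature_biform (u + u') v w = curvature_biform u v w + curvature_biform u' v w.
Proof.
rewrite /curvature_biform biform_dcD !biformDl biformDr.
by apply/rowP => i; rewrite ![in LHS]mxE ![in RHS]mxE; lra.
Qed.

Lemma curvature_biformZ1 a u v w :
  curvature_biform (a *: u) v w = a *: curvature_biform u v w.
Proof.
by rewrite /curvature_biform biform_dcZ !biformZl biformZr !scalerBr scalerDr scalerBr.
Qed.

Lemma curvature_biformD2 u v v' w :
  curvature_biform u (v + v') w = curvature_biform u v w + curvature_biform u v' w.
Proof. by rewrite curvature_biformC curvature_biformD1 opprD -!curvature_biformC. Qed.

Lemma curvature_biformZ2 a u v w :
  curvature_biform u (a *: v) w = a *: curvature_biform u v w.
Proof. by rewrite curvature_biformC curvature_biformZ1 -scalerN -curvature_biformC. Qed.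

Lemma curvature_biformD3 u v w w' :
  curvature_biform u v (w + w') = curvature_biform u v w + curvature_biform u v w'.
Proof.
rewrite /curvature_biform !biformDr.
by apply/rowP => i; rewrite ![in LHS]mxE ![in RHS]mxE; lra.
Qed.

Lemma curvature_biformZ3 a u v w :
  curvature_biform u v (a *: w) = a *: curvature_biform u v w.
Proof.
by rewrite /curvature_biform !biformZr !scalerBr scalerDr scalerBr.
Qed.

(** The matrix of u |-> R(u, v)w, the endomorphism whose trace is Ric(v, w). *)
Definition curvature_mx v w : 'M[R]_q := \matrix_(k, l) curvature_biform 'e_k v w 0 l.

Lemma curvature_biform_mx u v w : curvature_biform u v w = u *m curvature_mx v w.
Proof.
rewrite [LHS](row_linear_expand (F := fun z => curvature_biform z v w)).
- by rewrite mulmx_sum_row; apply: eq_bigr => i _; congr (_ *: _); apply/rowP => l; rewrite !mxE.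
- by move=> y z; exact: curvature_biformD1.
- by move=> a y; exact: curvature_biformZ1.
Qed.

Lemma ricci_trace y z :
  inner (\matrix_(i, j) \sum_k (curvature_biform 'e_k 'e_i 'e_j) 0 k) y z = \tr (curvature_mx y z).
Proof.
have E k : curvature_biform 'e_k y z =
    \sum_i \sum_j (y 0 i * z 0 j) *: curvature_biform 'e_k 'e_i 'e_j.
  rewrite [LHS](row_linear_expand (F := fun w => curvature_biform 'e_k w z)).
  - apply: eq_bigr => i _.
    rewrite [curvature_biform _ _ z](row_linear_expand (F := fun w => curvature_biform 'e_k 'e_i w)).
    + by rewrite scaler_sumr; apply: eq_bigr => j _; rewrite scalerA.
    + by move=> v w; exact: curvature_biformD3.
    + by move=> a w; exact: curvature_biformZ3.
  - by move=> v w; exact: curvature_biformD2.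
  - by move=> a w; exact: curvature_biformZ2.
rewrite inner_expand /mxtrace; under [RHS]eq_bigr do rewrite mxE E summxE.
rewrite [RHS]exchange_big; apply: eq_bigr => i _ /=.
under [RHS]eq_bigr do rewrite summxE.
rewrite [RHS]exchange_big; apply: eq_bigr => j _ /=.
rewrite mxE mulr_sumr mulr_suml; apply: eq_bigr => k _.
by rewrite [RHS]mxE; ring.
Qed.

End CurvatureAlgebra.

Section Curvature.
Context {R : realType} {q : nat}.
Variables (W : set 'rV[R]_q) (h : 'rV[R]_q -> 'M[R]_q).
Hypothesis hW : metric_on W h.

Definition christoffel_at x k i j := christoffel h k i j x.
Definition dchristoffel_at x (z : 'rV[R]_q) k i j := 'D_z (christoffel h k i j) x.

Lemma curvature_at x u v w : W x ->
  curvature h x u v w = curvature_biform (christoffel_at x) (dchristoffel_at x) u v w.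
Proof. by move=> Wx; rewrite (curvatureE hW). Qed.

Lemma dchristoffel_atD x u v k i j : W x -> dchristoffel_at x (u + v) k i j =
  dchristoffel_at x u k i j + dchristoffel_at x v k i j.
Proof. by move=> Wx; apply: deriveD_dir; apply: ck_diff (ck_christoffel hW i j k 0) Wx. Qed.

Lemma dchristoffel_atZ x a u k i j : W x -> dchristoffel_at x (a *: u) k i j =
  a * dchristoffel_at x u k i j.
Proof. by move=> Wx; apply: deriveZ_dir; apply: ck_diff (ck_christoffel hW i j k 0) Wx. Qed.

Definition ricci_mx x := curvature_mx (christoffel_at x) (dchristoffel_at x).

Lemma curvatureZ2 x u a v w : W x -> curvature h x u (a *: v) w = a *: curvature h x u v w.
Proof.
move=> Wx; rewrite !curvature_at//; apply: curvature_biformZ2 => *.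
exact: dchristoffel_atZ.
Qed.

Lemma curvature_mxE x u v w : W x -> curvature h x u v w = u *m ricci_mx x v w.
Proof.
move=> Wx; rewrite curvature_at//; apply: curvature_biform_mx => *.
  exact: dchristoffel_atD.
exact: dchristoffel_atZ.
Qed.

Lemma inner_ricci x y z : W x -> inner (ricci h x) y z = \tr (ricci_mx x y z).
Proof.
move=> Wx; rewrite -ricci_trace; [| |].
- congr (inner _ y z); apply/matrixP => i j; rewrite !mxE.
  by apply: eq_bigr => k _; rewrite curvature_at.
- by move=> *; exact: dchristoffel_atD.
- by move=> *; exact: dchristoffel_atZ.
Qed.

End Curvature.

Lemma derive_const_on (R : realType) n (W : normedModType R) (U : set 'rV[R]_n)
    (F : 'rV[R]_n -> W) c x u :
  open U -> U x -> (forall y, U y -> F y = c) -> 'D_u F x = 0.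
Proof.
move=> oU Ux Fc; rewrite -(derive_cst c x u).
exact/near_eq_derive/(near_open oU Ux).
Qed.

Lemma is_derive_trace (R : realType) (V : normedModType R) n (F : V -> 'M[R]_n) x v dF :
  is_derive x v F dF -> is_derive x v (fun y => \tr (F y)) (\tr dF).
Proof. by move=> /is_derive_mxP HF; apply: is_derive_fin_sum => i; exact: HF. Qed.

Section Hypersurface.
Context {R : realType} {n q : nat}.
Variables (W : set 'rV[R]_q) (h : 'rV[R]_q -> 'M[R]_q) (hW : metric_on W h).
Variables (U : set 'rV[R]_n) (f : 'rV[R]_n -> 'rV[R]_q) (g : 'rV[R]_n -> 'M[R]_n).
Hypotheses (gU : metric_on U g) (gE : forall x, U x -> g x = pullback_metric h f x).
Hypotheses (sf : smooth_on U f) (UW : forall x, U x -> W (f x)).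
Variable nu : 'rV[R]_n -> 'rV[R]_q.
Hypotheses (dim : q = (n + 1)%N) (nuU : unit_normal_on h f U nu).

Let oU : open U. Proof. by case: gU. Qed.
Let cf k : ck k U f. Proof. by move/smooth_onP : sf; apply. Qed.
Let cnu k : ck k U nu. Proof. by case: nuU => /smooth_onP + _ _; apply. Qed.
Let cp i k : ck k U (partial i f). Proof. exact/ck_partial. Qed.
Let cg k : ck k U g. Proof. by case: gU => _ /smooth_onP + _ _; apply. Qed.
Let cN i k : ck k U (cov h f 'e_i nu).
Proof. exact: (ck_cov hW oU cf UW). Qed.

Let symh x : W x -> (h x)^T = h x. Proof. by case: hW => _ _ + _; apply. Qed.
Let nu1 x : U x -> inner (h (f x)) (nu x) (nu x) = 1. Proof. by case: nuU => _ + _; apply. Qed.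
Let nup x i : U x -> inner (h (f x)) (partial i f x) (nu x) = 0. Proof. by case: nuU => _ _ +; apply. Qed.

Let along Y Z x u : U x -> ck 0 U Y -> ck 0 U Z ->
  'D_u (fun y => inner (h (f y)) (Y y) (Z y)) x =
  inner (h (f x)) (cov h f u Y x) (Z x) + inner (h (f x)) (Y x) (cov h f u Z x).
Proof.
move=> Ux cY cZ.
by have [_ ->] := is_derive_inner_along hW cf UW u Ux (ck_diff cY Ux) (ck_diff cZ Ux).
Qed.

Let inner_along_const Y Z c x u : U x -> ck 0 U Y -> ck 0 U Z ->
  (forall y, U y -> inner (h (f y)) (Y y) (Z y) = c) ->
  inner (h (f x)) (cov h f u Y x) (Z x) = - inner (h (f x)) (Y x) (cov h f u Z x).
Proof.
move=> Ux cY cZ H; apply/eqP; rewrite -addr_eq0 -along//; apply/eqP.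
exact: derive_const_on oU Ux H.
Qed.

Let N_nu x i : U x -> inner (h (f x)) (cov h f 'e_i nu x) (nu x) = 0.
Proof.
move=> Ux; have := inner_along_const 'e_i Ux (cnu 0) (cnu 0) nu1.
rewrite [X in _ = - X](innerC _ _ (symh (UW Ux))) => /eqP.
by rewrite -addr_eq0 -mulr2n mulrn_eq0/= => /eqP.
Qed.

Let weingarten x i j : U x ->
  inner (h (f x)) (cov h f 'e_i (partial j f) x) (nu x) =
  - inner (h (f x)) (cov h f 'e_i nu x) (partial j f x).
Proof.
move=> Ux; rewrite [X in _ = - X](innerC _ _ (symh (UW Ux))).
exact: (inner_along_const 'e_i Ux (cp j 0) (cnu 0) (fun y Uy => nup j Uy)).
Qed.

(** The factor of [shape_operator] in front of [invmx (g x)], kept apart because it is symmetric,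
    whereas the matrix of the shape operator need not be. *)
Definition second_form x : 'M[R]_n :=
  \matrix_(i, j) - inner (h (f x)) (cov h f 'e_i nu x) (partial j f x).

Let second_formE x i j : second_form x i j =
  - inner (h (f x)) (cov h f 'e_i nu x) (partial j f x).
Proof. exact: mxE. Qed.

Let cov_pC x i j : U x -> cov h f 'e_i (partial j f) x = cov h f 'e_j (partial i f) x.
Proof. by move=> Ux; exact: (cov_partialC hW oU cf UW 'e_i 'e_j Ux). Qed.

(** Differentiating the orthogonality of [nu] to the tangent vectors turns the entries into normal
    parts of second covariant derivatives of [f], which are symmetric by torsion-freeness. *)
Lemma second_form_sym x : U x -> (second_form x)^T = second_form x.
Proof.
move=> Ux; apply/matrixP => i j; rewrite [LHS]mxE.
apply: etrans (second_formE x j i) _; apply: etrans _ (esym (second_formE x i j)).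
apply: etrans (esym (weingarten j i Ux)) _; apply: etrans _ (weingarten i j Ux).
exact: (f_equal (fun z => inner (h (f x)) z (nu x)) (cov_pC j i Ux)).
Qed.

Let Gm x i : 'M[R]_n := \matrix_(j, k) christoffel g k i j x.

Let christoffel_delta x i j k : (christoffel_form g x 'e_i 'e_j) 0 k = christoffel g k i j x.
Proof.
rewrite mxE (bigD1 i)//= [X in _ + X]big1 ?addr0; last first.
  by move=> a ai; rewrite big1// => b _; rewrite mxE eqxx (negbTE ai)/= mulr0 mul0r.
rewrite (bigD1 j)//= [X in _ + X]big1 ?addr0; last first.
  by move=> b bj; rewrite [X in _ * X]mxE eqxx (negbTE bj)/= mulr0.
by rewrite !mxE !eqxx !mulr1.
Qed.

Let row_Gm x i j : row j (Gm x i) = christoffel_form g x 'e_i 'e_j.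
Proof. by apply/rowP => k; rewrite 2!mxE christoffel_delta. Qed.

Let christoffelC x i j k : U x -> christoffel g k i j x = christoffel g k j i x.
Proof. by move=> Ux; rewrite -!christoffel_delta (christoffel_formC gU). Qed.

Let inner_delta (A : 'M[R]_n) i j : inner A 'e_i 'e_j = A i j.
Proof. by rewrite /inner trmx_delta -rowE -colE !mxE. Qed.

Let Dg x l i j : U x -> ('D_('e_l) g x) i j =
  inner (h (f x)) (cov h f 'e_l (partial i f) x) (partial j f x)
  + inner (h (f x)) (partial i f x) (cov h f 'e_l (partial j f) x).
Proof.
move=> Ux; rewrite derive_mx; last by apply/diff_derivable/(ck_diff (cg 0) Ux).
rewrite mxE -along//; try exact: cp.
apply: near_eq_derive; apply: (near_open oU Ux) => y Uy.
by rewrite gE// mxE.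
Qed.

Let koszul_aux (a b c x y z : R) :
  x = a + b -> y = a + c -> z = b + c -> a = 2^-1 * (x + y - z).
Proof. by move=> -> -> ->; field. Qed.

Let inner_Dg x l i j : U x -> inner ('D_('e_l) g x) 'e_i 'e_j =
  inner (h (f x)) (cov h f 'e_l (partial i f) x) (partial j f x)
  + inner (h (f x)) (partial i f x) (cov h f 'e_l (partial j f) x).
Proof. by move=> Ux; rewrite inner_delta; exact: Dg. Qed.

(** Each derivative of the induced metric is a sum of two pairings of this kind, and Koszul's
    combination of three of them solves for one. Thus the induced connection is the tangential part
    of the ambient one. *)
Let tangent_part x i j l : U x ->
  inner (h (f x)) (cov h f 'e_i (partial j f) x) (partial l f x) =
  \sum_k christoffel g k i j x * g x k l.
Proof.
move=> Ux.
have -> : \sum_k christoffel g k i j x * g x k l = inner (g x) (christoffel_form g x 'e_i 'e_j) 'e_l.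
  rewrite /inner trmx_delta -colE [RHS]mxE [RHS]mxE.
  by apply: eq_bigr => k _; rewrite christoffel_delta.
apply: etrans _ (esym (koszul gU 'e_i 'e_j 'e_l Ux)).
apply: (koszul_aux (b := inner (h (f x)) (partial j f x) (cov h f 'e_i (partial l f) x))
  (c := inner (h (f x)) (partial i f x) (cov h f 'e_j (partial l f) x))).
- exact: inner_Dg.
- apply: etrans (inner_Dg j i l Ux) _.
  exact: (f_equal (fun w => inner (h (f x)) w _ + _) (cov_pC j i Ux)).
- apply: etrans (inner_Dg l i j Ux) _.
  apply: (f_equal2 +%R).
    rewrite (innerC _ (partial j f x) (symh (UW Ux))).
    exact: (f_equal (inner (h (f x)) (partial j f x)) (cov_pC l i Ux)).
  exact: (f_equal (inner (h (f x)) (partial i f x)) (cov_pC l j Ux)).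
Qed.

Let gJ x : U x -> jac f x *m h (f x) *m (jac f x)^T = g x.
Proof.
move=> Ux; apply/matrixP => i j.
apply: etrans (esym (inner_row (h (f x)) (jac f x) (jac f x) i j)) _.
rewrite !row_jac.
by rewrite gE//; apply: esym; exact: mxE.
Qed.

Let unitg x : U x -> jac f x *m h (f x) *m (jac f x)^T \in unitmx.
Proof. by move=> Ux; rewrite gJ//; exact: (metric_unit gU). Qed.

Let frame x i : U x -> inner (h (f x)) (row i (jac f x)) (nu x) = 0.
Proof. by move=> Ux; rewrite row_jac; exact: nup. Qed.

Lemma hypersurface_frame_eq0 x w : U x ->
  (forall i, inner (h (f x)) w (partial i f x) = 0) ->
  inner (h (f x)) w (nu x) = 0 -> w = 0.
Proof.
move=> Ux Hp; apply: (frame_eq0 dim (symh (UW Ux)) (nu1 Ux) (fun i => frame i Ux) (unitg Ux)).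
by move=> i; rewrite row_jac.
Qed.

Let Nm x : 'M[R]_(n, q) := \matrix_(i, j) (cov h f 'e_i nu x) 0 j.

Let row_Nm x i : row i (Nm x) = cov h f 'e_i nu x.
Proof. by apply/rowP => j; rewrite 2!mxE. Qed.

Let second_form_mx x : second_form x = - (Nm x *m h (f x) *m (jac f x)^T).
Proof.
apply/matrixP => i j; apply: etrans (second_formE x i j) _.
by rewrite [RHS]mxE -inner_row row_Nm row_jac.
Qed.

Let inner_christoffel x i j w : U x ->
  inner (h (f x)) w (christoffel_form g x 'e_i 'e_j *m jac f x) =
  \sum_k christoffel g k i j x * inner (h (f x)) w (partial k f x).
Proof.
move=> Ux; rewrite mulmx_sum_row inner_sumr; apply: eq_bigr => k _.
by rewrite innerZr row_jac christoffel_delta.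
Qed.

Let inner_christoffelN x i j w : U x ->
  inner (h (f x)) (\sum_k christoffel g k i j x *: cov h f 'e_k nu x) w =
  \sum_k christoffel g k i j x * inner (h (f x)) (cov h f 'e_k nu x) w.
Proof. by move=> Ux; rewrite inner_suml; apply: eq_bigr => k _; rewrite innerZl. Qed.

Lemma gauss_formula x i j : U x ->
  cov h f 'e_i (partial j f) x =
  christoffel_form g x 'e_i 'e_j *m jac f x + second_form x i j *: nu x.
Proof.
move=> Ux; apply/eqP; rewrite -subr_eq0; apply/eqP.
have sh := symh (UW Ux).
apply: (hypersurface_frame_eq0 Ux) => [l|].
  rewrite innerBl (innerDl _ (_ *m jac f x)) innerZl [inner _ (nu x) _](innerC _ _ sh) (nup l Ux) mulr0 addr0.
  rewrite (tangent_part i j l Ux) (innerC _ (partial l f x) sh) (inner_christoffel _ _ _ Ux).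
  apply/eqP; rewrite subr_eq0; apply/eqP; apply: eq_bigr => k _; congr (_ * _).
  rewrite (innerC _ _ sh) -[partial k f x]row_jac -[partial l f x]row_jac inner_row.
  by rewrite (gJ Ux).
rewrite innerBl (innerDl _ (_ *m jac f x)) innerZl (nu1 Ux) mulr1 second_formE (weingarten i j Ux).
rewrite (innerC _ (nu x) sh) (inner_christoffel _ _ _ Ux).
rewrite [X in - _ - (X + _)]big1 ?add0r ?subrr// => k _.
by rewrite (innerC _ _ sh) (nup k Ux) mulr0.
Qed.

(** By Gauss's formula the Christoffel term of the tension cancels the tangential part of the second
    derivatives, which leaves the trace of the second fundamental form times [nu]. *)
Lemma tension_hypersurface x : U x ->
  tension g h f x = \tr (shape_operator g h f nu x) *: nu x.
Proof.
move=> Ux; rewrite /tension.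
transitivity (\sum_i \sum_j (invmx (g x) i j * second_form x i j) *: nu x).
  apply: eq_bigr => i _; apply: eq_bigr => j _; rewrite -scalerA; congr (_ *: _).
  have -> : \sum_k christoffel g k i j x *: partial k f x =
      christoffel_form g x 'e_i 'e_j *m jac f x.
    by rewrite mulmx_sum_row; apply: eq_bigr => k _; rewrite row_jac christoffel_delta.
  by rewrite (gauss_formula i j Ux) addrC addKr.
under eq_bigr do rewrite -scaler_suml.
rewrite -scaler_suml; congr (_ *: _).
rewrite /shape_operator -/(second_form x) mxtrace_mulC.
apply: eq_bigr => i _; rewrite mxE; apply: eq_bigr => j _.
by rewrite -[in RHS](second_form_sym Ux) [in RHS]mxE.
Qed.

Let Sm x i : 'M[R]_(n, q) := \matrix_(j, a)
  (cov h f 'e_i (cov h f 'e_j nu) x - \sum_k christoffel g k i j x *: cov h f 'e_k nu x) 0 a.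

Let row_Sm x i j : row j (Sm x i) =
  cov h f 'e_i (cov h f 'e_j nu) x - \sum_k christoffel g k i j x *: cov h f 'e_k nu x.
Proof. by apply/rowP => a; rewrite 2!mxE. Qed.

Let Sm_normal x i j : U x -> inner (h (f x)) (row j (Sm x i)) (nu x) =
  - inner (h (f x)) (row i (Nm x)) (row j (Nm x)).
Proof.
move=> Ux; rewrite row_Sm !row_Nm innerBl (inner_christoffelN _ _ _ Ux).
rewrite [X in _ - X]big1 ?subr0; last by move=> k _; rewrite (N_nu k Ux) mulr0.
rewrite (innerC (cov h f 'e_i nu x) _ (symh (UW Ux))).
exact: (inner_along_const 'e_i Ux (cN j 0) (cnu 0) (fun y Uy => N_nu j Uy)).
Qed.

Let ck_second_form k : ck k U second_form.
Proof.
have c i j : ck k U (fun y => - inner (h (f y)) (cov h f 'e_i nu y) (partial j f y)).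
  have chf : ck k U (fun y => h (f y)).
    by have [oW /smooth_onP ch _ _] := hW; apply: (ck_comp_mx oU oW UW).
  have cm : ck k U (fun y => (-1 : R) *: (cov h f 'e_i nu y *m h (f y) *m (partial j f y)^T)).
    apply: ck_scale => //; first exact: ck_cst.
    by apply: ck_mulmx => //; [apply: ck_mulmx => //|apply: ck_tr].
  have /(ck_mxP _ _ oU)/(_ 0 0) := cm.
  by apply: ck_ext => // y Uy; rewrite mxE mulN1r.
apply/ck_mxP => // i j; apply: (ck_ext oU _ (c i j)) => y _.
exact: (esym (second_formE y i j)).
Qed.

Let codazzi_aux (a b s : R) : - (a + b) = - (a - s) + - s + - b.
Proof. by ring. Qed.

Let sub_aux (a b s : 'rV[R]_q) : a - s - (b - s) = a - b.
Proof. by rewrite opprB addrA subrK. Qed.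

(** After the product rule, Gauss's formula replaces the second derivatives of [f]; its normal term
    drops out because the derivatives of [nu] are tangent. *)
Let D_second_form x i : U x ->
  'D_('e_i) second_form x = - (Sm x i *m h (f x) *m (jac f x)^T)
    + Gm x i *m second_form x + second_form x *m (Gm x i)^T.
Proof.
move=> Ux; apply/matrixP => j l.
have d : derivable second_form x ('e_i : 'rV[R]_n).
  exact/diff_derivable/(ck_diff (ck_second_form 0) Ux).
apply: etrans (f_equal (fun M : 'M[R]_n => M j l) (derive_mx d)) _.
apply: etrans (mxE _ _ _ _) _.
have -> : 'D_('e_i) (fun y => second_form y j l) x =
    'D_('e_i) (fun y => - inner (h (f y)) (cov h f 'e_j nu y) (partial l f y)) x.
  by apply: (f_equal (fun F => 'D_('e_i) F x)); apply/funext => y; exact: second_formE.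
have -> : 'D_('e_i) (fun y => - inner (h (f y)) (cov h f 'e_j nu y) (partial l f y)) x =
    - (inner (h (f x)) (cov h f 'e_i (cov h f 'e_j nu) x) (partial l f x)
      + inner (h (f x)) (cov h f 'e_j nu x) (cov h f 'e_i (partial l f) x)).
  have Hd := is_derive_inner_along hW cf UW ('e_i : 'rV[R]_n) Ux (ck_diff (cN j 0) Ux) (ck_diff (cp l 0) Ux).
  by have [_ <-] := is_deriveN Hd.
have E1 : (Sm x i *m h (f x) *m (jac f x)^T) j l =
    inner (h (f x)) (cov h f 'e_i (cov h f 'e_j nu) x) (partial l f x)
    - \sum_k christoffel g k i j x * inner (h (f x)) (cov h f 'e_k nu x) (partial l f x).
  by rewrite -inner_row row_jac row_Sm innerBl (inner_christoffelN _ _ _ Ux).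
have E2 : (Gm x i *m second_form x) j l =
    - \sum_k christoffel g k i j x * inner (h (f x)) (cov h f 'e_k nu x) (partial l f x).
  rewrite mxE -sumrN; apply: eq_bigr => k _.
  by rewrite second_formE [Gm _ _ _ _]mxE mulrN.
have E3 : (second_form x *m (Gm x i)^T) j l =
    - inner (h (f x)) (cov h f 'e_j nu x) (cov h f 'e_i (partial l f) x).
  rewrite (gauss_formula i l Ux) innerDr innerZr (N_nu j Ux) mulr0 addr0.
  rewrite (inner_christoffel _ _ _ Ux) mxE -sumrN; apply: eq_bigr => k _.
  by rewrite second_formE [(Gm x i)^T _ _]mxE [Gm _ _ _ _]mxE mulNr mulrC.
have sum3 (X Y Z : 'M[R]_n) : (- X + Y + Z) j l = - X j l + Y j l + Z j l.
  by rewrite !mxE.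
apply: etrans _ (esym (sum3 _ _ _)).
apply: etrans _ (esym (f_equal2 +%R (f_equal2 +%R (f_equal -%R E1) E2) E3)).
exact: codazzi_aux.
Qed.

Let D_metric x i : U x -> 'D_('e_i) g x = Gm x i *m g x + g x *m (Gm x i)^T.
Proof.
move=> Ux; apply/matrixP => a b; rewrite -[LHS]inner_delta (metric_compat gU _ _ _ Ux).
rewrite -!row_Gm [RHS]mxE; apply: (f_equal2 +%R).
  by rewrite /inner trmx_delta -colE [LHS]mxE -row_mul mxE.
rewrite /inner -rowE -row_mul tr_row [LHS]mxE [LHS]mxE [RHS]mxE.
by apply: eq_bigr => k _; rewrite [col _ _ _ _]mxE.
Qed.

Let trace_const x c i : U x -> (forall y, U y -> \tr (shape_operator g h f nu y) = c) ->
  \tr ('D_('e_i) second_form x *m invmx (g x)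
    - second_form x *m (invmx (g x) *m (Gm x i *m g x + g x *m (Gm x i)^T) *m invmx (g x))) = 0.
Proof.
move=> Ux Hc'; rewrite -(D_metric i Ux).
have ci k : ck k U (fun y => invmx (g y)) by apply: ck_invmx => // y; exact: (metric_unit gU).
have dd (F : 'rV[R]_n -> 'M[R]_n) : ck 0 U F -> is_derive x ('e_i : 'rV[R]_n) F ('D_('e_i) F x).
  by move=> cF; apply/derivableP/diff_derivable/(ck_diff cF Ux).
have Hg := is_derive_mulmx (dd _ (cg 0)) (dd _ (ci 0)).
have Hb := is_derive_mulmx (dd _ (ck_second_form 0)) (dd _ (ci 0)).
have [_ eg] := Hg; have [_ eb] := Hb.
(* Differentiating g g^-1 = 1 gives the derivative of the inverse metric. *)
have eg0 : 'D_('e_i) (fun y => g y *m invmx (g y)) x = 0.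
  have H1 y : U y -> g y *m invmx (g y) = 1%:M.
    by move=> Uy; rewrite mulmxV// (metric_unit gU).
  exact: (derive_const_on _ oU Ux H1).
rewrite eg0 in eg.
have -> : second_form x *m (invmx (g x) *m 'D_('e_i) g x *m invmx (g x)) =
    - (second_form x *m 'D_('e_i) (fun y => invmx (g y)) x).
  move: eg; move: ('D_('e_i) g x) ('D_('e_i) (fun y => invmx (g y)) x) => A B.
  move=> /esym/eqP; rewrite addr_eq0 => /eqP e.
  by rewrite -mulmxA e mulmxN mulKmx ?mulmxN// (metric_unit gU).
rewrite opprK -eb.
have [dt et] := is_derive_trace Hb.
by rewrite eb -et; exact: (derive_const_on _ oU Ux Hc').
Qed.

Let Sm_commute x i j : U x -> row j (Sm x i) - row i (Sm x j) =
  curvature h (f x) (row i (jac f x)) (row j (jac f x)) (nu x).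
Proof.
move=> Ux; rewrite !row_Sm !row_jac.
have -> : \sum_k christoffel g k j i x *: cov h f 'e_k nu x =
    \sum_k christoffel g k i j x *: cov h f 'e_k nu x.
  by apply: eq_bigr => k _; rewrite (christoffelC _ _ _ Ux).
apply: etrans _ (cov_commute hW oU cf UW 'e_i 'e_j Ux cnu).
exact: sub_aux.
Qed.

Let gsum x (F : 'I_n -> 'I_n -> 'rV[R]_q) w :
  inner (h (f x)) (\sum_i \sum_j invmx (g x) i j *: F i j) w =
  \sum_i \sum_j invmx (g x) i j * inner (h (f x)) (F i j) w.
Proof.
rewrite inner_suml; apply: eq_bigr => i _; rewrite inner_suml.
by apply: eq_bigr => j _; rewrite innerZl.
Qed.

Let cov_scale Y Z c x u : U x -> ck 0 U Z -> (forall y, U y -> Y y = c *: Z y) ->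
  cov h f u Y x = c *: cov h f u Z x.
Proof.
move=> Ux cZ YZ; rewrite /cov (YZ x Ux) scalerDr; apply: (f_equal2 +%R).
  have -> : 'D_u Y x = 'D_u (fun y => c *: Z y) x.
    exact/near_eq_derive/(near_open oU Ux).
  by apply: deriveZ; apply/diff_derivable/(ck_diff cZ Ux).
by rewrite christoffel_formE biformZr.
Qed.

Let S0 x (F : 'I_n -> 'I_n -> 'rV[R]_q) (Rf : 'I_n -> 'I_n -> 'rV[R]_q) c w : U x ->
  (forall i j, F i j = c *: row j (Sm x i)) ->
  (forall i j, Rf i j = c *: curvature h (f x) (row i (jac f x)) (nu x) (row j (jac f x))) ->
  inner (h (f x)) (\sum_i \sum_j invmx (g x) i j *: F i j
    - \sum_i \sum_j invmx (g x) i j *: Rf i j) w =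
  c * (\sum_i \sum_j invmx (g x) i j * inner (h (f x)) (row j (Sm x i)) w
    - \sum_i \sum_j invmx (g x) i j * inner (h (f x))
        (curvature h (f x) (row i (jac f x)) (nu x) (row j (jac f x))) w).
Proof.
move=> Ux HF HR; rewrite innerBl !gsum mulrBr; congr (_ - _).
  rewrite mulr_sumr; apply: eq_bigr => i _; rewrite mulr_sumr; apply: eq_bigr => j _.
  by rewrite HF innerZl mulrCA.
rewrite mulr_sumr; apply: eq_bigr => i _; rewrite mulr_sumr; apply: eq_bigr => j _.
by rewrite HR innerZl mulrCA.
Qed.

(** The tension is [c] times [nu] on all of [U], not only at [x], so [c] comes out of both covariant
    derivatives and of the curvature term. *)
Let inner_bitension x c w : U x ->
  (forall y, U y -> \tr (shape_operator g h f nu y) = c) ->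
  inner (h (f x)) (bitension g h f x) w =
  c * (\sum_i \sum_j invmx (g x) i j * inner (h (f x)) (row j (Sm x i)) w
    - \sum_i \sum_j invmx (g x) i j * inner (h (f x))
        (curvature h (f x) (row i (jac f x)) (nu x) (row j (jac f x))) w).
Proof.
move=> Ux Htr.
have T y : U y -> tension g h f y = c *: nu y.
  by move=> Uy; rewrite tension_hypersurface// Htr.
have T1 j y : U y -> cov h f 'e_j (tension g h f) y = c *: cov h f 'e_j nu y.
  by move=> Uy; exact: (cov_scale 'e_j Uy (cnu 0) T).
have T2 i j : cov h f 'e_i (cov h f 'e_j (tension g h f)) x =
    c *: cov h f 'e_i (cov h f 'e_j nu) x.
  exact: (cov_scale 'e_i Ux (cN j 0) (T1 j)).
apply: S0 => // i j.
  rewrite row_Sm T2 scalerBr; congr (_ - _).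
  by rewrite scaler_sumr; apply: eq_bigr => k _; rewrite (T1 k x Ux) !scalerA mulrC.
by rewrite (T x Ux) !row_jac (curvatureZ2 hW)//; exact: UW.
Qed.

(** Skewness of the curvature exchanges the traced slot with [z] and produces minus the Ricci trace,
    short of its normal entry. *)
Let curvature_sum x w z : U x ->
  \sum_i \sum_j invmx (g x) i j * inner (h (f x))
    (curvature h (f x) (row i (jac f x)) w (row j (jac f x))) z =
  - (inner (ricci h (f x)) w z - inner (h (f x)) (curvature h (f x) (nu x) w z) (nu x)).
Proof.
move=> Ux; have Wx := UW Ux.
rewrite (inner_ricci hW _ _ Wx).
have RmE u v y : curvature h (f x) u v y = u *m ricci_mx h (f x) v y.
  exact: (curvature_mxE hW).
rewrite -(curvature_trace dim (symh Wx) (nu1 Ux) (fun i => frame i Ux) (unitg Ux) RmE).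
rewrite (gJ Ux) -sumrN; apply: eq_bigr => i _; rewrite -sumrN; apply: eq_bigr => j _.
rewrite (curvature_skew hW _ _ _ _ Wx) mulrN.
by rewrite (innerC _ (curvature _ _ _ _ _) (symh Wx)).
Qed.

(** The Laplacian contributes -tr A^2. The curvature term contributes Ric(nu, nu) after two sign
    changes, its normal correction being zero because R(nu, nu) = 0. *)
Lemma bitension_normal x c : U x ->
  (forall y, U y -> \tr (shape_operator g h f nu y) = c) ->
  inner (h (f x)) (bitension g h f x) (nu x) =
  c * (inner (ricci h (f x)) (nu x) (nu x)
       - \tr (shape_operator g h f nu x *m shape_operator g h f nu x)).
Proof.
move=> Ux Htr; have Wx := UW Ux.
rewrite (inner_bitension _ Ux Htr) (curvature_sum _ _ Ux).
have c0 w : curvature h (f x) (nu x) (nu x) w = 0 by rewrite /curvature subrr.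
rewrite c0 inner0l subr0 opprK addrC; congr (_ * (_ + _)).
rewrite -{1}(gJ Ux) (laplacian_normal dim (symh Wx) (nu1 Ux) (fun i => frame i Ux) (unitg Ux) (N := Nm x)).
- by rewrite -second_form_mx (gJ Ux).
- by move=> i; rewrite row_Nm; exact: N_nu.
- by rewrite -second_form_mx; exact: second_form_sym.
- by move=> i j; exact: Sm_normal.
Qed.

(** The first Ricci term comes from the Laplacian through Codazzi, the second from the curvature
    term of the bitension. *)
Lemma bitension_tangent x c l : U x ->
  (forall y, U y -> \tr (shape_operator g h f nu y) = c) ->
  inner (h (f x)) (bitension g h f x) (partial l f x) =
  c * (inner (ricci h (f x)) (partial l f x) (nu x)
       + inner (ricci h (f x)) (nu x) (partial l f x)).
Proof.
move=> Ux Htr; have Wx := UW Ux.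
rewrite (inner_bitension _ Ux Htr) (curvature_sum _ _ Ux).
have c0 w : curvature h (f x) (nu x) (nu x) w = 0 by rewrite /curvature subrr.
rewrite c0 inner0l subr0 opprK; congr (_ * (_ + _)).
rewrite -(row_jac f x l) (inner_ricci hW _ _ Wx).
rewrite -{1}(gJ Ux).
apply: (laplacian_tangent dim (symh Wx) (nu1 Ux) (fun i => frame i Ux) (unitg Ux)
  (N := Nm x) (S := Sm x) (C := Gm x) (B' := fun i => 'D_('e_i) second_form x)
  (Rm := curvature h (f x))).
- by rewrite -second_form_mx; exact: second_form_sym.
- by move=> i; rewrite -second_form_mx; exact: D_second_form.
- move=> i; have d : derivable second_form x ('e_i : 'rV[R]_n).
    exact/diff_derivable/(ck_diff (ck_second_form 0) Ux).
  have [_ <-] := is_derive_tr (derivableP d).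
  apply: near_eq_derive; apply: (near_open oU Ux) => y; exact: second_form_sym.
- by move=> i; rewrite -second_form_mx (gJ Ux); exact: (trace_const i Ux Htr).
- by move=> i j; exact: Sm_commute.
- by move=> u v w; exact: (curvature_mxE hW).
- by move=> u v w z; exact: (curvature_skew hW).
Qed.

End Hypersurface.

(** * Hypersurfaces of a product with a line *)

Section BlockCalculus.
Context {R : realType}.

Lemma is_derive_lsubmx (V : normedModType R) a b (F : V -> 'rV[R]_(a + b)) x v dF :
  is_derive x v F dF -> is_derive x v (fun y => lsubmx (F y)) (lsubmx dF).
Proof.
move=> /is_derive_mxP H; apply/is_derive_mxP => i j.
by under eq_fun do rewrite mxE; rewrite mxE.
Qed.

Lemma is_derive_rsubmx (V : normedModType R) a b (F : V -> 'rV[R]_(a + b)) x v dF :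
  is_derive x v F dF -> is_derive x v (fun y => rsubmx (F y)) (rsubmx dF).
Proof.
move=> /is_derive_mxP H; apply/is_derive_mxP => i j.
by under eq_fun do rewrite mxE; rewrite mxE.
Qed.

Lemma derive_lsubmx (V : normedModType R) a b (F : V -> 'rV[R]_(a + b)) x v :
  derivable F x v -> 'D_v (fun y => lsubmx (F y)) x = lsubmx ('D_v F x).
Proof. by move=> d; have [_ ->] := is_derive_lsubmx (derivableP d). Qed.

Lemma derive_rsubmx (V : normedModType R) a b (F : V -> 'rV[R]_(a + b)) x v :
  derivable F x v -> 'D_v (fun y => rsubmx (F y)) x = rsubmx ('D_v F x).
Proof. by move=> d; have [_ ->] := is_derive_rsubmx (derivableP d). Qed.

Lemma ck_lsubmx n a b k (U : set 'rV[R]_n) (F : 'rV[R]_n -> 'rV[R]_(a + b)) :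
  open U -> ck k U F -> ck k U (fun y => lsubmx (F y)).
Proof.
move=> oU /(ck_mxP _ _ oU) cF; apply/ck_mxP => // i j.
by under eq_fun do rewrite mxE.
Qed.

Lemma ck_rsubmx n a b k (U : set 'rV[R]_n) (F : 'rV[R]_n -> 'rV[R]_(a + b)) :
  open U -> ck k U F -> ck k U (fun y => rsubmx (F y)).
Proof.
move=> oU /(ck_mxP _ _ oU) cF; apply/ck_mxP => // i j.
by under eq_fun do rewrite mxE.
Qed.

Lemma ck_row_mx n a b k (U : set 'rV[R]_n) (F : 'rV[R]_n -> 'rV[R]_a) (G : 'rV[R]_n -> 'rV[R]_b) :
  open U -> ck k U F -> ck k U G -> ck k U (fun y => row_mx (F y) (G y)).
Proof.
move=> oU /(ck_mxP _ _ oU) cF /(ck_mxP _ _ oU) cG; apply/ck_mxP => // i j.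
under eq_fun do rewrite mxE.
by case: (fintype.split j) => l.
Qed.

Lemma inner_block a b (A : 'M[R]_a) (B : 'M[R]_b) u v :
  inner (block_mx A 0 0 B) u v =
  inner A (lsubmx u) (lsubmx v) + inner B (rsubmx u) (rsubmx v).
Proof.
rewrite -{1}[u]hsubmxK -{1}[v]hsubmxK /inner mul_row_block tr_row_mx !mulmx0 addr0 add0r.
by rewrite mul_row_col mxE.
Qed.

End BlockCalculus.

Section ProductWithLine.
Context {R : realType} {m : nat}.
Variables (W : set 'rV[R]_m) (h : 'rV[R]_m -> 'M[R]_m) (hW : metric_on W h).

(** Convertible to the metric of [times_line L] in a product chart when [h] is the metric of [L] in
    the base chart. *)
Definition line_metric (y : 'rV[R]_(m + 1)) : 'M[R]_(m + 1) :=
  block_mx (h (lsubmx y)) 0 0 1%:M.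

Definition line_domain : set 'rV[R]_(m + 1) := [set y | W (lsubmx y)].

Let oW : open W. Proof. by case: hW. Qed.

Lemma open_line_domain : open line_domain.
Proof.
move=> y Wy; apply: (@continuous_lsubmx _ 1 m 1 y); exact: open_nbhs_nbhs.
Qed.

Lemma metric_on_line : metric_on line_domain line_metric.
Proof.
have [_ /smooth_onP sh symh posh] := hW; have oW' := open_line_domain.
split=> //.
- apply/smooth_onP => k; apply/ck_mxP => // i j.
  have cl : ck k line_domain (fun y => h (lsubmx y)).
    apply: (ck_comp_mx oW' oW _ (sh k)) => //.
    by apply: (ck_lsubmx oW' (ck_id k oW')).
  rewrite /line_metric; under eq_fun do rewrite mxE.
  case: (fintype.split i) => a; under eq_fun do rewrite mxE; case: (fintype.split j) => b.
  + by move/(ck_mxP _ _ oW') : cl; apply.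
  + exact: ck_cst.
  + exact: ck_cst.
  + exact: ck_cst.
- by move=> y Wy; rewrite /line_metric tr_block_mx !trmx0 trmx1 symh.
- move=> y u Wy u0; rewrite inner_block.
  have sq : inner 1%:M (rsubmx u) (rsubmx u) = (rsubmx u 0 0) ^+ 2.
    by rewrite /inner mulmx1 mxE big_ord1 [X in _ * X]mxE.
  have [l0|l0] := eqVneq (lsubmx u) 0.
    have r0 : rsubmx u 0 0 != 0.
      apply: contra_neq u0 => r0; rewrite -[u]hsubmxK l0.
      suff -> : rsubmx u = 0 by rewrite row_mx0.
      by apply/matrixP => i j; rewrite !ord1 r0 mxE.
    by rewrite l0 inner0l add0r sq exprn_even_gt0.
  by rewrite ltr_wpDr ?posh// sq sqr_ge0.
Qed.

Let derive_line_metric y u : line_domain y ->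
  'D_u line_metric y = block_mx ('D_(lsubmx u) h (lsubmx y)) 0 0 0.
Proof.
move=> Wy; have [_ /smooth_onP sh _ _] := hW.
have dl : differentiable (lsubmx : 'rV[R]_(m + 1) -> 'rV[R]_m) y by apply: differentiable_lsubmx.
have H := is_derive_comp u dl (ck_diff (sh 0) Wy).
have e : 'D_u (lsubmx : 'rV[R]_(m + 1) -> 'rV[R]_m) y = lsubmx u.
  by have [_ ->] := is_derive_lsubmx (is_derive_id y u).
rewrite e in H; move: H => /is_derive_mxP H.
suff : is_derive y u line_metric (block_mx ('D_(lsubmx u) h (lsubmx y)) 0 0 0) by case.
apply/is_derive_mxP => i j; rewrite /line_metric; under eq_fun do rewrite mxE.
rewrite mxE; case: (fintype.split i) => a; under eq_fun do rewrite mxE; rewrite mxE;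
  case: (fintype.split j) => b.
- exact: H.
- by rewrite !mxE; exact: is_derive_cst.
- by rewrite !mxE; exact: is_derive_cst.
- by rewrite !mxE; exact: is_derive_cst.
Qed.

Let inner_derive_line y u v w : line_domain y -> inner ('D_u line_metric y) v w =
  inner ('D_(lsubmx u) h (lsubmx y)) (lsubmx v) (lsubmx w).
Proof.
move=> Wy; rewrite derive_line_metric// inner_block.
by rewrite [X in _ + X](_ : _ = 0) ?addr0// /inner mulmx0 mul0mx mxE.
Qed.

Let koszul_cong (x y z x' y' z' : R) : x = x' -> y = y' -> z = z' ->
  2^-1 * (x + y - z) = 2^-1 * (x' + y' - z').
Proof. by move=> -> -> ->. Qed.

(** Derivatives of the product metric see only horizontal parts, so its Koszul formula reduces to
    the one for [h]. *)
Lemma christoffel_form_line y u v : line_domain y ->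
  christoffel_form line_metric y u v =
  row_mx (christoffel_form h (lsubmx y) (lsubmx u) (lsubmx v)) 0.
Proof.
move=> Wy; apply: (inner_inj (metric_unit metric_on_line Wy)) => w.
apply: etrans (koszul metric_on_line u v w Wy) _.
apply: etrans (koszul_cong (inner_derive_line _ _ _ Wy) (inner_derive_line _ _ _ Wy)
  (inner_derive_line _ _ _ Wy)) _.
apply: etrans (esym (koszul hW _ _ _ Wy)) _.
by rewrite /line_metric inner_block row_mxKl row_mxKr inner0l addr0.
Qed.

Lemma cov_line n (f Y : 'rV[R]_n -> 'rV[R]_(m + 1)) u x :
  line_domain (f x) -> differentiable f x -> differentiable Y x ->
  cov line_metric f u Y x =
  row_mx (cov h (fun y => lsubmx (f y)) u (fun y => lsubmx (Y y)) x)
         ('D_u (fun y => rsubmx (Y y)) x).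
Proof.
move=> Wx df dY.
apply: etrans (f_equal (+%R ('D_u Y x)) (christoffel_form_line _ _ Wx)) _.
have split_sum (D : 'rV[R]_(m + 1)) G : D + row_mx G 0 = row_mx (lsubmx D + G) (rsubmx D).
  by rewrite -{1}[D]hsubmxK add_row_mx addr0.
apply: etrans (split_sum _ _) _.
have e1 := derive_lsubmx (diff_derivable (v := u) df).
have e2 := derive_lsubmx (diff_derivable (v := u) dY).
have e3 := derive_rsubmx (diff_derivable (v := u) dY).
apply: (f_equal2 (fun A B => row_mx A B)) (esym e3).
by apply: (f_equal2 +%R) (esym e2) (f_equal (fun z => christoffel_form h _ z _) (esym e1)).
Qed.

Lemma curvature_line y u v w : line_domain y ->
  curvature line_metric y u v w =
  row_mx (curvature h (lsubmx y) (lsubmx u) (lsubmx v) (lsubmx w)) 0.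
Proof.
move=> Wy; have oW' := open_line_domain.
have ds z : differentiable (lsubmx : 'rV[R]_(m + 1) -> 'rV[R]_m) z by apply: differentiable_lsubmx.
have dsE z t : 'D_t (lsubmx : 'rV[R]_(m + 1) -> 'rV[R]_m) z = lsubmx t.
  by have [_ ->] := is_derive_lsubmx (is_derive_id z t).
have key a b : cov line_metric id a (cov line_metric id b (cst w)) y =
    row_mx (cov h id (lsubmx a) (cov h id (lsubmx b) (cst (lsubmx w))) (lsubmx y)) 0.
  pose G z := christoffel_form h z (lsubmx b) (lsubmx w).
  have dG : differentiable G (lsubmx y).
    have idW k : ck k W (@id 'rV[R]_m) by exact: ck_id.
    have := ck_cov hW oW idW (fun x W => W) (lsubmx b) (Y := cst (lsubmx w)) 0
       (fun k => ck_cst k W (lsubmx w)).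
    by rewrite cov_id_cst => /ck_diff; apply.
  have E z : line_domain z -> cov line_metric id b (cst w) z = row_mx (G (lsubmx z)) 0.
    by move=> Wz; rewrite cov_id_cst christoffel_form_line.
  have El z : line_domain z -> lsubmx (cov line_metric id b (cst w) z) = G (lsubmx z).
    by move=> Wz; rewrite E// row_mxKl.
  have Er z : line_domain z -> rsubmx (cov line_metric id b (cst w) z) = 0.
    by move=> Wz; rewrite E// row_mxKr.
  have dF : differentiable (cov line_metric id b (cst w)) y.
    have idW k : ck k line_domain (@id 'rV[R]_(m + 1)) by exact: ck_id.
    have := ck_cov metric_on_line oW' idW (fun x W => W) b (Y := cst w) 0
       (fun k => ck_cst k line_domain w).
    by move=> /ck_diff; apply.
  have did : differentiable (@id 'rV[R]_(m + 1)) y by case: (is_diff_id y).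
  apply: etrans (cov_line (f := id) a Wy did dF) _.
  apply: (f_equal2 (fun A B => row_mx A B)); last exact: derive_const_on oW' Wy Er.
  have eG : cov h id (lsubmx b) (cst (lsubmx w)) = G by exact: cov_id_cst.
  apply: etrans _ (f_equal (fun F' => cov h id (lsubmx a) F' (lsubmx y)) (esym eG)).
  apply: (f_equal2 +%R).
    have -> : 'D_a (fun z => lsubmx (cov line_metric id b (cst w) z)) y =
        'D_a (fun z => G (lsubmx z)) y.
      by apply: near_eq_derive; exact: (near_open oW' Wy).
    by rewrite (derive_comp _ (ds y) dG) dsE.
  apply: (f_equal2 (christoffel_form h (lsubmx y))); last exact: El.
  by rewrite derive_id; exact: dsE.
apply: etrans (f_equal2 (fun A B => A - B) (key u v) (key v u)) _.
by rewrite opp_row_mx add_row_mx oppr0 addr0.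
Qed.

(** The last basis vector adds nothing to the trace, because the curvature of the product has no
    vertical component. *)
Lemma inner_ricci_line y u v : line_domain y ->
  inner (ricci line_metric y) u v = inner (ricci h (lsubmx y)) (lsubmx u) (lsubmx v).
Proof.
move=> Wy; rewrite (inner_ricci metric_on_line)// (inner_ricci hW)//.
have E k l : ricci_mx line_metric y u v k l = curvature line_metric y 'e_k u v 0 l.
  by rewrite (curvature_mxE metric_on_line)// -rowE [RHS]mxE.
have E' k l : ricci_mx h (lsubmx y) (lsubmx u) (lsubmx v) k l =
    curvature h (lsubmx y) 'e_k (lsubmx u) (lsubmx v) 0 l.
  by rewrite (curvature_mxE hW)// -rowE [RHS]mxE.
rewrite /mxtrace big_split_ord/= [X in _ + X]big1 ?addr0; last first.
  by move=> k _; rewrite E curvature_line// row_mxEr mxE.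
apply: eq_bigr => k _; rewrite E E' curvature_line// row_mxEl.
apply: (f_equal (fun z => curvature h (lsubmx y) z (lsubmx u) (lsubmx v) 0 k)).
by apply/rowP => j; rewrite !mxE eq_lshift.
Qed.

End ProductWithLine.

(** * Traces of self-adjoint operators in a basis that need not be orthonormal *)

Section TraceAlgebra.
Context {R : realType}.

(** Cholesky reduction by induction on the size: [S] is the Schur complement of the corner entry,
    and it is positive because its value at [v] is the value of [g] at the completed vector [w]. *)
Lemma posdef_congruence n (g : 'M[R]_n) : g^T = g -> (forall u, u != 0 -> 0 < inner g u u) ->
  exists C : 'M[R]_n, C *m g *m C^T = 1%:M.
Proof.
elim: n g => [|n IH] g symg posg.
  by exists 0; apply/matrixP => -[].
move: g symg posg; rewrite -[n.+1]/(1 + n)%N => g symg posg.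
pose a := ulsubmx g 0 0; pose b := ursubmx g; pose d := drsubmx g.
have ga : ulsubmx g = a%:M by rewrite [LHS]mx11_scalar.
have gb : dlsubmx g = b^T by rewrite /b trmx_ursub symg.
have gE : g = block_mx a%:M b b^T d by rewrite -[LHS]submxK ga gb.
have symd : d^T = d by rewrite /d trmx_drsub symg.
have a0 : 0 < a.
  have := posg (row_mx 1%:M 0); rewrite gE /inner mul_row_block !mul0mx !mul1mx !addr0.
  rewrite tr_row_mx mul_row_col trmx0 mulmx0 addr0 trmx1 mulmx1 mxE eqxx mulr1n; apply.
  by apply/eqP => /matrixP/(_ 0 (lshift n 0))/eqP; rewrite row_mxEl !mxE oner_eq0.
have an0 : a != 0 by rewrite gt_eqF.
pose S := d - a^-1 *: (b^T *m b).
have symS : S^T = S by rewrite /S linearB linearZ/= trmx_mul trmxK symd.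
have posS v : v != 0 -> 0 < inner S v v.
  move=> v0; pose w := row_mx (- (a^-1 *: (v *m b^T))) v.
  have := posg w; rewrite gE /inner mul_row_block tr_row_mx mul_row_col.
  rewrite mul_mx_scalar scalerN scalerA mulfV// scale1r addNr mul0mx add0r.
  have -> : - (a^-1 *: (v *m b^T)) *m b + v *m d = v *m S.
    by rewrite /S mulmxBr mulNmx -scalemxAl -scalemxAr mulmxA addrC.
  apply; apply: contra_neq v0 => w0.
  by have := congr1 rsubmx w0; rewrite row_mxKr => ->; apply/rowP => j; rewrite !mxE.
have [C CS] := IH S symS posS.
pose r := (Num.sqrt a)^-1.
have sa0 : Num.sqrt a != 0 by rewrite gt_eqF// sqrtr_gt0.
have rra : r * r * a = 1.
  by rewrite /r -{3}(sqr_sqrtr (ltW a0)) expr2 -invfM mulVf// mulf_neq0.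
exists (block_mx r%:M 0 (- (a^-1 *: (C *m b^T))) C).
rewrite gE mulmx_block tr_block_mx mulmx_block.
rewrite !mul0mx !addr0 tr_scalar_mx trmx0 !mulmx0 !addr0.
have -> : - (a^-1 *: (C *m b^T)) *m a%:M + C *m b^T = 0.
  by rewrite mul_mx_scalar scalerN scalerA mulfV// scale1r addNr.
have -> : - (a^-1 *: (C *m b^T)) *m b + C *m d = C *m S.
  by rewrite /S mulmxBr mulNmx -scalemxAl -scalemxAr mulmxA addrC.
rewrite !mul0mx !add0r CS -!scalar_mxM -mulrA [a * r]mulrC mulrA rra.
have -> : (r * a)%:M *m (- (a^-1 *: (C *m b^T)))^T + r%:M *m b *m C^T = 0.
  rewrite linearN linearZ /= trmx_mul trmxK mulmxN !mul_scalar_mx -scalemxAl scalerA.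
  by rewrite mulfK// addNr.
by rewrite scalar_mx_block.
Qed.

(** In a [g]-orthonormal basis the operator becomes the symmetric matrix [X], and the trace of its
    square is the sum of the squares of the entries. Were that zero, [X] and hence the trace would
    vanish. *)
Lemma trace_square_ge0 n (g B : 'M[R]_n) :
  g^T = g -> (forall u, u != 0 -> 0 < inner g u u) -> B^T = B ->
  \tr (B *m invmx g) != 0 -> 0 < \tr (B *m invmx g *m (B *m invmx g)).
Proof.
move=> symg posg symB trB; have [C CgC] := posdef_congruence symg posg.
have ug := posdef_unit posg.
have ig : invmx g = C^T *m C.
  have /mulmx1C e : C *m (g *m C^T) = 1%:M by rewrite mulmxA.
  by rewrite -[LHS]mulmx1 -e !mulmxA mulVmx// mul1mx.
pose X := C *m B *m C^T.
have symX : X^T = X by rewrite /X !trmx_mul trmxK symB mulmxA.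
have -> : \tr (B *m invmx g *m (B *m invmx g)) = \sum_i \sum_j X i j ^+ 2.
  have -> : \tr (B *m invmx g *m (B *m invmx g)) = \tr (X *m X).
    transitivity (\tr ((B *m C^T *m C *m B *m C^T) *m C)); first by rewrite ig !mulmxA.
    by rewrite mxtrace_mulC /X !mulmxA.
  apply: eq_bigr => i _; rewrite mxE; apply: eq_bigr => j _.
  have e : X j i = X i j by rewrite -{1}symX [LHS]mxE.
  by rewrite e expr2.
have S0 i : 0 <= \sum_j X i j ^+ 2 by apply: sumr_ge0 => j _; exact: sqr_ge0.
rewrite lt_neqAle sumr_ge0 ?andbT//; apply: contra_neq trB => /esym e.
have X0 : X = 0.
  apply/matrixP => i j; rewrite [RHS]mxE.
  have ei : \sum_j X i j ^+ 2 = 0 by exact: (psumr_eq0P (fun i _ => S0 i) e).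
  have /eqP : X i j ^+ 2 = 0 by exact: (psumr_eq0P (fun j _ => sqr_ge0 (X i j)) ei).
  by rewrite sqrf_eq0 => /eqP.
have -> : \tr (B *m invmx g) = \tr X.
  by rewrite ig /X -[C *m B *m C^T]mulmxA [RHS]mxtrace_mulC mulmxA.
by rewrite X0 mxtrace0.
Qed.

(** [frame_complete] is used with [T] as the normal of the frame [J]. It gives g^-1 = J^T (J g
    J^T)^-1 J + T^T T, and [B] kills the last term, so the discarded direction adds nothing to
    either trace. *)
Lemma trace_slice k n (g B : 'M[R]_n) (J : 'M[R]_(k, n)) (T : 'rV[R]_n) :
  n = (k + 1)%N -> g^T = g -> g \in unitmx -> inner g T T = 1 ->
  (forall a, inner g (row a J) T = 0) -> J *m g *m J^T \in unitmx -> B *m T^T = 0 ->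
  let A := B *m invmx g in
  let A' := J *m B *m J^T *m invmx (J *m g *m J^T) in
  \tr A = \tr A' /\ \tr (A *m A) = \tr (A' *m A').
Proof.
move=> dim symg ug TT JT uN BT A A'.
set K := J^T *m invmx (J *m g *m J^T) *m J.
have AE : A = B *m K.
  have := frame_complete dim symg TT JT uN.
  move=> /(congr1 (fun M => invmx g *m M)); rewrite mulmx1 mulmxDr !mulmxA mulVmx// !mul1mx => e.
  by rewrite /A -e mulmxDr !mulmxA BT mul0mx addr0.
rewrite AE /A' /K; split.
  by rewrite !mulmxA [LHS]mxtrace_mulC !mulmxA.
by rewrite !mulmxA [LHS]mxtrace_mulC !mulmxA.
Qed.

End TraceAlgebra.

Section PullbackMetric.
Context {R : realType}.

Lemma pullback_metric_jac n q (h : 'rV[R]_q -> 'M[R]_q) (f : 'rV[R]_n -> 'rV[R]_q) x :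
  pullback_metric h f x = jac f x *m h (f x) *m (jac f x)^T.
Proof.
apply/matrixP => i j; rewrite -inner_row !row_jac; exact: mxE.
Qed.

Lemma inner_pullback n q (h : 'rV[R]_q -> 'M[R]_q) (f : 'rV[R]_n -> 'rV[R]_q) x u v :
  inner (pullback_metric h f x) u v = inner (h (f x)) (u *m jac f x) (v *m jac f x).
Proof. by rewrite pullback_metric_jac /inner trmx_mul !mulmxA. Qed.

End PullbackMetric.

Section VerticalCylinder.
Context {R : realType} {m : nat}.
Variables (W : set 'rV[R]_m) (h : 'rV[R]_m -> 'M[R]_m) (hW : metric_on W h).
Variable mu : R.
Hypothesis einstein_h : forall z, W z -> ricci h z = mu *: h z.
Variables (U : set 'rV[R]_m) (f : 'rV[R]_m -> 'rV[R]_(m + 1)) (g : 'rV[R]_m -> 'M[R]_m).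
Hypotheses (gU : metric_on U g)
  (gE : forall x, U x -> g x = pullback_metric (line_metric h) f x).
Hypotheses (sf : smooth_on U f) (UW : forall x, U x -> line_domain W (f x)).
Variables (nu : 'rV[R]_m -> 'rV[R]_(m + 1)) (c lambda : R).
Hypotheses (nuU : unit_normal_on (line_metric h) f U nu) (lambda0 : 0 <= lambda) (c0 : c != 0).
Hypothesis trA : forall x, U x -> \tr (shape_operator g (line_metric h) f nu x) = c.
Hypothesis biharm : forall x, U x ->
  bitension g (line_metric h) f x - lambda *: tension g (line_metric h) f x = 0.

Let hQ := metric_on_line hW.
Let dim : (m + 1)%N = (m + 1)%N := erefl.

Let inner_ricci_nu x u : U x ->
  inner (ricci (line_metric h) (f x)) u (nu x) =
  mu * inner (h (lsubmx (f x))) (lsubmx u) (lsubmx (nu x)).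
Proof.
move=> Ux; rewrite (inner_ricci_line hW _ _ (UW Ux)) (einstein_h (UW Ux)).
by rewrite /inner -scalemxAr -scalemxAl mxE.
Qed.

Let inner_nu_ricci x u : U x ->
  inner (ricci (line_metric h) (f x)) (nu x) u =
  mu * inner (h (lsubmx (f x))) (lsubmx u) (lsubmx (nu x)).
Proof.
move=> Ux; rewrite (inner_ricci_line hW _ _ (UW Ux)) (einstein_h (UW Ux)).
have [_ _ sh _] := hW; rewrite [X in mu * X](innerC _ _ (sh _ (UW Ux))).
by rewrite /inner -scalemxAr -scalemxAl mxE.
Qed.

Lemma inner1 (u v : 'rV[R]_1) : inner 1%:M u v = u 0 0 * v 0 0.
Proof. by rewrite /inner mulmx1 mxE big_ord1 [X in _ * X]mxE. Qed.

Definition dt : 'rV[R]_(m + 1) := row_mx 0 1%:M.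

Lemma inner_dt y u : inner (line_metric h y) dt u = rsubmx u 0 0.
Proof.
rewrite /line_metric inner_block row_mxKl row_mxKr inner0l add0r inner1.
by rewrite mxE eqxx mul1r.
Qed.

Lemma vertical_normal x : U x -> rsubmx (nu x) = 0 /\
  \tr (shape_operator g (line_metric h) f nu x *m shape_operator g (line_metric h) f nu x)
    = mu - lambda.
Proof.
move=> Ux; have [_ nn np] := nuU.
set A := shape_operator g (line_metric h) f nu x; set t := rsubmx (nu x) 0 0.
pose N := inner (h (lsubmx (f x))) (lsubmx (nu x)) (lsubmx (nu x)).
have Nt : N + t * t = 1.
  by rewrite -(nn x Ux) /line_metric inner_block inner1.
have tensionE : tension g (line_metric h) f x = c *: nu x.
  by rewrite (tension_hypersurface hQ gU gE sf UW dim nuU)// trA.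
have bE : bitension g (line_metric h) f x = lambda *: (c *: nu x).
  by apply/eqP; rewrite -tensionE -subr_eq0; apply/eqP; exact: biharm.
have normal_eq : mu * N - \tr (A *m A) = lambda.
  have := bitension_normal hQ gU gE sf UW dim nuU Ux trA.
  rewrite (inner_ricci_nu _ Ux) bE !innerZl nn// mulr1 -/N -/A => e.
  by apply: (mulfI c0); rewrite -e mulrC.
have trA2 : 0 < \tr (A *m A).
  have [_ _ symg posg] := gU.
  apply: trace_square_ge0; [exact: symg|by move=> u; exact: posg| |].
    exact: (second_form_sym hQ gU sf UW nuU).
  by rewrite -/(shape_operator g (line_metric h) f nu x) trA.
(* The sign of lambda enters here; positivity makes both [mu] and the horizontal part of [nu]
   nonzero. *)
have muN : 0 < mu * N.
  by rewrite -(subrK (\tr (A *m A)) (mu * N)) normal_eq ltr_wpDl.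
have mu0 : mu != 0 by apply: contraTneq muN => ->; rewrite mul0r ltxx.
(* The tangential equation makes the horizontal parts of [nu] and of a tangent vector orthogonal.
   The whole vectors are orthogonal too, so the product of the vertical parts vanishes. *)
have tang l : t * rsubmx (partial l f x) 0 0 = 0.
  have := bitension_tangent hQ gU gE sf UW dim nuU l Ux trA.
  rewrite (inner_ricci_nu _ Ux) (inner_nu_ricci _ Ux) bE !innerZl.
  have sQ : (line_metric h (f x))^T = line_metric h (f x) by case: hQ => _ _ + _; apply; exact: UW.
  rewrite (innerC _ _ sQ) np// !mulr0 => /esym/eqP.
  rewrite -mulr2n mulf_eq0 (negbTE c0)/= mulrn_eq0/= mulf_eq0 (negbTE mu0)/= => /eqP e.
  have := np x l Ux; rewrite /line_metric inner_block e add0r inner1 => <-.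
  exact: mulrC.
have t0 : t = 0.
  apply/eqP/negPn/negP => t0.
  have w0 : dt - t *: nu x = 0.
    apply: (hypersurface_frame_eq0 hQ gU gE UW dim nuU Ux) => [l|].
      have sQ : (line_metric h (f x))^T = line_metric h (f x) by case: hQ => _ _ + _; apply; exact: UW.
      rewrite innerBl innerZl inner_dt (innerC _ _ sQ) np// mulr0 subr0.
      by apply: (mulfI t0); rewrite tang mulr0.
    by rewrite innerBl innerZl inner_dt nn// mulr1 subrr.
  have : inner (line_metric h (f x)) dt dt = t * t.
    rewrite -{2}(subrK (t *: nu x) dt) w0 add0r inner_dt.
    by rewrite [rsubmx _]linearZ/= mxE.
  rewrite inner_dt row_mxKr mxE eqxx mulr1n => tt.
  move: Nt; rewrite -tt -[RHS]add0r => /addIr N0.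
  by move: muN; rewrite N0 mulr0 ltxx.
split; first by apply/matrixP => i j; rewrite !ord1 -/t t0 mxE.
move: Nt normal_eq; rewrite t0 mul0r addr0 => ->; rewrite mulr1 => <-.
by rewrite opprB addrC subrK.
Qed.

(** [dt] has no normal component, so its decomposition in the frame is purely tangential. *)
Lemma vertical_direction x : U x -> rsubmx (nu x) = 0 ->
  exists T : 'rV[R]_m, T *m jac f x = dt.
Proof.
move=> Ux r0; have [_ nn np] := nuU.
have sQ : (line_metric h (f x))^T = line_metric h (f x) by case: hQ => _ _ + _; apply; exact: UW.
have ug : jac f x *m line_metric h (f x) *m (jac f x)^T \in unitmx.
  by rewrite -pullback_metric_jac -gE//; exact: (metric_unit gU).
have fr i : inner (line_metric h (f x)) (row i (jac f x)) (nu x) = 0 by rewrite row_jac np.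
have := frame_decomp dim sQ (nn x Ux) fr ug dt.
rewrite inner_dt r0 mxE scale0r addr0; set T := (X in X *m _) => TE.
by exists T.
Qed.

End VerticalCylinder.

Section CovariantChainRule.
Context {R : realType}.

Lemma cov_comp k n q (h : 'rV[R]_q -> 'M[R]_q) (f Y : 'rV[R]_n -> 'rV[R]_q)
    (G : 'rV[R]_k -> 'rV[R]_n) u z :
  differentiable G z -> differentiable f (G z) -> differentiable Y (G z) ->
  cov h (fun z => f (G z)) u (fun z => Y (G z)) z = cov h f ('D_u G z) Y (G z).
Proof.
move=> dG df dY; apply: (f_equal2 +%R); first exact: derive_comp.
exact: (f_equal (fun w => christoffel_form h (f (G z)) w (Y (G z))) (derive_comp u dG df)).
Qed.

Lemma cov_expand n q (h : 'rV[R]_q -> 'M[R]_q) (f Y : 'rV[R]_n -> 'rV[R]_q) u x :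
  differentiable f x -> differentiable Y x ->
  cov h f u Y x = \sum_i u 0 i *: cov h f 'e_i Y x.
Proof.
move=> df dY; apply: (row_linear_expand (F := fun v => cov h f v Y x)) => [v w|a v].
  apply: etrans (f_equal2 (fun A B => A + christoffel_form h (f x) B (Y x))
    (deriveD_dir v w dY) (deriveD_dir v w df)) _.
  by rewrite christoffel_formE biformDl addrACA.
apply: etrans (f_equal2 (fun A B => A + christoffel_form h (f x) B (Y x))
  (deriveZ_dir a v dY) (deriveZ_dir a v df)) _.
by rewrite christoffel_formE biformZl scalerDr.
Qed.

End CovariantChainRule.

(** * Slices of constant height *)

Section Slice.
Context {R : realType} {k m : nat}.
Variables (W : set 'rV[R]_m) (h : 'rV[R]_m -> 'M[R]_m) (hW : metric_on W h).
Variable mu : R.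
Hypothesis einstein_h : forall z, W z -> ricci h z = mu *: h z.
Variables (U : set 'rV[R]_m) (f : 'rV[R]_m -> 'rV[R]_(m + 1)) (g : 'rV[R]_m -> 'M[R]_m).
Hypotheses (gU : metric_on U g)
  (gE : forall x, U x -> g x = pullback_metric (line_metric h) f x).
Hypotheses (sf : smooth_on U f) (UW : forall x, U x -> line_domain W (f x)).
Variables (nu : 'rV[R]_m -> 'rV[R]_(m + 1)) (c lambda : R).
Hypothesis nuU : unit_normal_on (line_metric h) f U nu.
Hypothesis trA : forall x, U x -> \tr (shape_operator g (line_metric h) f nu x) = c.
Hypothesis vertical : forall x, U x -> rsubmx (nu x) = 0 /\
  \tr (shape_operator g (line_metric h) f nu x *m shape_operator g (line_metric h) f nu x)
    = mu - lambda.
Hypothesis dim : m = (k + 1)%N.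
Variables (Z : set 'rV[R]_k) (G : 'rV[R]_k -> 'rV[R]_m) (gN : 'rV[R]_k -> 'M[R]_k).
Hypotheses (gZ : metric_on Z gN) (gNE : forall z, Z z -> gN z = pullback_metric g G z).
Hypotheses (sG : smooth_on Z G) (ZU : forall z, Z z -> U (G z)).
Variable t0 : 'rV[R]_1.
Hypothesis level : forall z, Z z -> rsubmx (f (G z)) = t0.

Let hQ := metric_on_line hW.
Let psi z := lsubmx (f (G z)).
Let nuN z := lsubmx (nu (G z)).
Let oZ : open Z. Proof. by case: gZ. Qed.
Let oU : open U. Proof. by case: gU. Qed.
Let cf j : ck j U f. Proof. by move/smooth_onP : sf; apply. Qed.
Let cG j : ck j Z G. Proof. by move/smooth_onP : sG; apply. Qed.
Let cnu j : ck j U nu. Proof. by case: nuU => /smooth_onP + _ _; apply. Qed.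
Let dG z : Z z -> differentiable G z. Proof. exact: (ck_diff (cG 0)). Qed.
Let df x : U x -> differentiable f x. Proof. exact: (ck_diff (cf 0)). Qed.
Let dnu x : U x -> differentiable nu x. Proof. exact: (ck_diff (cnu 0)). Qed.
Let dfG z : Z z -> differentiable (fun z => f (G z)) z.
Proof. by move=> Zz; apply: differentiable_comp; [exact: dG|exact/df/ZU]. Qed.

Let DfG z a : Z z -> 'D_('e_a) (fun z => f (G z)) z = row a (jac G z) *m jac f (G z).
Proof.
move=> Zz; rewrite (derive_comp _ (dG Zz) (df (ZU Zz))) -/(partial a G z) -row_jac.
by rewrite derive_jac//; exact/df/ZU.
Qed.

Let rDfG z a : Z z -> rsubmx (row a (jac G z) *m jac f (G z)) = 0.
Proof.
move=> Zz; rewrite -DfG// -(derive_rsubmx (diff_derivable (dfG Zz))).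
exact: derive_const_on oZ Zz level.
Qed.

Let partial_psi z a : Z z -> partial a psi z = lsubmx (row a (jac G z) *m jac f (G z)).
Proof. by move=> Zz; rewrite -DfG//; exact: (derive_lsubmx (diff_derivable (dfG Zz))). Qed.

Let inner_horizontal y u v : rsubmx v = 0 ->
  inner (h (lsubmx y)) (lsubmx u) (lsubmx v) = inner (line_metric h y) u v.
Proof. by move=> v0; rewrite /line_metric inner_block v0 inner0r addr0. Qed.

Lemma slice_pullback z : Z z -> pullback_metric h psi z = gN z.
Proof.
move=> Zz; apply: etrans _ (esym (etrans (gNE Zz) (pullback_metric_jac g G z))).
apply/matrixP => a b.
apply: etrans (mxE _ _ _ _) _; rewrite !partial_psi// inner_horizontal ?rDfG//.
by rewrite -inner_row gE ?inner_pullback//; exact: ZU.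
Qed.

Let spsi j : ck j Z psi.
Proof. by apply: ck_lsubmx => //; apply: (ck_comp_mx oZ oU ZU). Qed.

Let ZW z : Z z -> W (psi z).
Proof. by move=> Zz; exact: (UW (ZU Zz)). Qed.

Lemma slice_unit_normal : unit_normal_on h psi Z nuN.
Proof.
have [_ nn np] := nuU; split.
- by apply/smooth_onP => j; apply: ck_lsubmx => //; apply: (ck_comp_mx oZ oU ZU).
- move=> z Zz; have [r0 _] := vertical (ZU Zz).
  by rewrite inner_horizontal ?nn//; exact: ZU.
- move=> z a Zz; have [r0 _] := vertical (ZU Zz).
  rewrite partial_psi// inner_horizontal// mulmx_sum_row inner_suml big1// => i _.
  by rewrite innerZl (row_jac f) np ?mulr0//; exact: ZU.
Qed.

(** By [cov_line] the horizontal part commutes with covariant derivatives. The tangent vectors of a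
    slice are horizontal, so pairing with them loses nothing, and the form is the restriction of
    that of [f]. *)
Let second_form_slice z : Z z -> second_form h psi nuN z =
  jac G z *m second_form (line_metric h) f nu (G z) *m (jac G z)^T.
Proof.
move=> Zz; have Uz := ZU Zz; apply/matrixP => a b.
apply: etrans (mxE _ _ _ _) _; rewrite -inner_row.
have E : cov h psi 'e_a nuN z = lsubmx (cov (line_metric h) f (row a (jac G z)) nu (G z)).
  have dnuG : differentiable (fun z => nu (G z)) z.
    by apply: differentiable_comp; [exact: dG|exact: dnu].
  have e := cov_line hW ('e_a : 'rV[R]_k) (f := fun z => f (G z)) (UW Uz) (dfG Zz) dnuG.
  apply: etrans (esym (etrans (f_equal lsubmx e) (row_mxKl _ _))) (f_equal lsubmx _).
  rewrite row_jac; exact: cov_comp (dG Zz) (df Uz) (dnu Uz).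
rewrite E partial_psi// inner_horizontal ?rDfG//.
rewrite (cov_expand _ _ (df Uz) (dnu Uz)) inner_suml inner_expand -sumrN.
apply: eq_bigr => i _; rewrite innerZl mulmx_sum_row inner_sumr mulr_sumr -sumrN.
apply: eq_bigr => j _; rewrite innerZr (row_jac f).
by rewrite [second_form _ _ _ _ _ _]mxE; ring.
Qed.

(** [nu] stays horizontal on [U], so its covariant derivatives are horizontal and orthogonal to
    [dt]. *)
Let second_form_vertical x T : U x -> T *m jac f x = dt ->
  second_form (line_metric h) f nu x *m T^T = 0.
Proof.
move=> Ux TE; apply/matrixP => i j; rewrite ord1 [RHS]mxE.
have sQ : (line_metric h (f x))^T = line_metric h (f x) by case: hQ => _ _ + _; apply; exact: UW.
have rN : rsubmx (cov (line_metric h) f 'e_i nu x) = 0.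
  rewrite (cov_line hW 'e_i (UW Ux) (df Ux) (dnu Ux)) row_mxKr.
  have rn y : U y -> rsubmx (nu y) = 0 by move=> /vertical[].
  exact: derive_const_on oU Ux rn.
have : inner (line_metric h (f x)) (cov (line_metric h) f 'e_i nu x) dt = 0.
  by rewrite (innerC _ _ sQ) inner_dt rN mxE.
rewrite -TE mulmx_sum_row inner_sumr => e.
rewrite mxE -[RHS]oppr0 -[in RHS]e -sumrN; apply: eq_bigr => l _.
by rewrite innerZr row_jac [second_form _ _ _ _ _ _]mxE [T^T _ _]mxE mulNr mulrC.
Qed.

Let trace_slice_shape z : Z z ->
  \tr (shape_operator gN h psi nuN z) = c /\
  \tr (shape_operator gN h psi nuN z *m shape_operator gN h psi nuN z) = mu - lambda.
Proof.
move=> Zz; have Uz := ZU Zz.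
have [T TE] := vertical_direction hW gU gE UW nuU Uz (vertical Uz).1.
have BT := second_form_vertical Uz TE.
have [_ _ sg _] := gU.
have gu u v : inner (g (G z)) u v =
    inner (line_metric h (f (G z))) (u *m jac f (G z)) (v *m jac f (G z)).
  by rewrite gE// inner_pullback.
have TT : inner (g (G z)) T T = 1 by rewrite gu TE inner_dt row_mxKr mxE eqxx.
have sQ : (line_metric h (f (G z)))^T = line_metric h (f (G z)).
  by case: hQ => _ _ + _; apply; exact: UW.
have JT a : inner (g (G z)) (row a (jac G z)) T = 0.
  by rewrite gu TE (innerC _ _ sQ) inner_dt rDfG// mxE.
have uN : jac G z *m g (G z) *m (jac G z)^T \in unitmx.
  by rewrite -pullback_metric_jac -gNE//; exact: (metric_unit gZ).
have [e1 e2] := trace_slice dim (sg _ Uz) (metric_unit gU Uz) TT JT uN BT.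
have sE : shape_operator gN h psi nuN z =
    jac G z *m second_form (line_metric h) f nu (G z) *m (jac G z)^T *m
    invmx (jac G z *m g (G z) *m (jac G z)^T).
  by rewrite -second_form_slice// -pullback_metric_jac -gNE.
rewrite sE; split; first by apply: etrans (esym e1) (trA Uz).
by apply: etrans (esym e2) _; have [_] := vertical Uz.
Qed.

(** Both components of the bitension are used in the converse direction: in an Einstein metric the
    tangential one vanishes, and the normal one is c(mu - |A|^2) = c lambda. *)
Lemma slice_biharmonic z : Z z ->
  bitension gN h psi z - lambda *: tension gN h psi z = 0.
Proof.
move=> Zz; have spsi' : smooth_on Z psi by apply/smooth_onP.
have gNE' y : Z y -> gN y = pullback_metric h psi y by move=> Zy; rewrite slice_pullback.
have [_ nn np] := slice_unit_normal.
have tr y : Z y -> \tr (shape_operator gN h psi nuN y) = c by move=> /trace_slice_shape[].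
have sh : (h (psi z))^T = h (psi z) by case: hW => _ _ + _; apply; exact: ZW.
have tE : tension gN h psi z = c *: nuN z.
  by rewrite (tension_hypersurface hW gZ gNE' spsi' ZW dim slice_unit_normal)// tr.
have ric u v : inner (ricci h (psi z)) u v = mu * inner (h (psi z)) u v.
  by rewrite (einstein_h (ZW Zz)) /inner -scalemxAr -scalemxAl mxE.
apply: (hypersurface_frame_eq0 hW gZ gNE' ZW dim slice_unit_normal Zz) => [l|].
  rewrite innerBl (bitension_tangent hW gZ gNE' spsi' ZW dim slice_unit_normal l Zz tr).
  rewrite tE !innerZl !ric np// (innerC _ _ sh) np//.
  by rewrite !mulr0 addr0 mulr0 subr0.
rewrite innerBl (bitension_normal hW gZ gNE' spsi' ZW dim slice_unit_normal Zz tr).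
rewrite tE !innerZl ric nn// (trace_slice_shape Zz).2; ring.
Qed.

End Slice.

(** * Local base of the cylinder *)

Section Straightening.
Context {R : realType}.

(** [K] drops a coordinate in which [v] is nonzero; on the hyperplane w v = 0 that coordinate is
    determined by the others. *)
Lemma hyperplane_coordinates k (v : 'cV[R]_k.+1) : v != 0 ->
  exists K : 'M[R]_(k.+1, k), forall w : 'rV_k.+1, w *m K = 0 -> w *m v = 0 -> w = 0.
Proof.
move=> v0; have [i vi] : exists i, v i 0 != 0.
  apply/existsP; apply: contraNT v0; rewrite negb_exists => /forallP H.
  apply/eqP/matrixP => i j; rewrite ord1 mxE; apply/eqP.
  by have := H i; rewrite negbK.
exists (\matrix_(a, j) (a == lift i j)%:R) => w wK wv.
have wl j : w 0 (lift i j) = 0.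
  have := congr1 (fun M : 'rV[R]_k => M 0 j) wK; rewrite /= !mxE => <-.
  rewrite (bigD1 (lift i j))//= mxE eqxx mulr1 big1 ?addr0// => a ai.
  by rewrite mxE (negbTE ai) mulr0.
have wi : w 0 i = 0.
  have := congr1 (fun M : 'M[R]_1 => M 0 0) wv; rewrite /= !mxE (bigD1 i)//= big1 ?addr0.
    by move=> /eqP; rewrite mulf_eq0 (negbTE vi) orbF => /eqP.
  move=> a; rewrite eq_sym => /unlift_some[j -> _]; by rewrite wl mul0r.
by apply/rowP => a; rewrite mxE; case: (unliftP i a) => [j ->|->].
Qed.

(** The maximum norm makes balls into boxes, so a ball in the coordinates (t, z) is an interval of
    heights times a ball of the base. *)
Lemma ball_row_mx a b (x : 'rV[R]_a) (y : 'rV[R]_b) r u v : 0 < r ->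
  ball (row_mx x y) r (row_mx u v) <-> ball x r u /\ ball y r v.
Proof.
move=> r0; split=> [[_ H]|[[_ H1] [_ H2]]].
  split; split=> // i j.
    by have := H i (lshift b j); rewrite !row_mxEl.
  by have := H i (rshift a j); rewrite !row_mxEr.
split=> // i j; rewrite !mxE.
by case: (fintype.split j) => l; [exact: H1|exact: H2].
Qed.

(* Coordinates adapted to a vertical hypersurface [f]: the height and [k]
   linear functions of the horizontal part of [f].  In them [f] is
   [(t, z) |-> (F z, t)]. *)
Lemma straightening k (W : set 'rV[R]_k.+1) h (U : set 'rV[R]_k.+1) f g nu x0 :
  metric_on W h -> metric_on U g ->
  (forall x, U x -> g x = pullback_metric (line_metric h) f x) ->
  smooth_on U f -> (forall x, U x -> line_domain W (f x)) ->
  unit_normal_on (line_metric h) f U nu ->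
  (forall x, U x -> rsubmx (nu x) = 0) -> U x0 ->
  exists (s : R) (t0 : 'rV[R]_1) (z0 : 'rV[R]_k) (X : set 'rV[R]_k.+1)
      (G : 'rV[R]_(1 + k) -> 'rV[R]_k.+1),
    let B := ball (row_mx t0 z0) s in
    [/\ 0 < s, [/\ open X, X x0 & X `<=` U],
      forall x, X x -> exists2 y, B y & G y = x,
      forall y, B y -> X (G y) /\ rsubmx (f (G y)) = lsubmx y &
      [/\ forall y y', B y -> B y' -> rsubmx y = rsubmx y' ->
            lsubmx (f (G y)) = lsubmx (f (G y')),
        smooth_on B G
      & exists2 u : 'rV[R]_k.+1 -> 'rV[R]_(1 + k),
          forall x, X x -> differentiable u x & forall y, B y -> u (G y) = y]].
Proof.
move=> hW gU gE sf UW nuU r0 Ux0.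
have oU : open U by case: gU.
have cf j : ck j U f by move/smooth_onP : sf; apply.
have [_ nn np] := nuU.
(* [K] is injective on horizontal vectors orthogonal to [nu x0]. The vector defining this hyperplane
   is nonzero because [nu x0] is a horizontal unit vector. *)
have [K HK] : exists K : 'M[R]_(k.+1, k), forall w : 'rV_k.+1, w *m K = 0 ->
    w *m (h (lsubmx (f x0)) *m (lsubmx (nu x0))^T) = 0 -> w = 0.
  apply: hyperplane_coordinates; apply/eqP => v0.
  have := nn x0 Ux0; rewrite /line_metric inner_block r0// inner0l addr0.
  by rewrite /inner -mulmxA v0 mulmx0 mxE => /esym/eqP; rewrite oner_eq0.
pose u x : 'rV[R]_(1 + k) := row_mx (rsubmx (f x)) (lsubmx (f x) *m K).
have cu j : ck j U u.
  apply: ck_row_mx => //; first exact: ck_rsubmx.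
  by apply: ck_mulmx => //; [exact: ck_lsubmx|exact: ck_cst].
have su : smooth_on U u by apply/smooth_onP.
have Du x (v : 'rV[R]_k.+1) : U x ->
    v *m jac u x = row_mx (rsubmx (v *m jac f x)) (lsubmx (v *m jac f x) *m K).
  move=> Ux; have dfx := ck_diff (cf 0%N) Ux; have dux := ck_diff (cu 0%N) Ux.
  rewrite -(derive_jac v dfx) -(derive_jac v dux); have d := derivableP (diff_derivable (v := v) dfx).
  have Hl := is_derive_mulmx (is_derive_lsubmx d) (is_derive_cst K x v).
  rewrite mulmx0 addr0 in Hl; have Hr := is_derive_rsubmx d.
  suff : is_derive x v u (row_mx (rsubmx ('D_v f x)) (lsubmx ('D_v f x) *m K)) by case.
  apply/is_derive_mxP => i j; rewrite /u; under eq_fun do rewrite mxE.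
  rewrite mxE; case: (fintype.split j) => l.
    by move/is_derive_mxP : Hr; apply.
  by move/is_derive_mxP : Hl; apply.
have inj_f x (v : 'rV[R]_k.+1) : U x -> v *m jac f x = 0 -> v = 0.
  move=> Ux v0; have [//|vn0] := eqVneq v 0.
  have [_ _ _ posg] := gU; have := posg x v Ux vn0.
  by rewrite gE// inner_pullback v0 inner0l ltxx.
have unit0 : jac u x0 \in unitmx.
  apply: unitmx_kernel => v; rewrite Du// => v0.
  have rv : rsubmx (v *m jac f x0) = 0.
    by have := congr1 (@lsubmx R 1 1 k) v0; rewrite row_mxKl => ->; apply/matrixP => i j; rewrite !mxE.
  have lv : lsubmx (v *m jac f x0) *m K = 0.
    by have := congr1 (@rsubmx R 1 1 k) v0; rewrite row_mxKr => ->; apply/matrixP => i j; rewrite !mxE.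
  apply: (inj_f x0) => //; rewrite -[v *m _]hsubmxK rv.
  suff -> : lsubmx (v *m jac f x0) = 0 by rewrite row_mx0.
  apply: HK => //; apply/matrixP => i j; rewrite !ord1 [RHS]mxE mulmxA.
  have : inner (line_metric h (f x0)) (v *m jac f x0) (nu x0) = 0.
    rewrite mulmx_sum_row inner_suml big1// => l _.
    by rewrite innerZl row_jac np// mulr0.
  by rewrite /line_metric inner_block rv inner0l addr0.
have [r [s [G [[r_gt0 rU] s0 unit_u GE [GK sG]]]]] := inverse_function oU Ux0 su unit0.
pose t0 := rsubmx (f x0); pose z0 := lsubmx (f x0) *m K.
have ux0 : u x0 = row_mx t0 z0 by [].
pose B := ball (row_mx t0 z0) s.
(* Intersecting with the preimage of [B] makes [G] a bijection from [B] onto [X] with inverse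
   [u]. *)
pose X := ball x0 r `&` [set x | B (u x)].
have oB : open B by exact: ball_open.
have XU : X `<=` U by move=> x [/rU].
have oX : open X.
  have obr : open (ball x0 r) by exact: ball_open.
  move=> x [bx Bx]; apply: filterI; first exact: open_nbhs_nbhs.
  have cux : {for x, continuous u}.
    by apply: differentiable_continuous; apply: ck_diff (cu 0%N) (rU _ bx).
  by apply: cux; exact: open_nbhs_nbhs.
have BG y : B y -> X (G y) /\ u (G y) = y.
  by move=> By; have [bG uG] := GE y By; split=> //; split=> //=; rewrite uG.
have rG y : B y -> rsubmx (f (G y)) = lsubmx y.
  by move=> /BG[_ e]; rewrite -[in RHS]e row_mxKl.
have cG : ck 0 B G by move/smooth_onP : sG; apply.
exists s, t0, z0, X, G; split => //.
- split => //; split; first exact: ballxx.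
  by rewrite /= ux0; exact: ballxx.
- move=> x [bx Bx]; exists (u x) => //; exact: GK.
- by move=> y By; split; [case: (BG y By)|exact: rG].
split=> //; last first.
  exists u; last by move=> y /BG[].
  by move=> x /XU Ux; exact: ck_diff (cu 0%N) Ux.
move=> y y' By By' ryy'; apply/rowP => j.
pose e0 : 'rV[R]_(1 + k) := row_mx 1%:M 0.
have yy' : y' - y = (lsubmx y' 0 0 - lsubmx y 0 0) *: e0.
  rewrite -[y']hsubmxK -[y]hsubmxK ryy' opp_row_mx add_row_mx subrr.
  rewrite scale_row_mx scaler0 !row_mxKl; congr row_mx.
  by apply/matrixP => a b; rewrite !ord1 !mxE eqxx mulr1.
pose F w := lsubmx (f (G w)) 0 j.
have cfG : ck 0 B (fun w => lsubmx (f (G w))).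
  by apply: ck_lsubmx => //; apply: (ck_comp_mx oB oU _ (cf 0%N) cG) => w /BG[/XU].
have dF w : B w -> differentiable F w.
  by move=> Bw; have /differentiable_mxP := ck_diff cfG Bw; apply.
(* [jac u] sends both ['D_e0 G w] and the tangent vector [T] lying over [dt] to [e0]. It is
   invertible, so the two agree, and the composite of [f] and [G] moves vertically along [e0]. *)
have flat w : B w -> 'D_e0 F w = 0.
  move=> Bw; have [XG uG] := BG w Bw; have UG := XU _ XG.
  have [T TE] := vertical_direction hW gU gE UW nuU UG (r0 _ UG).
  have dGw := ck_diff cG Bw; have dfw := ck_diff (cf 0%N) UG; have duw := ck_diff (cu 0%N) UG.
  have e : 'D_e0 G w *m jac u (G w) = T *m jac u (G w).
    rewrite (Du _ T)// TE row_mxKl row_mxKr mul0mx -derive_jac// -derive_comp//.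
    apply: etrans _ (derive_id w e0); apply: near_eq_derive; apply: (near_open oB Bw).
    by move=> z /BG[].
  have DG : 'D_e0 G w = T.
    by have uu := unit_u _ XG.1; rewrite -[LHS](mulmxK uu) e mulmxK.
  have dfG : differentiable (fun w => f (G w)) w by apply: differentiable_comp.
  have Dl : 'D_e0 (fun w => lsubmx (f (G w))) w = 0.
    by rewrite (derive_lsubmx (diff_derivable dfG)) derive_comp// DG derive_jac// TE row_mxKl.
  have := derive_mx (diff_derivable (v := e0) (ck_diff cfG Bw)); rewrite Dl.
  by move=> /matrixP/(_ 0 j); rewrite !mxE => <-.
(* [B] is convex, so the mean value theorem applies on the segment from [y] to [y']. *)
have dline (t : R) : 0 <= t <= 1 -> differentiable F (t *: (y' - y) + y).
  by move=> t01; apply: dF; exact: segment_ball.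
have [t [t01 e]] := mvt_line dline; rewrite subrK in e.
have Bt : B (t *: (y' - y) + y) by exact: segment_ball.
have D0 : 'D_(y' - y) F (t *: (y' - y) + y) = 0.
  apply: etrans (f_equal (fun v => 'D_v F (t *: (y' - y) + y)) yy') _.
  apply: etrans (deriveZ_dir _ _ (dF _ Bt)) _.
  by apply: etrans (f_equal ( *:%R _) (flat _ Bt)) _; rewrite scaler0.
by move/eqP: (etrans e D0); rewrite subr_eq0 => /eqP/esym.
Qed.

End Straightening.

Section BallManifold.
Context {R : realType} {k : nat}.

(** The base consists of balls with rational centres and radii 1/(n+1). *)
Lemma second_countable_rV : @second_countable 'rV[R]_k.
Proof.
pose F (p : 'rV[rat]_k * nat) : set 'rV[R]_k := ball (map_mx (ratr : rat -> R) p.1 : 'rV[R]_k) p.2.+1%:R^-1.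
exists (F @` setT).
  by apply: card_le_trans (card_image_le _ _) _; exact: countableP.
split=> [_ [p _ <-]|x A /nbhs_ballP[e /= e0 eA]].
  by apply: ball_open.
have [n ne] : exists n : nat, (n.+1%:R^-1 : R) < e / 2.
  have e2 : 0 < e / 2 by rewrite divr_gt0.
  have [n _ H] := near_infty_natSinv_lt (PosNum e2).
  by exists n; apply: (H n); exact: leqnn.
have n0 : 0 < (n.+1%:R^-1 : R) by rewrite invr_gt0.
have [q Hq] : exists q : 'rV[rat]_k, forall i, `|ratr (q 0 i) - x 0 i| < n.+1%:R^-1.
  have H i : exists r : rat, `|ratr r - x 0 i| < n.+1%:R^-1.
    have lt : x 0 i - n.+1%:R^-1 < x 0 i + n.+1%:R^-1.
      by rewrite ltrD2l; apply: lt_trans n0; rewrite oppr_lt0.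
    have [r] := rat_in_itvoo lt; rewrite in_itv /= => /andP[r1 r2].
    by exists r; rewrite ltr_distl r1 r2.
  exists (\row_i xchoose (H i)) => i; rewrite mxE; exact: (xchooseP (H i)).
exists (F (q, n)).
  split; first by exists (q, n).
  by split=> // i j; rewrite ord1 mxE -ball_normE; exact: Hq.
move=> y [_ Fy]; apply: eA; split=> // i j; rewrite ord1 -ball_normE /ball_/=.
have := Fy 0 j; rewrite mxE -ball_normE /ball_/= => h.
rewrite -(subrK (ratr (q 0 j)) (x 0 j)) -addrA (le_lt_trans (ler_normD _ _))//.
rewrite [X in _ < X]splitr ltrD//; last exact: lt_trans h ne.
by rewrite distrC; exact: lt_trans (Hq j) ne.
Qed.

(** The space is a union of lines through the origin. *)
Lemma connected_rV : connected [set: 'rV[R]_k].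
Proof.
have -> : [set: 'rV[R]_k] = \bigcup_(v in setT) ((fun t : R => t *: v) @` setT).
  by apply/seteqP; split=> v // _; exists v => //; exists 1 => //; rewrite scale1r.
apply: bigcup_connected => [|v _].
  by exists 0 => v _; exists 0 => //; rewrite scale0r.
apply: connected_continuous_connected; first exact/connected_intervalP.
by apply: continuous_subspaceT => t; exact: scalel_continuous.
Qed.

Variables (z0 : 'rV[R]_k) (s : R).

(** The radial map x/(1 + |x|) onto the unit ball, rescaled; its inverse is w/(1 - |w|). A chart has
    to be a homeomorphism, and with a single chart the transition map is the identity. *)
Definition ball_coord (x : 'rV[R]_k) : 'rV[R]_k := z0 + s *: ((1 + `|x|)^-1 *: x).

Definition ball_param (z : 'rV[R]_k) : 'rV[R]_k :=
  let w := s^-1 *: (z - z0) in (1 - `|w|)^-1 *: w.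

Hypothesis s0 : 0 < s.

Let D0 (x : 'rV[R]_k) : 0 < 1 + `|x|.
Proof. by rewrite ltr_pwDl. Qed.

Lemma ball_coordK : cancel ball_coord ball_param.
Proof.
move=> x; have e : s^-1 *: (ball_coord x - z0) = (1 + `|x|)^-1 *: x.
  by rewrite /ball_coord addrAC subrr add0r scalerA mulVf ?gt_eqF// scale1r.
rewrite /ball_param e normrZ gtr0_norm ?invr_gt0// scalerA.
have -> : 1 - (1 + `|x|)^-1 * `|x| = (1 + `|x|)^-1.
  by rewrite -{1}(mulVf (lt0r_neq0 (D0 x))) -mulrBr addrK mulr1.
by rewrite invrK mulfV ?scale1r// gt_eqF.
Qed.

Lemma ball_coord_in x : ball z0 s (ball_coord x).
Proof.
rewrite -ball_normE /ball_/= /ball_coord opprD addrA subrr add0r normrN !normrZ.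
rewrite (gtr0_norm s0) gtr0_norm ?invr_gt0// -[ltRHS]mulr1 ltr_pM2l//.
by rewrite mulrC ltr_pdivrMr// mul1r ltrDr.
Qed.

Lemma ball_paramK z : ball z0 s z -> ball_coord (ball_param z) = z.
Proof.
rewrite -ball_normE /ball_/= => zs; rewrite /ball_param /ball_coord.
set w := s^-1 *: (z - z0).
have w1 : `|w| < 1.
  by rewrite /w normrZ gtr0_norm ?invr_gt0// distrC mulrC ltr_pdivrMr// mul1r.
have d0 : 0 < 1 - `|w| by rewrite subr_gt0.
have -> : (1 + `|(1 - `|w|)^-1 *: w|)^-1 *: ((1 - `|w|)^-1 *: w) = w.
  rewrite normrZ gtr0_norm ?invr_gt0// scalerA.
  have -> : 1 + (1 - `|w|)^-1 * `|w| = (1 - `|w|)^-1.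
    by rewrite -{1}(mulVf (lt0r_neq0 d0)) -mulrDr subrK mulr1.
  by rewrite invrK mulfV ?gt_eqF// scale1r.
by rewrite /w scalerA mulfV ?gt_eqF// scale1r addrC subrK.
Qed.

Lemma continuous_ball_coord : continuous ball_coord.
Proof.
move=> x.
have c1 : (fun y : 'rV[R]_k => 1 + `|y|) @ x --> 1 + `|x|.
  have c := @cvgD _ _ _ (nbhs x) _ (cst (1 : R)) (fun y : 'rV[R]_k => `|y|) _ _
    (cvg_cst (1 : R)) (@norm_continuous _ _ x).
  exact: c.
have c2 : (fun y : 'rV[R]_k => (1 + `|y|)^-1) @ x --> (1 + `|x|)^-1.
  exact: (cvgV (lt0r_neq0 (D0 x)) c1).
have c3 : (fun y : 'rV[R]_k => (1 + `|y|)^-1 *: y) @ x --> (1 + `|x|)^-1 *: x.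
  exact: (cvgZ c2 (@cvg_id _ (nbhs x))).
exact: (cvgD (f := fun=> z0) (cvg_cst z0) (cvgZ (s := fun=> s) (cvg_cst s) c3)).
Qed.

Lemma continuous_ball_param : {within ball z0 s, continuous ball_param}.
Proof.
rewrite continuous_open_subspace; last exact: ball_open.
move=> z; rewrite inE -ball_normE /ball_/= => zs.
have cw : (fun y : 'rV[R]_k => s^-1 *: (y - z0)) @ z --> s^-1 *: (z - z0).
  have c : (fun y : 'rV[R]_k => y - z0) @ z --> z - z0.
    exact: (cvgB (g := fun=> z0) (@cvg_id _ (nbhs z)) (cvg_cst z0)).
  exact: (cvgZ (s := fun=> s^-1) (cvg_cst s^-1) c).
have d0 : 1 - `|s^-1 *: (z - z0)| != 0.
  rewrite gt_eqF// subr_gt0 normrZ gtr0_norm ?invr_gt0// distrC mulrC.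
  by rewrite ltr_pdivrMr// mul1r.
have c1 : (fun y : 'rV[R]_k => 1 - `|s^-1 *: (y - z0)|) @ z --> 1 - `|s^-1 *: (z - z0)|.
  have c := @cvgB _ _ _ (nbhs z) _ (cst (1 : R)) _ _ _ (cvg_cst (1 : R)) (cvg_norm cw).
  exact: c.
exact: (cvgZ (cvgV d0 c1) cw).
Qed.

Variable gN : 'rV[R]_k -> 'M[R]_k.

(* A ball of ['rV_k] with the metric [gN], as a manifold with carrier ['rV_k]:
   the only chart maps ['rV_k] homeomorphically onto the ball. *)
Definition ball_manifold : riemData R k :=
  RiemData (carrier := 'rV[R]_k) (fun _ : unit => Chart setT ball_coord ball_param)
    (fun _ => gN).

Lemma img_ball_manifold (c : idx ball_manifold) : img (chart_at c) = ball z0 s.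
Proof.
apply/seteqP; split=> [_ [x _ <-]|z zs]; first exact: ball_coord_in.
by exists (ball_param z) => //; exact: ball_paramK.
Qed.

Lemma riemannian_ball_manifold : metric_on (ball z0 s) gN -> riemannian_manifold ball_manifold.
Proof.
move=> [oB sg symg posg].
have domE (c d : idx ball_manifold) :
    loc_dom (id : ball_manifold -> ball_manifold) c d = ball z0 s.
  by rewrite /loc_dom img_ball_manifold; apply/seteqP; split=> [z []|z].
have locE (c d : idx ball_manifold) z : ball z0 s z ->
    loc (id : ball_manifold -> ball_manifold) c d z = z by exact: ball_paramK.
split; first split.
- exact: norm_hausdorff.
- exact: second_countable_rV.
- exact: connected_rV.
split; [split|split].
- move=> c; split; rewrite ?img_ball_manifold //=.
  + exact: openT.
  + by apply: continuous_subspaceT; exact: continuous_ball_coord.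
  + exact: continuous_ball_param.
  + by move=> p _; exact: ball_coordK.
- by move=> p; exists tt.
- split; first by move=> x.
  move=> c d; rewrite domE; apply/smooth_onP => j.
  by apply: (ck_ext oB _ (ck_id j oB)) => z zB; rewrite locE.
- by move=> c; rewrite img_ball_manifold.
- by move=> c x; rewrite img_ball_manifold; exact: symg.
- by move=> c x u; rewrite img_ball_manifold; exact: posg.
- move=> c d z; rewrite domE => zB; rewrite pullback_metric_jac locE//.
  have -> : jac (loc (id : ball_manifold -> ball_manifold) c d) z = 1%:M.
    apply/row_matrixP => i; rewrite row_jac row1 -[RHS](derive_id z).
    by apply: near_eq_derive; apply: (near_open oB zB) => y; exact: locE.
  by rewrite mul1mx trmx1 mulmx1.
Qed.

End BallManifold.

(** * Cylinders *)

Section ChartLemmas.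
Context {R : realType}.

Lemma metric_onS n (U V : set 'rV[R]_n) h : open V -> V `<=` U -> metric_on U h -> metric_on V h.
Proof.
move=> oV VU [_ /smooth_onP sh symh posh]; split=> //.
- by apply/smooth_onP => j; exact: ckS (sh j).
- by move=> x /VU; exact: symh.
- by move=> x u /VU; exact: posh.
Qed.

Lemma smooth_onS n (W : normedModType R) (U V : set 'rV[R]_n) (f : 'rV[R]_n -> W) :
  V `<=` U -> smooth_on U f -> smooth_on V f.
Proof. by move=> VU sf s x /VU; exact: sf. Qed.

Lemma metric_on_chart n (M : riemData R n) (c : idx M) :
  riemannian_manifold M -> metric_on (img (chart_at c)) (metric c).
Proof.
move=> [_ [[isc _ _] [sg symg posg _]]]; split.
- by case: (isc c).
- exact: sg.
- exact: symg.
- exact: posg.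
Qed.

Lemma open_loc_dom n q (M : riemData R n) (Q : riemData R q) (phi : M -> Q) c d :
  is_chart (chart_at c) -> open (dom (chart_at d)) -> continuous phi ->
  open (loc_dom phi c d).
Proof.
move=> [_ oi _ cp _] od cphi; rewrite openE => x [ix dx]; apply: filterI.
  exact: open_nbhs_nbhs.
have px : {for x, continuous (param (chart_at c))}.
  by move: cp; rewrite continuous_open_subspace// => /(_ x); rewrite inE; apply.
have cx : {for x, continuous (phi \o param (chart_at c))}.
  by apply: continuous_comp => //; exact: cphi.
by apply: cx; exact: open_nbhs_nbhs.
Qed.

End ChartLemmas.

Section Assembly.
Context {R : realType} {k : nat}.
Variables (L M : riemData R k.+1) (lambda H : R) (phi : M -> times_line L).
Hypotheses (RL : riemannian_manifold L) (EL : einstein L) (lambda0 : 0 <= lambda)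
  (RM : riemannian_manifold M) (bphi : biharmonic_hypersurface lambda phi)
  (Hphi : constant_mean_curvature phi H) (H0 : H != 0).

Let cphi : continuous phi. Proof. by case: bphi => -[_ [[]]]. Qed.
Let chartM c : is_chart (chart_at c : chart R M k.+1). Proof. by case: RM => _ [[]]. Qed.
Let chartL d : is_chart (chart_at d : chart R L k.+1). Proof. by case: RL => _ [[]]. Qed.

Let open_domL (d : idx L) : open (dom (chart_at (d : idx (times_line L)))).
Proof.
have [od _ _ _ _] := chartL d.
have -> : dom (chart_at (d : idx (times_line L))) = fst @^-1` dom (chart_at d).
  by apply/seteqP; split=> [[a b] []|[a b]].
by apply: open_comp => // x _; exact: cvg_fst.
Qed.

Let loc_domP (c : idx M) (d : idx (times_line L)) : open (loc_dom phi c d).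
Proof. exact: (open_loc_dom (chartM c) (@open_domL d) cphi). Qed.

Let lloc c (d : idx L) x :
  lsubmx (loc phi c (d : idx (times_line L)) x) = Defs.coord (chart_at d) (phi (param (chart_at c) x)).1.
Proof. by rewrite /loc row_mxKl. Qed.

Let rloc c (d : idx L) x :
  rsubmx (loc phi c (d : idx (times_line L)) x) = const_mx (phi (param (chart_at c) x)).2.
Proof. by rewrite /loc row_mxKr. Qed.

(** One [mu] serves all pairs of charts: the slice is built in one chart of [L] but has to be
    checked in every other, where the unit normal may be a different one. The factor [k.+1%:R]
    undoes the normalisation in [mean_curvature]. *)
Let cmc_vertical : exists mu,
  (forall (d : idx L) z, img (chart_at d) z -> ricci (metric d) z = mu *: metric d z) /\
  forall (c : idx M) (d : idx L) x,
  loc_dom phi c (d : idx (times_line L)) x ->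
  exists V nu, let f := loc phi c (d : idx (times_line L)) in
    let A := shape_operator (metric c) (line_metric (metric d)) f nu in
    [/\ [/\ open V, V x & V `<=` loc_dom phi c (d : idx (times_line L))],
       [/\ metric_on V (metric c), smooth_on V f,
           forall y, V y -> metric c y = pullback_metric (line_metric (metric d)) f y
         & forall y, V y -> line_domain (img (chart_at d)) (f y)],
       unit_normal_on (line_metric (metric d)) f V nu,
       forall y, V y -> \tr (A y) = H * k.+1%:R
     & forall y, V y -> rsubmx (nu y) = 0 /\ \tr (A y *m A y) = mu - lambda].
Proof.
have [mu ein] := EL; exists mu; split=> // c d x xd.
have [V [nu [oV Vx Vd nuV Hm]]] := Hphi xd; exists V, nu => f A.
have [[_ [[_ sphi] iphi]] bih] := bphi.
have gV : metric_on V (metric c).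
  by apply: metric_onS oV _ (metric_on_chart c RM) => y /Vd[].
have sf : smooth_on V f by apply: smooth_onS Vd (sphi c d).
have gE y : V y -> metric c y = pullback_metric (line_metric (metric d)) f y.
  by move=> /Vd /iphi.
have VW y : V y -> line_domain (img (chart_at d)) (f y).
  move=> /Vd[_ [dy _]]; rewrite /line_domain /= lloc.
  by exists (phi (param (chart_at c) y)).1.
have trA y : V y -> \tr (A y) = H * k.+1%:R.
  by move=> /Hm <-; rewrite /mean_curvature divfK// pnatr_eq0.
have HR0 : H * k.+1%:R != 0 by rewrite mulf_neq0// pnatr_eq0.
split=> //; move=> y Vy.
apply: (vertical_normal (metric_on_chart d RL) (ein d) gV gE sf VW nuV lambda0 HR0 trA) => // z Vz.
exact: bih (Vd _ Vz).
Qed.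

Theorem cmc_vertical_cylinder : vertical_cylinder_over_biharmonic lambda phi.
Proof.
have [mu [ein cmc]] := cmc_vertical.
move=> p.
have [c pc] : exists c : idx M, dom (chart_at c) p by case: RM => _ [[_ + _] _]; apply.
have [d pd] : exists d : idx L, dom (chart_at d) (phi p).1 by case: RL => _ [[_ + _] _]; apply.
have [ocM oiM ccM cpM coordK] := chartM c.
have [_ _ _ _ coordLK] := chartL d.
pose x0 := Defs.coord (chart_at c) p.
have xd : loc_dom phi c (d : idx (times_line L)) x0.
  by split; [exists p|rewrite /= coordK].
pose f := loc phi c (d : idx (times_line L)).
have [V [nu [[oV Vx Vd] [gV sf gE VW] nuV _ vV]]] := cmc c d x0 xd.
have r0 y : V y -> rsubmx (nu y) = 0 by move=> /vV[].
have [s [t0 [z0 [X [G [s0 [oX Xx XV] XG GX [flat sG [u du uG]]]]]]]] :=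
  straightening (metric_on_chart d RL) gV gE sf VW nuV r0 Vx.
set B := ball (row_mx t0 z0) s in XG GX flat sG uG.
pose Z := ball z0 s.
have oB : open B by exact: ball_open.
have oZ : open Z by exact: ball_open.
(* The slice at the central height [t0]. *)
pose Gs (w : 'rV[R]_k) := G (row_mx t0 w).
(* [E] is [Gs] on [Z]; composing with the chart makes [locE] below an equality of
   functions, valid outside [Z] as well. *)
pose E w := Gs (ball_coord z0 s (ball_param z0 s w)).
have rowB w : Z w -> B (row_mx t0 w).
  by move=> Zw; apply/(ball_row_mx _ _ _ _ s0); split=> //; exact: ballxx.
have EG w : Z w -> E w = G (row_mx t0 w) by move=> Zw; rewrite /E /Gs ball_paramK.
have cGs j : ck j Z Gs.
  have cr : ck j Z (fun w : 'rV[R]_k => row_mx t0 w : 'rV[R]_(1 + k)).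
    by apply: ck_row_mx => //; [exact: ck_cst|exact: ck_id].
  by apply: (ck_comp_mx oZ oB rowB _ cr); move/smooth_onP : sG; apply.
have cE j : ck j Z E by apply: (ck_ext oZ _ (cGs j)) => w Zw; rewrite EG.
have XE w : Z w -> X (E w) by move=> Zw; rewrite EG//; case: (GX _ (rowB _ Zw)).
have imgX x : X x -> img (chart_at c) x by move=> /XV/Vd[].
(* [u] recovers (t0, w) from [E w], so [E] has injective differential. *)
have immersion (w v : 'rV[R]_k) : Z w -> v *m jac E w = 0 -> v = 0.
  move=> Zw v0; have dE : differentiable E w by exact: ck_diff (cE 0%N) Zw.
  have D0 : 'D_v (fun w => u (E w)) w = 0.
    rewrite derive_comp//; last exact/du/XE.
    by rewrite (derive_jac v dE) v0 derive0.
  have D1 : 'D_v (fun w => u (E w)) w = row_mx 0 v.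
    have -> : 'D_v (fun w => u (E w)) w = 'D_v (fun w => row_mx t0 w : 'rV[R]_(1 + k)) w.
      apply: near_eq_derive; apply: (near_open oZ Zw) => y Zy.
      by rewrite EG// uG//; exact: rowB.
    suff : is_derive w v (fun w => row_mx t0 w : 'rV[R]_(1 + k)) (row_mx 0 v) by case.
    apply/is_derive_mxP => i j; under eq_fun do rewrite mxE; rewrite mxE.
    case: (fintype.split j) => l; first by rewrite mxE; exact: is_derive_cst.
    by have /is_derive_mxP := is_derive_id w v; apply.
  have := congr1 (@rsubmx R 1 1 k) (etrans (esym D1) D0).
  by rewrite row_mxKr => ->; apply/rowP => j; rewrite !mxE.
(* The metric induced from [M] by the slice; [slice_pullback] will show that [psi] induces the same
   one from [L]. *)
pose gN w := pullback_metric (metric c) E w.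
have [_ /smooth_onP sg symg posg] := metric_on_chart c RM.
have gZ : metric_on Z gN.
  split=> //.
  - apply/smooth_onP => j.
    have cJ : ck j Z (jac E) by apply: smooth_jac => //; apply/smooth_onP.
    have cg : ck j Z (fun w => metric c (E w)).
      by apply: (ck_comp_mx oZ oiM _ (sg j) (cE j)) => w /XE/imgX.
    apply: (ck_ext oZ _ (ck_mulmx oZ (ck_mulmx oZ cJ cg) (ck_tr oZ cJ))) => w _.
    by rewrite /gN pullback_metric_jac.
  - move=> w /XE/imgX ix.
    by rewrite /gN pullback_metric_jac !trmx_mul trmxK symg// mulmxA.
  - move=> w v Zw v0; rewrite /gN inner_pullback; apply: posg; first exact/imgX/XE.
    by apply: contra_neq v0; exact: immersion.
pose N := ball_manifold z0 s gN.
pose psi (q : N) : L := (phi (param (chart_at c) (Gs (ball_coord z0 s q)))).1.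
have RN : riemannian_manifold N by exact: riemannian_ball_manifold.
have locE (e : idx N) (d' : idx L) :
    loc psi e d' = fun z => lsubmx (loc phi c (d' : idx (times_line L)) (E z)).
  by apply/funext => z; rewrite lloc.
have locD (e : idx N) (d' : idx L) z : loc_dom psi e d' z ->
    Z z /\ loc_dom phi c (d' : idx (times_line L)) (E z).
  move=> [iz dz]; rewrite img_ball_manifold// in iz; split=> //; split; first exact/imgX/XE.
  by split.
have level (d' : idx L) z : Z z -> rsubmx (loc phi c (d' : idx (times_line L)) (E z)) = t0.
  move=> Zz; have [_] := GX _ (rowB _ Zz); rewrite row_mxKl => <-.
  by rewrite EG// !rloc.
have cpsi : continuous psi.
  move=> q; have Zq : Z (ball_coord z0 s q) by exact: ball_coord_in.
  have c1 : {for q, continuous (ball_coord z0 s)} by exact: continuous_ball_coord.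
  have c2 : {for ball_coord z0 s q, continuous Gs}.
    by apply: differentiable_continuous; exact: ck_diff (cGs 0%N) Zq.
  have ix : img (chart_at c) (Gs (ball_coord z0 s q)).
    by apply: imgX; have := XE _ Zq; rewrite EG.
  have c3 : {for Gs (ball_coord z0 s q), continuous (param (chart_at c))}.
    by move: cpM; rewrite continuous_open_subspace// => /(_ (Gs (ball_coord z0 s q))); rewrite inE; apply.
  have c4 := continuous_comp (continuous_comp c1 c2) c3.
  have c5 := continuous_comp c4 (@cphi _).
  exact: (continuous_comp c5 (@cvg_fst _ _ _ _ _)).
(* For a chart [d'] of [L] a fresh neighbourhood [V'] and unit normal [nu'] are taken near [E z],
   and the slice lemmas are applied on the part of [Z] that [E] sends into [V']. *)
have local_slice (e : idx N) (d' : idx L) z : loc_dom psi e d' z ->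
    metric e z = pullback_metric (metric d') (loc psi e d') z /\
    bitension (metric e) (metric d') (loc psi e d') z
      - lambda *: tension (metric e) (metric d') (loc psi e d') z = 0.
  move=> /[dup] dz /locD[Zz xd'].
  have [V' [nu' [[oV' Vx' Vd'] [gV' sf' gE' VW'] nuV' trA' vV']]] := cmc c d' (E z) xd'.
  pose Z' := Z `&` E @^-1` V'.
  have oZ' : open Z'.
    rewrite openE => w [Zw Vw]; apply: filterI; first exact: open_nbhs_nbhs.
    by apply: (differentiable_continuous (ck_diff (cE 0%N) Zw)); exact: open_nbhs_nbhs.
  have gZ' : metric_on Z' (metric e) by apply: metric_onS oZ' _ gZ => w [].
  have sE' : smooth_on Z' E by apply/smooth_onP => j; apply: ckS (cE j) => w [].
  have ZV' w : Z' w -> V' (E w) by case.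
  have lev w : Z' w -> rsubmx (loc phi c (d' : idx (times_line L)) (E w)) = t0.
    by case=> Zw _; exact: level.
  have Zz' : Z' z by [].
  have gNE w : Z' w -> metric e w = pullback_metric (metric c) E w by [].
  have dimk : k.+1 = (k + 1)%N by rewrite addn1.
  rewrite locE; split; first exact: (esym (slice_pullback gE' sf' gZ' gNE sE' ZV' lev Zz')).
  exact: (slice_biharmonic (metric_on_chart d' RL) (ein d') gV' gE' sf' VW' nuV' trA' vV' dimk
    gZ' gNE sE' ZV' lev Zz').
exists N, psi; split=> //.
  split.
    split=> //; split; last by move=> e d' z /local_slice[].
    split=> // e d'; rewrite locE; apply/smooth_onP => j.
    have oD : open (loc_dom psi e d').
      apply: open_loc_dom => //; first by case: RN => _ [[]].
      by case: (chartL d').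
    apply: ck_lsubmx => //.
    have [_ [[_ sphi] _]] := bphi.1.
    apply: (ck_comp_mx oD (@loc_domP c d') _ _ (ckS _ (cE j))).
    - by move=> z /locD[].
    - by have /smooth_onP := sphi c d'; apply.
    - by move=> z /locD[].
  by move=> e d' z /local_slice[].
have domG y : B y -> dom (chart_at d) (phi (param (chart_at c) (G y))).1.
  by move=> By; have [Xy _] := GX _ By; have [_ []] := Vd _ (XV _ Xy).
(* Equal coordinates give equal points of [L] because both points lie in the domain of the chart
   [d]. *)
have flatL y y' : B y -> B y' -> rsubmx y = rsubmx y' ->
    (phi (param (chart_at c) (G y))).1 = (phi (param (chart_at c) (G y'))).1.
  move=> By By' yy'; have := flat _ _ By By' yy'; rewrite !lloc => eqc.
  by rewrite -(coordLK _ (domG _ By)) eqc coordLK//; exact: domG.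
have timeL y : B y -> (const_mx (phi (param (chart_at c) (G y))).2 : 'M[R]_1) = lsubmx y.
  by move=> By; have [_] := GX _ By; rewrite rloc.
exists (dom (chart_at c) `&` Defs.coord (chart_at c) @^-1` X).
(* The first factor is all of [N], since the carrier of the ball manifold is the whole space; the
   second is the interval of heights covered by [B]. *)
exists (setT `*` ball (t0 0 0) s); split.
- rewrite openE => p' [dp' Xp']; apply: filterI; first exact: open_nbhs_nbhs.
  have cp' : {for p', continuous (Defs.coord (chart_at c))}.
    by move: ccM; rewrite continuous_open_subspace// => /(_ p'); rewrite inE; apply.
  by apply: cp'; exact: open_nbhs_nbhs.
- by split.
- rewrite openE => -[q t] [_ bt]; exists (setT, ball (t0 0 0) s).
    split; first exact: filterT.
    by apply: open_nbhs_nbhs; split=> //; exact: ball_open.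
  by move=> [? ?] [].
apply/seteqP; split.
  move=> _ [p' [dp' Xp'] <-]; have [y By Gy] := XG _ Xp'.
  have [bl br] : ball t0 s (lsubmx y) /\ ball z0 s (rsubmx y).
    by apply/(ball_row_mx _ _ _ _ s0); rewrite hsubmxK.
  have pE : param (chart_at c) (G y) = p' by rewrite Gy coordK.
  (* The base point is read off from the coordinates z, the height from [phi p'] itself. *)
  exists (ball_param z0 s (rsubmx y), (phi p').2).
    by split=> //=; case: bl => _ /(_ 0 0); rewrite -timeL// pE mxE.
  rewrite /= [RHS]surjective_pairing; congr pair.
  rewrite /psi /Gs ball_paramK// -[in RHS]pE; apply: flatL => //; first exact: rowB.
  by rewrite row_mxKr.
move=> _ [[q t] [_ bt] <-].
pose y : 'rV[R]_(1 + k) := row_mx (const_mx t) (ball_coord z0 s q).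
have Zq : Z (ball_coord z0 s q) by exact: ball_coord_in.
have By : B y.
  apply/(ball_row_mx _ _ _ _ s0); split=> //; split=> // i j.
  by rewrite mxE !ord1.
have [Xy _] := GX _ By; have [p' dp' cp'] := imgX _ Xy.
have pE : param (chart_at c) (G y) = p' by rewrite -cp' coordK.
exists p'; first by split=> //; rewrite /= cp'.
rewrite /= [LHS]surjective_pairing; congr pair.
  by rewrite -pE; apply: flatL => //; [exact: rowB|rewrite !row_mxKr].
by have := congr1 (fun A : 'M[R]_1 => A 0 0) (timeL _ By); rewrite row_mxKl !mxE pE.
Qed.

End Assembly.

Theorem theorem4p1 (R : realType) (m : nat) (hm : (0 < m)%N)
  (L M : riemData R m) (lambda H : R) (phi : M -> times_line L) :
  riemannian_manifold L ->
  einstein L ->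
  0 <= lambda ->
  riemannian_manifold M ->
  biharmonic_hypersurface lambda phi ->
  constant_mean_curvature phi H ->
  minimal phi \/ vertical_cylinder_over_biharmonic lambda phi.
Proof.
case: m hm L M phi => [//|k] _ L M phi RL EL lambda0 RM bphi Hphi.
have [H0|H0] := eqVneq H 0; first by left; rewrite /minimal -H0.
by right; exact: cmc_vertical_cylinder RL EL lambda0 RM bphi Hphi H0.
Qed.
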